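(* Let $(\Theta,d_\Theta)$ be a compact metric space and $(\mathcal{X},\|\cdot\|_{\mathcal{X}})$ a Banach space. Let $(X_i)_{i\in\mathbb{N}}$ be an i.i.d. sequence of Bochner-integrable Borel random elements in $\mathcal{C}(\Theta,\mathcal{X})$ on a probability space $(\Omega,\mathcal{F},\mathbb{P})$, and let $$S_n:=\frac{1}{\sqrt n}\sum_{i=1}^n\big(X_i-\mathbb{E}^B[X_i]\big),\quad n\in\mathbb{N}.$$ Let $C,t>0$ be constants such that $N(\Theta,d_\Theta,\eta)\le C\eta^{-t}$ for all $\eta\in\,]0,\Delta(\Theta)]$, and let $\|X_1\|_\infty$ be square integrable. Assume that there is a dense subset $\Theta'\subseteq\Theta$ such that $(S_n(\cdot,\theta))_{n\in\mathbb{N}}$ is a uniformly tight sequence of random elements in $\mathcal{X}$ for all $\theta\in\Theta'$, and that there exist $M,p>0$ as well as $q>t$ with $$\sup_{n\in\mathbb{N}}\mathbb{E}\big[\|S_n(\cdot,\theta)-S_n(\cdot,\vartheta)\|_{\mathcal{X}}^p\big]\le M\,d_\Theta(\theta,\vartheta)^q\quad\text{for }\theta,\vartheta\in\Theta.$$ Then the sequence $(S_n)_{n\in\mathbb{N}}$ converges weakly to a tight centered Gaussian random element in $\big(\mathcal{C}(\Theta,\mathcal{X}),\mathcal{B}(\mathcal{C}(\Theta,\mathcal{X}))\big)$.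
   Context: $\mathcal{C}(\Theta,\mathcal{X})$ is the Banach space of continuous maps $\Theta\to\mathcal{X}$ with sup-norm $\|f\|_\infty=\sup_{\theta}\|f(\theta)\|_{\mathcal{X}}$ and its Borel $\sigma$-algebra $\mathcal{B}(\mathcal{C}(\Theta,\mathcal{X}))$; separability is not assumed. Borel random elements are maps measurable w.r.t. the Borel $\sigma$-algebra. $\mathbb{E}^B$ denotes the Bochner integral. $S_n(\cdot,\theta)$ denotes $\omega\mapsto S_n(\omega)(\theta)$. A sequence $(Y_n)$ of Borel random elements in a metric space $S$ is uniformly tight if for every $\varepsilon>0$ there is a compact $K\subseteq S$ with $\sup_n\mathbb{P}(Y_n\notin K)\le\varepsilon$; a single random element is tight if its law is tight in this sense. A centered Gaussian random element in a Banach space is a Borel random element $G$ such that $\Lambda(G)$ is a centered (possibly degenerate) Gaussian random variable for every continuous linear functional $\Lambda$ into $\mathbb{R}$. Weak convergence is weak convergence of laws as Borel probability measures. $\Delta(\Theta)$ is the diameter of $\Theta$, and $N(\Theta,d_\Theta,\eta)$ is the minimal number of closed $d_\Theta$-balls of radius $\eta>0$ with centers in $\Theta$ needed to cover $\Theta$. $]a,b]$ denotes a half-open interval. *)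

(* Defs.v *)
From HB Require Import structures.
From mathcomp Require Import all_boot all_order all_algebra.
From mathcomp Require Import finmap.
From mathcomp Require Import all_classical all_reals all_analysis.

Set Implicit Arguments.
Unset Strict Implicit.
Unset Printing Implicit Defensive.

Import Order.TTheory GRing.Theory Num.Theory.
Import numFieldNormedType.Exports.

Local Open Scope classical_set_scope.
Local Open Scope ring_scope.

(* The compactness proof is a parameter of the type so that the supremum of
   |f| is finite, which is what makes it a norm. *)
Definition cspace (Theta : topologicalType) (R : realType)
    (E : normedModType R) (cTheta : compact [set: Theta]) : Type :=
  continuousType Theta E.

Section cspace_lmodule.
Context (Theta : topologicalType) (R : realType) (E : normedModType R).
Context (cTheta : compact [set: Theta]).
Local Notation C := (cspace E cTheta).

Definition mkcspace (f : Theta -> E) (cf : continuous f) : C :=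
  [the continuousType Theta E of mkcts cf].

Lemma cspace_continuous (f : C) : continuous f.
Proof. exact: (@cts_fun _ _ (f : continuousType Theta E)). Qed.

Lemma cspaceP (f g : C) : (forall x, f x = g x) -> f = g.
Proof. by move=> fg; apply/continuousEP. Qed.

HB.instance Definition _ := Choice.copy C (continuousType Theta E).

Let cst0_continuous : continuous (fun _ : Theta => 0 : E).
Proof. by move=> x; exact: cvg_cst. Qed.

Let opp_continuous (f : C) : continuous (fun x => - f x).
Proof. by move=> x; apply: cvgN; exact: cspace_continuous. Qed.

Let add_continuous (f g : C) : continuous (fun x => f x + g x).
Proof. by move=> x; apply: cvgD; exact: cspace_continuous. Qed.

Let scale_continuous (a : R) (f : C) : continuous (fun x => a *: f x).
Proof. by move=> x; apply: cvgZl_tmp; exact: cspace_continuous. Qed.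

Definition cspace0 : C := mkcspace cst0_continuous.
Definition cspace_opp f : C := mkcspace (@opp_continuous f).
Definition cspace_add f g : C := mkcspace (@add_continuous f g).
Definition cspace_scale a f : C := mkcspace (@scale_continuous a f).

Let addA : associative cspace_add.
Proof. by move=> f g h; apply/cspaceP => x; exact: addrA. Qed.
Let addC : commutative cspace_add.
Proof. by move=> f g; apply/cspaceP => x; exact: addrC. Qed.
Let add0 : left_id cspace0 cspace_add.
Proof. by move=> f; apply/cspaceP => x; exact: add0r. Qed.
Let addN : left_inverse cspace0 cspace_opp cspace_add.
Proof. by move=> f; apply/cspaceP => x; exact: addNr. Qed.

HB.instance Definition _ := GRing.isZmodule.Build C addA addC add0 addN.

Let scaleA a b (f : C) :
  cspace_scale a (cspace_scale b f) = cspace_scale (a * b) f.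
Proof. by apply/cspaceP => x; exact: scalerA. Qed.
Let scale1 : left_id 1 cspace_scale.
Proof. by move=> f; apply/cspaceP => x; exact: scale1r. Qed.
Let scaleDr : right_distributive cspace_scale +%R.
Proof. by move=> a f g; apply/cspaceP => x; exact: scalerDr. Qed.
Let scaleDl f : {morph cspace_scale^~ f : a b / a + b}.
Proof. by move=> a b; apply/cspaceP => x; exact: scalerDl. Qed.

HB.instance Definition _ :=
  GRing.Zmodule_isLmodule.Build R C scaleA scale1 scaleDr scaleDl.

Lemma cspace0E (x : Theta) : (0 : C) x = 0. Proof. by []. Qed.
Lemma cspaceDE (f g : C) (x : Theta) : (f + g) x = f x + g x.
Proof. by []. Qed.
Lemma cspaceNE (f : C) (x : Theta) : (- f) x = - f x. Proof. by []. Qed.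
Lemma cspaceZE (a : R) (f : C) (x : Theta) : (a *: f) x = a *: f x.
Proof. by []. Qed.

(* [sup set0 = 0], so this is also right when [Theta] is empty. *)
Definition cspace_norm (f : C) : R := sup (range (fun x => `|f x|)).

Let norm_ubound (f : C) : has_ubound (range (fun x => `|f x|)).
Proof.
have /compact_bounded : compact ((f : Theta -> E) @` [set: Theta]).
  apply: continuous_compact => //.
  by apply: continuous_subspaceT => x; exact: cspace_continuous.
case=> M [_ MP]; exists (M + 1) => _ [x _ <-].
by apply: (MP (M + 1)); [rewrite ltrDl|exists x].
Qed.

Lemma le_cspace_norm (f : C) (x : Theta) : `|f x| <= cspace_norm f.
Proof. by apply: ub_le_sup; [exact: norm_ubound|exists x]. Qed.

Let norm_ge0 (f : C) : 0 <= cspace_norm f.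
Proof.
have [[_ [x _ _]]|e] := pselect (range (fun x => `|f x|) !=set0).
  exact: le_trans (le_cspace_norm f x).
by rewrite /cspace_norm sup_out// => -[].
Qed.

Lemma cspace_norm_le (f : C) (M : R) :
  0 <= M -> (forall x, `|f x| <= M) -> cspace_norm f <= M.
Proof.
move=> M0 fM.
have [ne|e] := pselect (range (fun x => `|f x|) !=set0).
  by apply: ge_sup => // _ [x _ <-].
by rewrite /cspace_norm sup_out// => -[].
Qed.

Let ler_normD (f g : C) : cspace_norm (f + g) <= cspace_norm f + cspace_norm g.
Proof.
apply: cspace_norm_le => [|x]; first by rewrite addr_ge0.
by rewrite (le_trans (ler_normD _ _))// lerD// le_cspace_norm.
Qed.

Let normrZ (a : R) (f : C) : cspace_norm (a *: f) = `|a| * cspace_norm f.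
Proof.
have le (b : R) (g : C) : cspace_norm (b *: g) <= `|b| * cspace_norm g.
  apply: cspace_norm_le => [|x]; first by rewrite mulr_ge0.
  by rewrite cspaceZE normrZ ler_wpM2l// le_cspace_norm.
apply/eqP; rewrite eq_le le/=.
have [->|a0] := eqVneq a 0; first by rewrite normr0 mul0r.
rewrite -ler_pdivlMl ?normr_gt0//.
have {1}-> : f = a^-1 *: (a *: f) by rewrite scalerA mulVf// scale1r.
by rewrite (le_trans (le _ _))// normfV.
Qed.

Let normr0_eq0 (f : C) : cspace_norm f = 0 -> f = 0.
Proof.
move=> f0; apply/cspaceP => x; apply/eqP; rewrite -normr_le0 -f0.
exact: le_cspace_norm.
Qed.

HB.instance Definition _ :=
  Lmodule_isNormed.Build R C ler_normD normrZ normr0_eq0.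

Lemma cspace_normE (f : C) : `|f| = sup (range (fun x => `|f x|)).
Proof. by []. Qed.

End cspace_lmodule.

Section cspace_complete.
Context (Theta : topologicalType) (R : realType).
Context (E : completeNormedModType R) (cTheta : compact [set: Theta]).
Local Notation C := (cspace E cTheta).

Let cauchy_cvg (F : set_system C) : ProperFilter F -> cauchy F -> cvg F.
Proof.
move=> FF /cauchy_ballP Fc.
pose G : set_system (arrow_uniform_type Theta E) :=
  (fun f : C => (f : Theta -> E)) @ F.
have /cauchy_cvg/cvg_ex[g Gg] : cauchy G.
  apply/cauchy_ballP => e e0; have [[A B] /= [FA FB] AB] := Fc e e0.
  exists ([set h : Theta -> E | exists2 f : C, A f & h = f],
          [set h : Theta -> E | exists2 f : C, B f & h = f]) => /=.
    by split; [move: FA|move: FB]; apply: filterS => f Af; exists f.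
  move=> [_ _] /= [[a Aa ->] [b Bb ->]] t.
  have := AB (a, b) (conj Aa Bb); rewrite -!ball_normE/=.
  exact: le_lt_trans (le_cspace_norm (a - b) t).
have cg : continuous g.
  apply: (@uniform_limit_continuous _ _ G); last by rewrite uniform_nbhsT.
  by apply: (@filterS _ F) filterT => f _; exact: cspace_continuous.
apply/cvg_ex; exists (mkcspace cTheta cg).
apply/(@cvgrPdist_le _ _ C F FF id) => e e0.
move/cvg_fct_entourageP : Gg => /(_ _ (entourage_ball _ (PosNum e0))).
move=> fg; apply: (@filterS _ F) fg => f fg.
apply: cspace_norm_le => [|t]; first exact: ltW.
by have := fg t; rewrite -ball_normE/= => /ltW.
Qed.

HB.instance Definition _ := Uniform_isComplete.Build C cauchy_cvg.

End cspace_complete.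

Section metric.
Context (R : realType) (Theta : metricType R).
Local Open Scope ereal_scope.

Definition diameter : R := sup [set mdist z.1 z.2 | z in [set: Theta * Theta]].

Definition is_net (eta : R) (s : seq Theta) : Prop :=
  forall x, exists2 c, c \in s & (mdist c x <= eta)%R.

(* Equal to [+oo] when no finite cover exists. *)
Definition covering_number (eta : R) : \bar R :=
  ereal_inf [set (size s)%:R%:E | s in is_net eta].

End metric.

Definition borel (T : ptopologicalType) : Type := g_sigma_algebraType (@open T).
HB.instance Definition _ (T : ptopologicalType) :=
  Measurable.copy (borel T) (g_sigma_algebraType (@open T)).

Lemma continuous_measurable_borel (S T : ptopologicalType) (f : S -> T) :
  continuous f -> measurable_fun [set: borel S] (f : borel S -> borel T).
Proof.
move=> /continuousP cf.
apply: (@measurability _ _ (borel S) (borel T) setT f (@open T) erefl).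
move=> _ [B oB <-].
by rewrite setTI; apply: sub_sigma_algebra; exact: cf.
Qed.

Section bochner.
Context d (T : measurableType d) (R : realType) (P : probability T R).
Context (E : completeNormedModType R).
Implicit Types (f : T -> E) (s : nat -> T -> E).
Local Open Scope ereal_scope.

(* The library's [{sfun T >-> R}] is for real-valued functions only. *)
Definition simple_fun (g : T -> E) : Prop :=
  finite_set (range g) /\ forall y, measurable (g @^-1` [set y]).

Definition simple_integral (g : T -> E) : E :=
  (\sum_(y \in range g) fine (P (g @^-1` [set y])) *: y)%R.

Definition bochner_approx f s : Prop :=
  [/\ forall n, simple_fun (s n),
      {ae P, forall w, s n w @[n --> \oo] --> f w} &
      \int[P]_w (`|f w - s n w|)%:E @[n --> \oo] --> 0].

Definition bochner_integrable f : Prop := exists s, bochner_approx f s.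

(* The limit of the integrals exists and is the same for all approximating
   sequences; [get] selects it (and is a default value when [f] is not
   integrable). *)
Definition bochner_integral f : E :=
  get [set y | exists2 s, bochner_approx f s &
                          simple_integral (s n) @[n --> \oo] --> y].

(* [X 0] is the first term of the sequence and the sum has [n] terms.  As [E]
   need not be separable, a sum of Borel maps need not be Borel; since Bochner
   integrable maps are almost surely separably valued, the normalized sum still
   agrees almost surely with a Borel map, which is then the random element. *)
Definition normalized_sum (X : nat -> T -> E) (n : nat) (w : T) : E :=
  ((Num.sqrt n%:R)^-1 *: \sum_(i < n) (X i w - bochner_integral (X i)))%R.

End bochner.

Section random_elements.
Context d (T : measurableType d) (R : realType) (P : probability T R).
Local Open Scope ereal_scope.

Definition independent_seq d' (S : measurableType d')
    (X : nat -> {RV P >-> S}) : Prop :=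
  forall (J : {fset nat}) (A : nat -> set S), (forall i, measurable (A i)) ->
    P (\bigcap_(i in [set` J]) X i @^-1` A i) =
    \prod_(i <- J) P (X i @^-1` A i).

Definition identically_distributed d' (S : measurableType d')
    (X : nat -> {RV P >-> S}) : Prop :=
  forall i j (A : set S), measurable A ->
    distribution P (X i) A = distribution P (X j) A.

Definition iid d' (S : measurableType d') (X : nat -> {RV P >-> S}) : Prop :=
  independent_seq X /\ identically_distributed X.

Definition uniformly_tight (S : ptopologicalType)
    (Y : nat -> {RV P >-> borel S}) : Prop :=
  forall eps : R, (0 < eps)%R -> exists2 K : set S, compact K &
    ereal_sup (range (fun n => P (Y n @^-1` (~` K)))) <= eps%:E.

Definition tight (S : ptopologicalType) (Y : {RV P >-> borel S}) : Prop :=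
  uniformly_tight (fun=> Y).

(* [normal_prob 0 0] is not the Dirac mass in the library, so that the
   degenerate case has to be written separately. *)
Definition centered_gaussian_rv (Y : T -> R) : Prop :=
  exists2 sigma : R, (0 <= sigma)%R & forall A : set R, measurable A ->
    P (Y @^-1` A) = if sigma == 0%R then \d_(0%R : R) A else normal_prob 0 sigma A.

Definition centered_gaussian (E : normedModType R)
    (G : {RV P >-> borel E}) : Prop :=
  forall L : {linear E -> R^o}, continuous L ->
    centered_gaussian_rv (fun w => L (G w)).

End random_elements.

Definition weak_cvg (R : realType) (S : ptopologicalType)
    (mu : nat -> probability (borel S) R) (nu : probability (borel S) R) : Prop :=
  forall f : S -> R, continuous f -> bounded_fun f ->
    (\int[mu n]_x (f x)%:E @[n --> \oo] --> \int[nu]_x (f x)%:E)%E.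

Section evaluation.
Context (Theta : topologicalType) (R : realType) (E : normedModType R).
Context (cTheta : compact [set: Theta]).
Local Notation C := (cspace E cTheta).

Definition cspace_eval (x : Theta) (f : borel C) : borel E := (f : C) x.

Lemma cspace_eval_continuous (x : Theta) :
  continuous (fun f : C => (f : C) x).
Proof.
move=> f; apply/(@cvgrPdist_le R E C (nbhs (f : C))) => e e0.
apply/(@nbhs_normP R C); exists e => //= g /ltW.
exact: le_trans (le_cspace_norm (f - g) x).
Qed.

Let measurable_cspace_eval x : measurable_fun [set: borel C] (cspace_eval x).
Proof.
exact: (continuous_measurable_borel (@cspace_eval_continuous x)).
Qed.

HB.instance Definition _ x :=
  @isMeasurableFun.Build _ _ _ _ (cspace_eval x) (@measurable_cspace_eval x).

Context d (T : measurableType d) (P : probability T R).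

Definition eval_rv (Y : {RV P >-> borel C}) (x : Theta) : {RV P >-> borel E} :=
  [the {mfun T >-> borel E} of cspace_eval x \o (Y : {mfun T >-> borel C})].

End evaluation.

(* Main.v *)
From HB Require Import structures.
Require Import Defs.
From mathcomp Require Import all_boot all_order all_algebra.
From mathcomp Require Import finmap.
From mathcomp Require Import all_classical all_reals all_analysis.
From mathcomp Require Import measurable_realfun.
From mathcomp Require Import ring lra.

Set Implicit Arguments.
Unset Strict Implicit.
Unset Printing Implicit Defensive.

Import Order.TTheory GRing.Theory Num.Theory.
Import numFieldNormedType.Exports.

Local Open Scope classical_set_scope.
Local Open Scope ring_scope.

(** The proof has two independent halves: chaining makes the sequence tight,
    and a central limit theorem along continuous functionals identifies what a
    tight sequence converges to.

    Tightness. The covering hypothesis provides finite nets inside the dense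
    set with radii [D b^k] and at most [A b^(-tk)] points. Each point of a net is
    linked to a nearby point of the previous one. Markov's inequality and the
    moment hypothesis bound, by a multiple of [(b^(q-t) / rho^p)^k], the
    probability that along some link of level [k] the increment of [Sn] exceeds
    [rho^k]. Since [t < q] this is summable for suitable [b] and [rho], so that
    with large probability no link above some level carries an excessive
    increment; by tightness at the points of the nets, the values there stay with
    large probability in prescribed compact sets. The functions with both
    properties ([chained]) form a compact set, because such a function is known
    up to a geometric tail from its values on one net ([compact_chained],
    [uniformly_tight_chaining]).

    Limit. For a continuous functional [L], the real variables
    [L (X i) - L (mean)] are i.i.d., centered and square integrable, because
    [L] commutes with the Bochner integral ([linear_bochner_integral]). By
    independence the integral of [cos (c + a (Y_0 + .. + Y_k))] satisfies a
    two-term recursion ([cos_sum_recursion]), whose solution is compared with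
    [exp (- s^2 / 2n) ^ k * cos c]: this is the real central limit theorem, in
    the form of convergence of the integrals of [cos (L x + c)]
    ([clt_trig], [clt_trig_banach]).

    The linear combinations of the functions [cos (L x + c)] form an algebra,
    which separates points by the Hahn-Banach theorem, so that they approximate
    every bounded continuous function on compact sets (Stone-Weierstrass,
    [trigpoly_dense]). With tightness, the integrals of every bounded continuous
    function therefore converge. The limit is a positive functional inheriting
    tightness, and tightness is exactly what makes such a functional the
    integral against a Borel probability, although the space is neither locally
    compact nor separable ([riesz_tight]); no extraction of subsequences is
    involved ([weak_cvg_of_trig]).

    Gaussianity. The image of the limit law under [L] has the trigonometric
    integrals of a centered normal law, computed by a differential equation in
    [gaussian_trig], and trigonometric integrals determine a law on the line
    ([law_of_trig]). *)

(** * The Hahn-Banach theorem *)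

Section hahn_banach.
Context (R : realType) (V : normedModType R).
Implicit Types (q : V -> R) (x y v : V).

Definition sublinear q : Prop :=
  (forall x y, q (x + y) <= q x + q y) /\
  (forall (a : R) x, 0 <= a -> q (a *: x) = a * q x).

(* The largest sublinear functional below [q] with value [- q y] at [- y]. *)
Let ray_inf q y x : R := inf [set q (x + t *: y) - t * q y | t in [set t | 0 <= t]].

(** The last inequality is the additivity gained in the direction [y], and it is
    obtained without leaving the sublinear functionals: this is what both the
    minimality argument and the choice of a norming direction below exploit. *)
Lemma sublinear_ray_inf q y : sublinear q ->
  [/\ sublinear (ray_inf q y), forall x, ray_inf q y x <= q x &
      forall x, ray_inf q y x <= q (x + y) - q y].
Proof.
move=> [qD qZ].
have q0 : q 0 = 0 by rewrite -[X in q X](scale0r 0) qZ// mul0r.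
have lbx x t : 0 <= t -> - q (- x) <= q (x + t *: y) - t * q y.
  move=> t0; rewrite -(qZ t)//.
  have := qD (x + t *: y) (- x); rewrite addrAC subrr add0r; lra.
have hlb x : has_lbound [set q (x + t *: y) - t * q y | t in [set t | 0 <= t]].
  by exists (- q (- x)) => _ [t t0 <-]; exact: lbx.
have hne x : [set q (x + t *: y) - t * q y | t in [set t | 0 <= t]] !=set0.
  by exists (q (x + 0 *: y) - 0 * q y); exists 0 => /=.
have le t x : 0 <= t -> ray_inf q y x <= q (x + t *: y) - t * q y.
  by move=> t0; apply: ge_inf; [exact: hlb|exists t].
split; [split| |] => [x z|a x a0|x|x].
- rewrite -lerBlDr; apply: (lb_le_inf (hne _)).
  move=> _ [s s0 <-]; rewrite lerBlDr -lerBlDl.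
  apply: (lb_le_inf (hne _)).
  move=> _ [t t0 <-].
  have := le (s + t) (x + z) (addr_ge0 s0 t0).
  have := qD (x + s *: y) (z + t *: y).
  rewrite addrACA -scalerDl mulrDl; lra.
- have [->|an0] := eqVneq a 0.
    rewrite scale0r mul0r; apply/eqP; rewrite eq_le; apply/andP; split.
      by have := le 0 0 (lexx 0); rewrite scale0r addr0 mul0r subr0 q0.
    apply: (lb_le_inf (hne _)).
    by move=> _ [t t0 <-]; rewrite add0r qZ// subrr.
  have ap : 0 < a by rewrite lt_neqAle eq_sym an0.
  apply/eqP; rewrite eq_le; apply/andP; split.
    rewrite -ler_pdivrMl//; apply: (lb_le_inf (hne _)).
    move=> _ [t t0 <-]; rewrite ler_pdivrMl//.
    have := le (a * t) (a *: x) (mulr_ge0 a0 t0).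
    by rewrite -scalerA -scalerDr qZ// mulrBr mulrA.
  apply: (lb_le_inf (hne _)).
  move=> _ [t t0 <-].
  have t'0 : 0 <= a^-1 * t by rewrite mulr_ge0// invr_ge0.
  have := le (a^-1 * t) x t'0; rewrite -(ler_pM2l ap) => /le_trans; apply.
  by rewrite mulrBr -qZ// scalerDr scalerA !mulrA divff// !mul1r.
- by have := le 0 x (lexx 0); rewrite scale0r addr0 mul0r subr0.
- by have := le 1 x ler01; rewrite scale1r mul1r.
Qed.

(** Zorn's lemma gives a minimal sublinear functional [m] below [q]. As
    [ray_inf m y] is sublinear and below [m], it equals [m], and then
    [m x + m y <= m (x + y)] for all [x] and [y], so that [m] is linear. *)
Lemma exists_linear_below q : sublinear q ->
  exists L : {linear V -> R^o}, forall x, L x <= q x.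
Proof.
move=> sq.
pose Q := {r : V -> R | sublinear r /\ forall x, r x <= q x}.
pose ler' (r s : Q) := `[< forall x, sval s x <= sval r x >].
have [| | | |[m [sm mq]] mmin] := @Zorn Q ler'.
- by move=> r; apply/asboolP.
- move=> r s u /asboolP rs /asboolP su; apply/asboolP => x.
  exact: le_trans (su x) (rs x).
- move=> [r pr] [s ps] /asboolP/= rs /asboolP/= sr.
  have rse : r = s by apply/funext => x; apply/eqP; rewrite eq_le rs sr.
  by subst s; congr exist; exact: Prop_irrelevance.
- move=> A Atot.
  have [[r0 Ar0]|A0] := pselect (A !=set0); last first.
    exists (exist _ q (conj sq (fun x => lexx (q x)))) => s As.
    by exfalso; apply: A0; exists s.
  pose I x := [set sval r x | r in A].
  have Ine x : I x !=set0 by exists (sval r0 x); exists r0.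
  have lb x : has_lbound (I x).
    exists (- q (- x)) => _ [[r [[rD rZ] rq]] Ar <-] /=.
    have r00 : r 0 = 0 by rewrite -[X in r X](scale0r 0) rZ// mul0r.
    by have := rD x (- x); rewrite subrr r00; have := rq (- x); lra.
  pose i x := inf (I x).
  have ile r x : A r -> i x <= sval r x by move=> Ar; apply: ge_inf => //; exists r.
  have si : sublinear i.
    split=> [x y|a x a0].
      rewrite -lerBlDr; apply: lb_le_inf => // _ [r Ar <-].
      rewrite lerBlDr -lerBlDl; apply: lb_le_inf => // _ [s As <-].
      rewrite lerBlDl.
      have [/asboolP rs|/asboolP sr] := Atot r s Ar As.
        apply: le_trans (ile s (x + y) As) _.
        have [[sD _] _] := svalP s; apply: le_trans (sD _ _) _.
        by rewrite lerD2r.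
      apply: le_trans (ile r (x + y) Ar) _.
      have [[rD _] _] := svalP r; apply: le_trans (rD _ _) _.
      by rewrite lerD2l.
    apply/eqP; rewrite eq_le; apply/andP; split; last first.
      apply: lb_le_inf => // _ [r Ar <-].
      have [[_ rZ] _] := svalP r; rewrite rZ//.
      by rewrite ler_wpM2l// ile.
    have [->|an0] := eqVneq a 0.
      rewrite scale0r mul0r; apply: le_trans (ile r0 0 Ar0) _.
      have [[_ rZ] _] := svalP r0.
      by rewrite -[X in sval r0 X](scale0r 0) rZ// mul0r.
    have ap : 0 < a by rewrite lt_neqAle eq_sym an0.
    rewrite -ler_pdivrMl//; apply: lb_le_inf => // _ [r Ar <-].
    rewrite ler_pdivrMl//; have [[_ rZ] _] := svalP r.
    by rewrite -rZ// ile.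
  have iq x : i x <= q x.
    by apply: le_trans (ile r0 x Ar0) _; have [_] := svalP r0; apply.
  exists (exist _ i (conj si iq)) => r Ar; apply/asboolP => x /=.
  exact: ile.
have mD x y : m (x + y) = m x + m y.
  apply/eqP; rewrite eq_le; have [mD mZ] := sm; rewrite mD/=.
  have [sr rm ry] := sublinear_ray_inf y sm.
  have rq x' : ray_inf m y x' <= q x' by apply: le_trans (rm x') (mq x').
  have /mmin/(congr1 sval)/= e :
      ler' (exist _ m (conj sm mq)) (exist _ (ray_inf m y) (conj sr rq)).
    exact/asboolP.
  by have := ry x; rewrite e; lra.
have mL : linear (m : V -> R^o).
  have mN x : m (- x) = - m x.
    have [_ mZ] := sm.
    have m0 : m 0 = 0 by rewrite -[X in m X](scale0r 0) mZ// mul0r.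
    by have := mD x (- x); rewrite subrr m0; lra.
  move=> a x y; rewrite mD; congr (_ + _).
  have [_ mZ] := sm.
  have [a0|a0] := leP 0 a; first by rewrite mZ.
  by rewrite -[a in LHS]opprK scaleNr mN mZ ?oppr_ge0 1?ltW// mulNr opprK.
pose Lm := GRing.isLinear.Build R V R^o *:%R m mL.
pose L : {linear V -> R^o} := HB.pack m Lm.
by exists L.
Qed.

(** A linear [L] below [ray_inf] of the norm in the direction [v] is below the
    norm, and [L (- v) <= `|0| - `|v|] forces [L v = `|v|]. *)
Lemma norming_functional v : exists L : {linear V -> R^o},
  [/\ continuous L, forall x, `|L x| <= `|x| & L v = `|v|].
Proof.
have sn : sublinear (fun x : V => `|x|).
  by split=> [x y|a x a0]; [exact: ler_normD|rewrite normrZ ger0_norm].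
have [sr rn rv] := sublinear_ray_inf v sn.
have [L Lr] := exists_linear_below sr; exists L.
have Ln x : `|L x| <= `|x|.
  rewrite ler_norml; apply/andP; split; last exact: le_trans (Lr x) (rn x).
  by rewrite lerNl -linearN -[leRHS]normrN; exact: le_trans (Lr _) (rn _).
split=> //.
  apply/linear_bounded_continuous/linear_boundedP; exists 1; split=> //.
  by move=> M M1 x; apply: le_trans (Ln x) _; rewrite ler_peMl// ltW.
apply/eqP; rewrite eq_le (le_trans (ler_norm _) (Ln v))/=.
have := le_trans (Lr (- v)) (rv (- v)); rewrite addNr normr0 sub0r linearN.
by rewrite lerN2.
Qed.

End hahn_banach.

(** * The Stone-Weierstrass theorem *)

Lemma compact_directed_cover (T : topologicalType) (K : set T) (I : Type)
    (D : set I) (U : I -> set T) :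
  compact K -> D !=set0 -> (forall i, D i -> open (U i)) ->
  (forall i j, D i -> D j -> exists2 k, D k & U i `|` U j `<=` U k) ->
  K `<=` \bigcup_(i in D) U i -> exists2 i, D i & K `<=` U i.
Proof.
move=> /compact_near_coveringP cK [i0 Di0] Uo Udir KU.
pose B i := [set j | D j /\ U i `<=` U j].
have FB : Filter (filter_from D B).
  apply: filter_from_filter; first by exists i0.
  move=> i j Di Dj; have [k Dk UU] := Udir i j Di Dj; exists k => // l [Dl Ul].
  by split; split=> //; apply: subset_trans Ul => x Ux; apply: UU; [left|right].
have [|i Di Bi] := cK _ (filter_from D B) (fun j x => U j x) FB.
  move=> x /KU[i Di Ux]; exists (U i, B i) => /=.
    by split; [exact: open_nbhs_nbhs (conj (Uo i Di) Ux)|exists i].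
  by move=> [y j] [/= Uy [Dj]]; exact.
by exists i => //; apply: (Bi i); split.
Qed.

Section abs_approx.
Context (R : realType).
Implicit Types x : R.

(** Polynomials in [x] increasing to [`|x|] on [-1, 1]: each step is a damped
    Newton correction for the equation [y ^+ 2 = x ^+ 2]. *)
Fixpoint abs_approx (n : nat) x : R :=
  if n is m.+1 then abs_approx m x + 2^-1 * (x ^+ 2 - abs_approx m x ^+ 2) else 0.

(** With [a = `|x|] and [p] the approximation, one step multiplies the error
    [a - p] by [1 - (a + p) / 2 <= 1 - a / 2]; the second estimate is the
    invariant that turns this into the uniform error [a / (1 + n a / 2) <= 2 / n],
    where the decay is slow only for [a] small, that is, where the error is
    already small. *)
Lemma abs_approxP n x : `|x| <= 1 ->
  0 <= abs_approx n x <= `|x| /\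
  (`|x| - abs_approx n x) * (1 + n%:R * (`|x| / 2)) <= `|x|.
Proof.
move=> x1; elim: n => [|n [/andP[p0 px] ih]] /=.
  by rewrite lexx normr_ge0 mul0r addr0 subr0 mulr1.
rewrite -[x ^+ 2]real_normK ?num_real//; set a := `|x| in x1 px ih *.
set p := abs_approx n x in p0 px ih *.
have a0 : 0 <= a by exact: normr_ge0.
have n0 : 0 <= n%:R :> R by [].
split; first by apply/andP; split; nra.
rewrite -[n.+1]addn1 natrD; move: (n%:R : R) n0 ih => N N0 ih.
apply: le_trans ih.
have -> : a - (p + 2^-1 * (a ^+ 2 - p ^+ 2)) = (a - p) * (1 - (a + p) / 2) by field.
rewrite -mulrA ler_wpM2l ?subr_ge0//.
apply: (@le_trans _ _ ((1 - a / 2) * (1 + (N + 1) * (a / 2)))).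
  apply: ler_wpM2r; last by lra.
  by rewrite addr_ge0// mulr_ge0 ?divr_ge0//; lra.
nra.
Qed.

Lemma abs_approx_lim (e : R) : 0 < e ->
  exists n, forall x, `|x| <= 1 -> `| `|x| - abs_approx n x| <= e.
Proof.
move=> e0; exists (Num.truncn (2 / e)).+1 => x x1.
have [/andP[p0 px] ih] := abs_approxP (Num.truncn (2 / e)).+1 x1.
set n := _.+1 in p0 px ih *.
have ne : 2 / e < n%:R by exact: truncnS_gt.
rewrite ger0_norm ?subr_ge0// leNgt; apply/negP => h.
have a0 : 0 < `|x| by apply: lt_le_trans (lt_trans e0 h) _; rewrite gerBl.
have : e * (1 + n%:R * (`|x| / 2)) <= `|x|.
  apply: le_trans ih; apply: ler_wpM2r; last exact: ltW.
  by apply: addr_ge0 => //; apply: mulr_ge0 => //; exact: divr_ge0.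
have : 2 < e * n%:R by rewrite mulrC -ltr_pdivrMr.
nra.
Qed.

End abs_approx.

Section stone_weierstrass.
Context (R : realType) (T : topologicalType) (A : set (T -> R)).
Hypothesis A_cont : forall f, A f -> continuous f.
Hypothesis A_bnd : forall f, A f -> exists M : R, forall x, `|f x| <= M.
Hypothesis A_cst : forall a, A (fun=> a).
Hypothesis A_add : forall f g, A f -> A g -> A (fun x => f x + g x).
Hypothesis A_mul : forall f g, A f -> A g -> A (fun x => f x * g x).
Hypothesis A_lim : forall f,
  (forall e : R, 0 < e -> exists2 g, A g & forall x, `|f x - g x| <= e) -> A f.
Hypothesis A_sep : forall x y, x != y -> exists2 f, A f & f x != f y.

Let A_scale a f : A f -> A (fun x => a * f x).
Proof. by move=> Af; apply: A_mul. Qed.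

Let A_ext f g : A f -> (forall x, f x = g x) -> A g.
Proof. by move=> Af fg; rewrite (_ : g = f)//; apply/funext => x. Qed.

Let A_abs f : A f -> A (fun x => `|f x|).
Proof.
move=> Af; have [M fM] := A_bnd Af.
pose m := Num.max M 1.
have m0 : 0 < m by rewrite lt_max ltr01 orbT.
have fm x : `|m^-1 * f x| <= 1.
  rewrite normrM gtr0_norm ?invr_gt0// ler_pdivrMl// mulr1.
  by rewrite (le_trans (fM x))// le_max lexx.
have Ap n : A (fun x => abs_approx n (m^-1 * f x)).
  elim: n => [|n ih]; first exact: A_cst.
  apply: (A_ext (f := fun x => abs_approx n (m^-1 * f x) + 2^-1 *
    ((m^-1 * f x) * (m^-1 * f x) +
      (-1) * (abs_approx n (m^-1 * f x) * abs_approx n (m^-1 * f x))))).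
    by apply: A_add => //; apply: A_scale; apply: A_add;
      [|apply: A_scale]; apply: A_mul => //; apply: A_scale.
  by move=> x /=; rewrite !expr2 mulN1r.
apply: A_lim => e e0.
have [|n an] := @abs_approx_lim R (e / m); first by rewrite divr_gt0.
exists (fun x => m * abs_approx n (m^-1 * f x)); first exact: A_scale.
move=> x.
have {1}-> : f x = m * (m^-1 * f x) by rewrite mulrA divff ?mul1r// gt_eqF.
rewrite normrM gtr0_norm// -mulrBr normrM gtr0_norm//.
by rewrite -ler_pdivlMl// [leRHS]mulrC an.
Qed.

Let A_max f g : A f -> A g -> A (fun x => Num.max (f x) (g x)).
Proof.
move=> Af Ag; apply: (A_ext (f := fun x => 2^-1 *
    ((f x + g x) + `|f x + (-1) * g x|))).
  by apply: A_scale; apply: A_add; [exact: A_add|apply: A_abs; apply: A_add => //;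
    exact: A_scale].
by move=> x; rewrite mulN1r maxr_absE; field.
Qed.

Let A_min f g : A f -> A g -> A (fun x => Num.min (f x) (g x)).
Proof.
move=> Af Ag; apply: (A_ext (f := fun x => 2^-1 *
    ((f x + g x) + (-1) * `|f x + (-1) * g x|))).
  by apply: A_scale; apply: A_add; [exact: A_add|apply: A_scale; apply: A_abs;
    apply: A_add => //; exact: A_scale].
by move=> x; rewrite !mulN1r minr_absE; field.
Qed.

Let A_interp x y (a b : R) : (x = y -> a = b) ->
  exists2 h, A h & h x = a /\ h y = b.
Proof.
move=> ab; have [xy|xy] := eqVneq x y.
  by exists (fun=> a) => //; split=> //; exact: ab.
have [f Af fxy] := A_sep xy.
exists (fun z => a + ((b - a) / (f y - f x)) * (f z + - f x)).
  by apply: A_add => //; apply: A_scale; apply: A_add.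
have fxy0 : f y - f x != 0 by rewrite subr_eq0 eq_sym.
split; first by rewrite subrr mulr0 addr0.
by rewrite mulfVK// subrKC.
Qed.

(** Being closed under uniform limits, [A] is a lattice, since absolute values
    are uniform limits of polynomials. Interpolating [f] at pairs of points, one
    compactness argument gives for each [x] a function equal to [f] at [x] and
    below [f + e] on [K] (a minimum), a second one a function within [e] of [f]
    on [K] (a maximum). Clipping at [- B] and [B] at the end loses nothing on [K]
    and bounds [g] on the whole space, which integration off [K] requires. *)
Lemma stone_weierstrass (K : set T) (f : T -> R) (B e : R) :
  compact K -> continuous f -> 0 <= B -> (forall x, `|f x| <= B) -> 0 < e ->
  exists g, [/\ A g, forall x, K x -> `|f x - g x| <= e & forall x, `|g x| <= B].
Proof.
move=> cK cf B0 fB e0.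
have openlt (h1 h2 : T -> R) : continuous h1 -> continuous h2 ->
    open [set x | h1 x < h2 x].
  move=> c1 c2.
  rewrite (_ : mkset _ = (fun x => h2 x - h1 x) @^-1` [set r | 0 < r]).
    apply: open_comp; last exact: open_gt.
    by move=> x _; apply: cvgB; [exact: c2|exact: c1].
  by apply/seteqP; split=> x /=; rewrite subr_gt0.
have ce a : continuous (fun x => f x + a).
  by move=> x; apply: cvgD; [exact: cf|exact: cvg_cst].
have below x : exists g, [/\ A g, g x = f x & forall y, K y -> g y < f y + e].
  have [||||g [Ag gx] Kg] := @compact_directed_cover T K (T -> R)
    [set h | A h /\ h x = f x] (fun h => [set y | h y < f y + e]) cK.
  - by exists (fun=> f x); split.
  - by move=> h [Ah _]; apply: openlt => //; exact: A_cont.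
  - move=> h1 h2 [A1 h1x] [A2 h2x].
    exists (fun y => Num.min (h1 y) (h2 y)); last by move=> y /=; rewrite gt_min => -[->|->]; rewrite ?orbT.
    by split; [exact: A_min|rewrite h1x h2x minxx].
  - move=> y Ky; have [|h Ah [hx hy]] := @A_interp x y (f x) (f y); first by move=> ->.
    by exists h => //=; rewrite hy ltrDl.
  by exists g; split.
have [||||g [Ag gu] Kg] := @compact_directed_cover T K (T -> R)
    [set h | A h /\ forall y, K y -> h y < f y + e] (fun h => [set y | f y + - e < h y]) cK.
- have [[x _]|K0] := pselect (K !=set0).
    by have [g [Ag _ gK]] := below x; exists g.
  by exists (fun=> 0); split=> // y Ky; exfalso; apply: K0; exists y.
- by move=> h [Ah _]; apply: openlt => //; exact: A_cont.
- move=> h1 h2 [A1 h1x] [A2 h2x].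
  exists (fun y => Num.max (h1 y) (h2 y)); last by move=> y /=; rewrite lt_max => -[->|->]; rewrite ?orbT.
  by split; [exact: A_max|move=> y Ky; rewrite gt_max h1x// h2x].
- move=> x Kx; have [g [Ag gx gK]] := below x.
  by exists g => //=; rewrite gx gtrDl oppr_lt0.
(* [g] is within [e] of [f] on [K]; clip it to [- B, B]. *)
exists (fun x => Num.max (- B) (Num.min B (g x))); split.
- by apply: A_max => //; apply: A_min.
- move=> x Kx; have := fB x; rewrite ler_norml => /andP[f1 f2].
  have g1 := gu x Kx; have g2 := Kg x Kx; rewrite /= in g2.
  rewrite ler_norml; apply/andP; case: (lerP B (g x)) => h1; case: (lerP (- B)) => h2; split; lra.
- move=> x; rewrite ler_norml le_max lexx/= ge_max ge_min lexx/= andbT; lra.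
Qed.

End stone_weierstrass.

(** * Trigonometric polynomials on a normed space *)

Lemma cosMcos (R : realType) (a b : R) :
  cos a * cos b = 2^-1 * (cos (a + b) + cos (a - b)).
Proof. by rewrite cosD cosB; field. Qed.

Section trigonometric_polynomials.
Context (R : realType) (V : normedModType R).

(** Phases [c] make sines superfluous, and the product formula for cosines then
    makes these functions an algebra. *)
Inductive trigpoly : (V -> R) -> Prop :=
| trigpoly_cos (L : {linear V -> R^o}) (c : R) :
    continuous L -> trigpoly (fun x => cos (L x + c))
| trigpoly_add f g : trigpoly f -> trigpoly g -> trigpoly (fun x => f x + g x)
| trigpoly_scale (a : R) f : trigpoly f -> trigpoly (fun x => a * f x).

Lemma trigpoly_ext f g : trigpoly f -> (forall x, f x = g x) -> trigpoly g.
Proof. by move=> tf fg; rewrite (_ : g = f)//; apply/funext => x. Qed.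

Lemma trigpoly_cst a : trigpoly (fun=> a).
Proof.
have c0 : continuous (\0%R : {linear V -> R^o}) by move=> x; exact: cvg_cst.
apply: trigpoly_ext (trigpoly_scale a (trigpoly_cos 0 c0)) _ => x.
by rewrite addr0 cos0 mulr1.
Qed.

Lemma trigpoly_mul f g : trigpoly f -> trigpoly g -> trigpoly (fun x => f x * g x).
Proof.
move=> tf tg; elim: tf => [L c cL|f1 f2 _ ih1 _ ih2|a h _ ih]; last 2 first.
- by apply: trigpoly_ext (trigpoly_add ih1 ih2) _ => x; rewrite mulrDl.
- by apply: trigpoly_ext (trigpoly_scale a ih) _ => x; rewrite mulrA.
elim: tg => [L' c' cL'|f1 f2 _ ih1 _ ih2|a h _ ih]; last 2 first.
- by apply: trigpoly_ext (trigpoly_add ih1 ih2) _ => x; rewrite mulrDr.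
- by apply: trigpoly_ext (trigpoly_scale a ih) _ => x; rewrite mulrCA.
have cD : continuous (L \+ L' : {linear V -> R^o}).
  by move=> x; apply: cvgD; [exact: cL|exact: cL'].
have cB : continuous (L \- L' : {linear V -> R^o}).
  by move=> x; apply: cvgB; [exact: cL|exact: cL'].
apply: trigpoly_ext (trigpoly_scale 2^-1 (trigpoly_add
  (trigpoly_cos (c + c') cD) (trigpoly_cos (c - c') cB))) _ => x /=.
rewrite cosMcos; congr (_ * (cos _ + cos _)); first by rewrite addrACA.
by rewrite opprD addrACA.
Qed.

Lemma trigpoly_continuous f : trigpoly f -> continuous f.
Proof.
elim=> [L c cL|f1 f2 _ ih1 _ ih2|a h _ ih] x.
- apply: (continuous_comp (f := fun x => L x + c) (g := cos)).
    by apply: cvgD; [exact: cL|exact: cvg_cst].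
  exact: continuous_cos.
- by apply: cvgD; [exact: ih1|exact: ih2].
- by apply: cvgM; [exact: cvg_cst|exact: ih].
Qed.

Lemma trigpoly_bounded f : trigpoly f -> exists M : R, forall x, `|f x| <= M.
Proof.
elim=> [L c _|f1 f2 _ [M1 ih1] _ [M2 ih2]|a h _ [M ih]].
- by exists 1 => x; exact: cos_max.
- by exists (M1 + M2) => x; rewrite (le_trans (ler_normD _ _))// lerD.
- by exists (`|a| * M) => x; rewrite normrM ler_wpM2l.
Qed.

(** A functional norming [x - y], rescaled to differ by [pi] at [x] and [y],
    gives the cosines [-1] and [1]. *)
Lemma trigpoly_separates (x y : V) : x != y -> exists2 f, trigpoly f & f x != f y.
Proof.
move=> xy; have xy0 : 0 < `|x - y| by rewrite normr_gt0 subr_eq0.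
have [L [cL _ Lxy]] := norming_functional (x - y).
pose L' : {linear V -> R^o} := (pi / `|x - y|) \*: L.
have cL' : continuous L' by move=> z; apply: cvgZl_tmp; exact: cL.
exists (fun z => cos (L' z + - L' y)).
  exact: trigpoly_cos.
rewrite -!linearB /= Lxy subrr linear0 scaler0 cos0.
rewrite /GRing.scale/= mulfVK; last by rewrite gt_eqF.
by rewrite cospi lt_eqF// (lt_trans _ ltr01)// ltrN10.
Qed.

(** The theorem above is applied to the uniform closure of the trigonometric
    polynomials, whose elements are again uniformly approximated by them. *)
Lemma trigpoly_dense (K : set V) (f : V -> R) (B e : R) :
  compact K -> continuous f -> (forall x, `|f x| <= B) -> 0 < e ->
  exists g, [/\ trigpoly g, forall x, K x -> `|f x - g x| <= e &
                forall x, `|g x| <= B + e].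
Proof.
move=> cK cf fB e0.
pose A := [set g : V -> R | forall d : R, 0 < d ->
  exists2 h, trigpoly h & forall x, `|g x - h x| <= d].
have tA g : trigpoly g -> A g.
  by move=> tg d d0; exists g => // x; rewrite subrr normr0 ltW.
have Abnd g : A g -> exists M : R, forall x, `|g x| <= M.
  move=> Ag; have [h /trigpoly_bounded[M hM] gh] := Ag 1 ltr01.
  exists (1 + M) => x; rewrite -[g x](subrK (h x)).
  by rewrite (le_trans (ler_normD _ _))// lerD.
have [| | | | | | | |g [Ag fg gB]] := @stone_weierstrass R V A _ Abnd _ _ _ _ _ K f B (e / 2) cK cf _ fB _.
- move=> g Ag x; apply/cvgrPdist_le => d d0.
  have d30 : 0 < d / 3 by rewrite divr_gt0.
  have [h th gh] := Ag _ d30.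
  have /cvgrPdist_le/(_ _ d30) := trigpoly_continuous th (x := x).
  apply: filterS => y hy.
  have := gh x; have := gh y; move: hy; rewrite !ler_norml.
  by move=> /andP[? ?] /andP[? ?] /andP[? ?]; apply/andP; split; lra.
- by move=> a; apply: tA; exact: trigpoly_cst.
- move=> g1 g2 A1 A2 d d0; have d20 : 0 < d / 2 by rewrite divr_gt0.
  have [h1 t1 h1d] := A1 _ d20; have [h2 t2 h2d] := A2 _ d20.
  exists (fun x => h1 x + h2 x); first exact: trigpoly_add.
  move=> x; rewrite opprD addrACA [leRHS]splitr.
  by rewrite (le_trans (ler_normD _ _))// lerD.
- move=> g1 g2 A1 A2 d d0.
  have [M1 gM1] := Abnd _ A1.
  have [M2 gM2] := Abnd _ A2.
  have M10 : 0 <= M1 by exact: le_trans (normr_ge0 _) (gM1 0).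
  have M20 : 0 <= M2 by exact: le_trans (normr_ge0 _) (gM2 0).
  (* |g1 g2 - h1 h2| <= |g1| |g2 - h2| + |h2| |g1 - h1|, and |h2| <= M2 + 1 *)
  pose r := Num.min 1 (d / (M1 + M2 + 1)).
  have s0 : 0 < M1 + M2 + 1 by lra.
  have r0 : 0 < r by rewrite lt_min ltr01 divr_gt0.
  have [h1 t1 h1d] := A1 _ r0; have [h2 t2 h2d] := A2 _ r0.
  exists (fun x => h1 x * h2 x); first exact: trigpoly_mul.
  move=> x.
  have -> : g1 x * g2 x - h1 x * h2 x =
    g1 x * (g2 x - h2 x) + h2 x * (g1 x - h1 x) by ring.
  rewrite (le_trans (ler_normD _ _))// !normrM.
  have h2M : `|h2 x| <= M2 + 1.
    rewrite -[h2 x](subKr (g2 x)) (le_trans (ler_normB _ _))// lerD//.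
    by rewrite (le_trans (h2d x))// ge_min lexx.
  apply: (@le_trans _ _ (M1 * r + (M2 + 1) * r)).
    by apply: lerD; apply: ler_pM.
  rewrite -mulrDl addrA -ler_pdivlMl// [leRHS]mulrC.
  by rewrite ge_min lexx orbT.
- move=> g Ag d d0; have d20 : 0 < d / 2 by rewrite divr_gt0.
  have [h Ah gh] := Ag _ d20; have [k tk hk] := Ah _ d20.
  exists k => // x; rewrite -[g x](subrK (h x)) -addrA [leRHS]splitr.
  by rewrite (le_trans (ler_normD _ _))// lerD.
- by move=> x y /trigpoly_separates[g tg gxy]; exists g => //; exact: tA.
- exact: le_trans (normr_ge0 _) (fB 0).
- by rewrite divr_gt0.
have e20 : 0 < e / 2 by rewrite divr_gt0.
have [h th gh] := Ag _ e20.
exists h; split=> // x.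
  move=> /fg fgx; rewrite -[f x](subrK (g x)) -addrA [leRHS]splitr.
  by rewrite (le_trans (ler_normD _ _))// lerD.
rewrite -[h x](subKr (g x)) (le_trans (ler_normB _ _))// lerD//.
by rewrite (le_trans (gh x))// ler_pdivrMr// ler_peMr ?ler1n// ltW.
Qed.

End trigonometric_polynomials.

(** * Layers of a bounded function *)

Section staircase.
Context (R : realType).
Implicit Types z : R.

Definition clip01 z : R := Num.max 0 (Num.min 1 z).

Lemma clip01_itv z : 0 <= clip01 z <= 1.
Proof. by rewrite le_max lexx ge_max ge_min ler01 lexx. Qed.

(** The layer-cake decomposition of a number between [0] and [n] into layers of
    thickness one. Applied to [n * f] it splits a function [f] into layers that
    are continuous when [f] is, which the integral representation needs. *)
Lemma sum_clip01 (n : nat) z : 0 <= z <= n%:R ->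
  \sum_(j < n) clip01 (z - j%:R) = z.
Proof.
move=> /andP[z0 zn]; have {2}-> : z = Num.min z n%:R by case: leP zn.
elim: n {zn} => [|n ih]; first by rewrite big_ord0; case: leP z0; lra.
rewrite big_ord_recr/= ih -natr1 /clip01; move: (n%:R : R) (ler0n R n) => N N0.
case: (leP z N); case: (leP z (N + 1)) => ? ?; case: (leP 1 (z - N)) => ?;
  case: (leP 0) => ?; lra.
Qed.

(** The sum is the ceiling of [z]; applied to [n * f] it approximates [f] within
    [1 / n] by a combination of indicators. *)
Lemma sum_below (n : nat) z : 0 <= z <= n%:R ->
  z <= \sum_(j < n) (j%:R < z)%R%:R <= z + 1.
Proof.
move=> /andP[z0 zn].
suff: Num.min z n%:R <= \sum_(j < n) (j%:R < z)%R%:R <= Num.min (z + 1) n%:R.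
  by move=> /andP[h1 h2]; apply/andP; split; [move: h1; rewrite (min_idPl zn)|move: h2; rewrite le_min => /andP[]].
elim: n {zn} => [|n /andP[ih1 ih2]].
  by rewrite big_ord0; apply/andP; split; [case: (lerP z)|case: (lerP (z + 1))]; lra.
rewrite big_ord_recr/= -natr1; move: ih1 ih2.
move: (\sum_(i < n) _) => S; move: (n%:R : R) (ler0n R n) => N N0.
have [Nz|zN] := ltP N z; rewrite /= ?addr0 => h1 h2; apply/andP; split; move: h1 h2;
 case: (leP z N); case: (leP z (N + 1)); case: (leP (z + 1) N); case: (leP (z + 1) (N + 1)); lra.
Qed.

End staircase.

Lemma indic_bool (T : Type) (R : realType) (b : pred T) (x : T) :
  \1_[set y | b y] x = (b x)%:R :> R.
Proof.
by rewrite indicE; congr (_%:R); congr nat_of_bool; apply/idP/idP; rewrite inE.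
Qed.

(** * Integrals of bounded measurable and bounded continuous functions *)

Section bounded_integrals.
Context d (T : measurableType d) (R : realType) (P : probability T R).
Implicit Types f g : T -> R.

(** Integrable for every probability on [T], so that the integral is linear on
    these functions without side conditions. *)
Definition bmf f := measurable_fun setT f /\ exists M : R, forall x, `|f x| <= M.

Lemma bmf_integrable f : bmf f -> P.-integrable setT (EFin \o f).
Proof.
move=> [mf [M fM]]; apply: measurable_bounded_integrable => //.
  by rewrite [ltLHS]probability_setT ltry.
exists M; split; first by rewrite num_real.
by move=> x Mx y _; apply: le_trans (fM y) (ltW Mx).
Qed.

Lemma bmf_cst (a : R) : bmf (fun=> a).
Proof. by split; [exact: measurable_cst|exists `|a|]. Qed.

Lemma bmfD f g : bmf f -> bmf g -> bmf (fun x => f x + g x).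
Proof.
move=> [mf [M fM]] [mg [N gN]]; split; first exact: measurable_funD.
by exists (M + N) => x; rewrite (le_trans (ler_normD _ _))// lerD.
Qed.

Lemma bmfM f g : bmf f -> bmf g -> bmf (fun x => f x * g x).
Proof.
move=> [mf [M fM]] [mg [N gN]]; split; first exact: measurable_funM.
by exists (M * N) => x; rewrite normrM ler_pM.
Qed.

Lemma bmfZ (a : R) f : bmf f -> bmf (fun x => a * f x).
Proof. by apply: bmfM; exact: bmf_cst. Qed.

Lemma bmfN f : bmf f -> bmf (fun x => - f x).
Proof. by move=> /(bmfZ (-1)); under eq_fun do rewrite mulN1r. Qed.

Lemma bmfB f g : bmf f -> bmf g -> bmf (fun x => f x - g x).
Proof. by move=> bf /bmfN; exact: bmfD. Qed.

Lemma bmf_indic (A : set T) : measurable A -> bmf (\1_A : T -> R).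
Proof.
move=> mA; split; first exact: measurable_indic.
by exists 1 => x; rewrite indicE; case: (_ \in _); rewrite ?normr1// normr0.
Qed.

Lemma bmf_sum n (F : 'I_n -> T -> R) : (forall i, bmf (F i)) ->
  bmf (fun x => \sum_(i < n) F i x).
Proof.
elim: n F => [|n ih] F bF.
  by under eq_fun do rewrite big_ord0; exact: bmf_cst.
under eq_fun do rewrite big_ord_recr/=.
by apply: bmfD => //; apply: ih => i.
Qed.

Lemma EFin_Rintegral f : bmf f ->
  (\int[P]_x f x)%:E = (\int[P]_x (f x)%:E)%E.
Proof.
by move=> bf; rewrite /Rintegral fineK//; apply: integrable_fin_num => //;
  exact: bmf_integrable.
Qed.

Lemma bintD f g : bmf f -> bmf g ->
  \int[P]_x (f x + g x) = \int[P]_x f x + \int[P]_x g x.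
Proof. by move=> bf bg; rewrite RintegralD//; exact: bmf_integrable. Qed.

Lemma bintB f g : bmf f -> bmf g ->
  \int[P]_x (f x - g x) = \int[P]_x f x - \int[P]_x g x.
Proof. by move=> bf bg; rewrite RintegralB//; exact: bmf_integrable. Qed.

Lemma bintZ (a : R) f : bmf f -> \int[P]_x (a * f x) = a * \int[P]_x f x.
Proof. by move=> bf; rewrite RintegralZl//; exact: bmf_integrable. Qed.

Lemma bint_cst (a : R) : \int[P]_x (fun=> a) x = a.
Proof. by rewrite Rintegral_cst// [X in fine X]probability_setT/= mulr1. Qed.

Lemma bint_indic (A : set T) : measurable A -> \int[P]_x (\1_A x) = fine (P A).
Proof. by move=> mA; rewrite /Rintegral integral_indic// setIT. Qed.

Lemma bint_sum n (F : 'I_n -> T -> R) : (forall i, bmf (F i)) ->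
  \int[P]_x (\sum_(i < n) F i x) = \sum_(i < n) \int[P]_x F i x.
Proof.
elim: n F => [|n ih] F bF.
  by under eq_Rintegral do rewrite big_ord0; rewrite bint_cst big_ord0.
under eq_Rintegral do rewrite big_ord_recr/=.
by rewrite bintD ?big_ord_recr ?ih//; apply: bmf_sum => i.
Qed.

Lemma le_bint f g : bmf f -> bmf g -> (forall x, f x <= g x) ->
  \int[P]_x f x <= \int[P]_x g x.
Proof. by move=> bf bg fg; apply: le_Rintegral => //; exact: bmf_integrable. Qed.

Lemma bint_norm_le f (M : R) : bmf f -> (forall x, `|f x| <= M) ->
  `|\int[P]_x f x| <= M.
Proof.
move=> bf fM; rewrite ler_norml; apply/andP; split.
  rewrite -[leLHS]bint_cst; apply: le_bint => //; first exact: bmf_cst.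
  by move=> x; have := fM x; rewrite ler_norml => /andP[].
rewrite -[leRHS]bint_cst; apply: le_bint => //; first exact: bmf_cst.
by move=> x; have := fM x; rewrite ler_norml => /andP[].
Qed.

(** The integrand is at most [e + M * \1_N] in absolute value. This is how
    smallness on a compact set of large probability becomes smallness of an
    integral. *)
Lemma bint_norm_le_off f (e M : R) (N : set T) : bmf f -> measurable N ->
  0 <= e -> 0 <= M -> (forall x, ~ N x -> `|f x| <= e) -> (forall x, `|f x| <= M) ->
  `|\int[P]_x f x| <= e + M * fine (P N).
Proof.
move=> bf mN e0 M0 fe fM.
have bg : bmf (fun x => e + M * \1_N x).
  by apply: bmfD; [exact: bmf_cst|apply: bmfZ; exact: bmf_indic].
have -> : e + M * fine (P N) = \int[P]_x (e + M * \1_N x).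
  rewrite (bintD (bmf_cst e)); last by apply: bmfZ; exact: bmf_indic.
  by rewrite bint_cst bintZ ?bint_indic//; exact: bmf_indic.
apply: le_trans (le_normr_Rintegral measurableT (bmf_integrable bf)) _.
apply: le_bint => //.
  case: bf => mf [M' fM']; split; first exact: measurableT_comp.
  by exists M' => x; rewrite normr_id.
move=> x; rewrite indicE; have [xN|xN] := boolP (x \in N).
  by rewrite mulr1 (le_trans (fM x))// lerDr.
by rewrite mulr0 addr0 fe// => Nx; move: xN; rewrite (mem_set Nx).
Qed.

End bounded_integrals.

Section bounded_continuous.
Context (R : realType) (V : topologicalType).
Implicit Types f g : V -> R.

Definition bcont f := continuous f /\ exists M : R, forall x, `|f x| <= M.

Lemma bcont_cst (a : R) : bcont (fun=> a).
Proof. by split; [move=> x; exact: cvg_cst|exists `|a|]. Qed.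

Lemma bcontD f g : bcont f -> bcont g -> bcont (fun x => f x + g x).
Proof.
move=> [cf [M fM]] [cg [N gN]]; split.
  by move=> x; apply: cvgD; [exact: cf|exact: cg].
by exists (M + N) => x; rewrite (le_trans (ler_normD _ _))// lerD.
Qed.

Lemma bcontZ (a : R) f : bcont f -> bcont (fun x => a * f x).
Proof.
move=> [cf [M fM]]; split; first by move=> x; apply: cvgM; [exact: cvg_cst|exact: cf].
by exists (`|a| * M) => x; rewrite normrM ler_wpM2l.
Qed.

Lemma bcontB f g : bcont f -> bcont g -> bcont (fun x => f x - g x).
Proof.
move=> bf /(bcontZ (-1)) bg; have := bcontD bf bg.
by under eq_fun do rewrite mulN1r.
Qed.

Lemma bcont_abs f : bcont f -> bcont (fun x => `|f x|).
Proof.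
move=> [cf [M fM]]; split; last by exists M => x; rewrite normr_id.
by move=> x; apply: cvg_norm; exact: cf.
Qed.

Lemma bcont_max f g : bcont f -> bcont g -> bcont (fun x => Num.max (f x) (g x)).
Proof.
move=> bf bg; rewrite (_ : (fun=> _) = fun x => 2^-1 *
    ((f x + g x) + `|f x - g x|)).
  by apply: bcontZ; apply: bcontD; [exact: bcontD|apply/bcont_abs/bcontB].
by apply/funext => x; rewrite maxr_absE mulrC.
Qed.

Lemma bcont_min f g : bcont f -> bcont g -> bcont (fun x => Num.min (f x) (g x)).
Proof.
move=> bf bg; rewrite (_ : (fun=> _) = fun x => 2^-1 *
    ((f x + g x) - `|f x - g x|)).
  by apply: bcontZ; apply: bcontB; [exact: bcontD|apply/bcont_abs/bcontB].
by apply/funext => x; rewrite minr_absE mulrC.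
Qed.

Lemma bcont_sum n (F : 'I_n -> V -> R) : (forall i, bcont (F i)) ->
  bcont (fun x => \sum_(i < n) F i x).
Proof.
elim: n F => [|n ih] F bF.
  by under eq_fun do rewrite big_ord0; exact: bcont_cst.
under eq_fun do rewrite big_ord_recr/=.
by apply: bcontD => //; apply: ih => i.
Qed.

Lemma open_lt_bcont f g : bcont f -> bcont g -> open [set x | f x < g x].
Proof.
move=> bf bg; have [cgf _] := bcontB bg bf.
rewrite (_ : mkset _ = (fun x => g x - f x) @^-1` [set r | 0 < r]).
  by apply: open_comp => //; exact: open_gt.
by apply/seteqP; split=> x /=; rewrite subr_gt0.
Qed.

End bounded_continuous.

Section borel_functions.
Context (R : realType) (V : ptopologicalType).

Lemma open_measurable_borel (U : set V) : open U -> measurable (U : set (borel V)).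
Proof. by move=> oU; exact: sub_sigma_algebra. Qed.

Lemma closed_measurable_borel (U : set V) : closed U -> measurable (U : set (borel V)).
Proof.
move=> cU; rewrite -[U]setCK; apply: measurableC; apply: open_measurable_borel.
exact: closed_openC.
Qed.

Lemma continuous_measurable_real (f : V -> R) : continuous f ->
  measurable_fun [set: borel V] (f : borel V -> R).
Proof.
move=> /continuousP cf.
apply: (measurability _ (RGenOpens.measurableE R)) => _ [_ [a [b ->]] <-].
rewrite setTI; apply: open_measurable_borel; apply: cf.
exact: interval_open.
Qed.

Lemma bcont_bmf (f : V -> R) : bcont f -> bmf (f : borel V -> R).
Proof. by move=> [cf bf]; split=> //; exact: continuous_measurable_real. Qed.

End borel_functions.

(** * Tight positive functionals are integrals *)

Section riesz.
Context (R : realType) (V : normedModType R) (l : (V -> R) -> R).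
Hypothesis l_add : forall f g, bcont f -> bcont g ->
  l (fun x => f x + g x) = l f + l g.
Hypothesis l_scale : forall a f, bcont f -> l (fun x => a * f x) = a * l f.
Hypothesis l_le : forall f g, bcont f -> bcont g -> (forall x, f x <= g x) ->
  l f <= l g.
Hypothesis l1 : l (fun=> 1) = 1.
Hypothesis l_tight : forall e : R, 0 < e -> exists2 K : set V, compact K &
  forall (f : V -> R) (a : R), bcont f -> 0 <= a -> (forall x, f x <= 1) ->
    (forall x, K x -> f x <= a) -> l f <= a + e.

Let l_cst a : l (fun=> a) = a.
Proof.
rewrite (_ : (fun=> a) = (fun x : V => a * (fun=> 1) x)).
  by rewrite l_scale ?l1 ?mulr1//; exact: bcont_cst.
by apply/funext => x; rewrite mulr1.
Qed.

Let l_sub f g : bcont f -> bcont g -> l (fun x => f x - g x) = l f - l g.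
Proof.
move=> bf bg; rewrite -[X in _ = _ + X]mulN1r -l_scale// -l_add//; last exact: bcontZ.
by congr l; apply/funext => x; rewrite mulN1r.
Qed.

Let l_sum n (F : 'I_n -> V -> R) : (forall i, bcont (F i)) ->
  l (fun x => \sum_(i < n) F i x) = \sum_(i < n) l (F i).
Proof.
elim: n F => [|n ih] F bF.
  by under eq_fun do rewrite big_ord0; rewrite l_cst big_ord0.
under eq_fun do rewrite big_ord_recr/=.
by rewrite l_add ?ih ?big_ord_recr//; apply: bcont_sum => i.
Qed.

(* Bounded continuous functions subordinate to [U]: for [U] open, the supremum
   of their values under [l] is to be the measure of [U], and outer regularity
   then dictates the outer measure [mu]. *)
Let sub_ind (U : set V) : set (V -> R) :=
  [set f | [/\ bcont f, forall x, 0 <= f x <= 1 & forall x, ~ U x -> f x = 0]].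

Local Open Scope ereal_scope.

Let lam (U : set V) : \bar R := ereal_sup [set (l f)%:E | f in sub_ind U].

Let mu (A : set V) : \bar R :=
  ereal_inf [set lam U | U in [set U | open U /\ A `<=` U]].

Let sub_ind0 U : sub_ind U (fun=> 0%R).
Proof. by split; [exact: bcont_cst|move=> x; rewrite lexx ler01|]. Qed.

Let lam_ge U f : sub_ind U f -> (l f)%:E <= lam U.
Proof. by move=> fU; apply: ereal_sup_ubound; exists f. Qed.

Let lam_ge0 U : 0 <= lam U.
Proof. by have := lam_ge (sub_ind0 U); rewrite l_cst. Qed.

Let lam_le1 U : lam U <= 1.
Proof.
apply: ge_ereal_sup => _ [f [bf f01 _] <-]; rewrite lee_fin -(l_cst 1).
by apply: l_le => //; [exact: bcont_cst|move=> x; have /andP[] := f01 x].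
Qed.

Let lam_mono U W : U `<=` W -> lam U <= lam W.
Proof.
move=> UW; apply: ereal_sup_le => _ [f [bf f01 f0] <-]; exists f => //.
by split=> // x Wx; apply: f0 => /UW.
Qed.

Let mu_ge0 A : 0 <= mu A.
Proof. by apply: le_ereal_inf_tmp => _ [U _ <-]. Qed.

Let mu_le A U : open U -> A `<=` U -> mu A <= lam U.
Proof. by move=> oU AU; apply: ereal_inf_lbound; exists U. Qed.

Let mu_open U : open U -> mu U = lam U.
Proof.
move=> oU; apply/eqP; rewrite eq_le mu_le//=.
by apply: le_ereal_inf_tmp => _ [W [_ UW] <-]; exact: lam_mono.
Qed.

Let mu_fin A : mu A \is a fin_num.
Proof.
rewrite ge0_fin_numE//; apply: le_lt_trans (ltry 1).
by apply: le_trans (lam_le1 setT); apply: mu_le => //; exact: openT.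
Qed.

Let mu_mono : {homo mu : A B / A `<=` B >-> A <= B}.
Proof.
move=> A B AB; apply: le_ereal_inf_tmp => _ [U [oU BU] <-].
by apply: mu_le => //; exact: subset_trans BU.
Qed.

Let mu0 : mu set0 = 0.
Proof.
apply/eqP; rewrite eq_le mu_ge0 andbT (le_trans (mu_le open0 _))//.
apply: ge_ereal_sup => _ [f [bf _ f0] <-].
by rewrite (_ : f = fun=> 0%R) ?l_cst//; apply/funext => x; exact: f0.
Qed.

(* The cone of height one over a ball; the metric replaces Urysohn functions. *)
Let bump (U : set V) x : open U -> U x -> exists2 f, sub_ind U f & f x = 1%R.
Proof.
move=> oU Ux; have [r /= r0 rU] : exists2 r : R, (0 < r)%R & ball x r `<=` U.
  by have /nbhs_ballP[r r0 rU] := open_nbhs_nbhs (conj oU Ux); exists r.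
exists (fun y => Num.max 0 (1 - r^-1 * `|x - y|))%R; last first.
  by rewrite subrr normr0 mulr0 subr0; apply/max_idPr.
have c : continuous (fun y : V => Num.max 0 (1 - r^-1 * `|x - y|) : R)%R.
  move=> y; apply: (@continuous_max R V (fun=> 0%R) (fun y => 1 - r^-1 * `|x - y|)%R y).
    exact: cvg_cst.
  apply: cvgB; first exact: cvg_cst.
  apply: cvgM; first exact: cvg_cst.
  by apply: cvg_norm; apply: cvgB; [exact: cvg_cst|exact: cvg_id].
have f01 y : (0 <= Num.max 0 (1 - r^-1 * `|x - y|) <= 1)%R.
  rewrite le_max lexx/= ge_max ler01/= gerBl.
  by rewrite mulr_ge0// invr_ge0 ltW.
split=> //.
  by split=> //; exists 1%R => y; have /andP[? ?] := f01 y; rewrite ger0_norm.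
move=> y Uy; apply/max_idPl; rewrite subr_le0 ler_pdivlMl// mulr1.
rewrite leNgt; apply/negP => xy; apply: Uy; apply: rU.
by rewrite -ball_normE.
Qed.

Let sub_ind_max U f g : sub_ind U f -> sub_ind U g ->
  sub_ind U (fun x => Num.max (f x) (g x)).
Proof.
move=> [bf f01 f0] [bg g01 g0]; split; first exact: bcont_max.
  move=> x; have /andP[? ?] := f01 x; have /andP[? ?] := g01 x.
  by rewrite le_max ge_max; apply/andP; split; [apply/orP; left|apply/andP].
by move=> x Ux; rewrite f0// g0// maxxx.
Qed.

(* The one place where tightness enters. A function [f] subordinate to the union
   is, up to [e / 2] and on a compact set [K], below a finite sum of functions
   subordinate to the [U j], because such sums majorize it locally; tightness of
   [l] absorbs what happens off [K]. *)
Let lam_bigcup (U : nat -> set V) : (forall i, open (U i)) ->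
  lam (\bigcup_i U i) <= \sum_(i <oo) lam (U i).
Proof.
move=> oU; apply: ge_ereal_sup => _ [f [bf f01 f0] <-].
apply/lee_addgt0Pr => e e0.
have e20 : (0 < e / 2)%R by rewrite divr_gt0.
have [K cK Kl] := l_tight e20.
have [| | | |[N g] /= gU Kg] := @compact_directed_cover V K (nat * (nat -> V -> R))
  [set i | forall j, sub_ind (U j) (i.2 j)]
  (fun i => [set x | f x < \sum_(j < i.1) i.2 j x + e / 2]%R) cK.
- by exists (0%N, fun _ _ => 0%R) => j; exact: sub_ind0.
- move=> [N g] /= gU; apply: open_lt_bcont => //.
  apply: bcontD; last exact: bcont_cst.
  by apply: bcont_sum => i; have [] := gU i.
- move=> [N g] [N' g'] /= gU gU'.
  exists (maxn N N', fun j x => Num.max (g j x) (g' j x)) => /=.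
    by move=> j; exact: sub_ind_max.
  have aux (n m : nat) (h h' : nat -> V -> R) x : (forall j, sub_ind (U j) (h j)) ->
      (forall j, sub_ind (U j) (h' j)) ->
    (\sum_(j < n) h j x <= \sum_(j < maxn n m) Num.max (h j x) (h' j x))%R.
    move=> hU hU'.
    rewrite -(big_mkord xpredT (fun j => h j x)).
    rewrite -(big_mkord xpredT (fun j => Num.max (h j x) (h' j x))).
    rewrite (big_cat_nat (leq0n n) (leq_maxl n m))/=.
    rewrite -[leLHS]addr0 lerD//.
      by apply: ler_sum => j _; rewrite le_max lexx.
    apply: sumr_ge0 => j _; have [_ h01 _] := hU j.
    by have /andP[] := h01 x; rewrite le_max => ->.
  move=> x [] /lt_le_trans; apply; rewrite lerD2r.
    exact: aux.
  rewrite maxnC; under [leRHS]eq_bigr do rewrite maxC.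
  exact: aux.
- move=> x Kx; have [|Ux] := pselect ((\bigcup_i U i) x); last first.
    exists (0%N, fun _ _ => 0%R) => /=; first by move=> j; exact: sub_ind0.
    by rewrite big_ord0 add0r f0.
  move=> [j _ Ux]; have [h hU hx] := bump (oU j) Ux.
  exists (j.+1, fun i => if i == j then h else fun=> 0%R) => /=.
    by move=> i; case: eqP => [->//|_]; exact: sub_ind0.
  rewrite big_ord_recr/= eqxx hx -addrA ltr_wpDl//.
    apply: sumr_ge0 => i _; case: eqP => // _.
    by have [_ h01 _] := hU; have /andP[] := h01 x.
  by have /andP[_ fx] := f01 x; rewrite (le_lt_trans fx)// ltrDl.
have bg : bcont (fun x => \sum_(j < N) g j x)%R.
  by apply: bcont_sum => j; have [] := gU j.
have h : (l (fun x => f x - \sum_(j < N) g j x) <= e / 2 + e / 2)%R.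
  apply: Kl; [exact: bcontB|exact: ltW| |].
    move=> x; have /andP[_ fx] := f01 x; apply: le_trans fx.
    rewrite gerBl sumr_ge0// => j _; have [_ g01 _] := gU j.
    by have /andP[] := g01 x.
  by move=> x /Kg/ltW; rewrite lerBlDl.
rewrite l_sub// lerBlDl -splitr l_sum in h; last by move=> j; have [] := gU j.
apply: (@le_trans _ _ ((\sum_(j < N) l (g j))%R%:E + e%:E)).
  by rewrite -EFinD lee_fin.
rewrite leeD2r// -sumEFin.
apply: (@le_trans _ _ (\sum_(0 <= j < N) lam (U j))).
  rewrite big_mkord; apply: lee_sum => j _; apply: lam_ge; exact: gU.
by apply: nneseries_lim_ge => i _ _; exact: lam_ge0.
Qed.

Let mu_sigma : sigma_subadditive mu.
Proof.
move=> A; apply/lee_addgt0Pr => e e0.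
rewrite (le_trans _ (epsilon_trick _ _ _))//; last exact: ltW.
have [U AU] : {U : nat -> set V & forall n, [/\ open (U n), A n `<=` U n &
    lam (U n) <= mu (A n) + (e / (2 ^ n.+1)%:R)%:E]}.
  apply: (@choice _ _ (fun n U => [/\ open U, A n `<=` U &
    lam U <= mu (A n) + (e / (2 ^ n.+1)%:R)%:E])) => n.
  have en : (0 < e / (2 ^ n.+1)%:R)%R by rewrite divr_gt0// ltr0n expn_gt0.
  have [_ [U [oU AU] <-] /ltW lamU] := lb_ereal_inf_adherent en (mu_fin (A n)).
  by exists U.
apply: (@le_trans _ _ (lam (\bigcup_n U n))).
  apply: mu_le; first by apply: bigcup_open => n _; have [] := AU n.
  by move=> x [n _ Anx]; exists n => //; have [_ + _] := AU n; exact.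
apply: le_trans (lam_bigcup _) _; first by move=> n; have [] := AU n.
apply: lee_nneseries => [n _ _|n _]; first exact: lam_ge0.
by have [] := AU n.
Qed.

Let mo : {outer_measure set V -> \bar R} :=
  HB.pack_for {outer_measure set V -> \bar R} mu
    (isOuterMeasure.Build R V mu mu0 mu_ge0 mu_mono mu_sigma).

(* For [f] nearly optimal in [W `&` U], the excess [f'] of [f] over [d] and any
   [h] subordinate to [W `&` (f < d)] are nowhere both nonzero, so that [f' + h] is
   subordinate to [W]; and the open set [W `&` (f < d)] contains [W `\` U]. *)
Let open_cara (U : set V) : open U -> mo.-caratheodory U.
Proof.
move=> oU; apply: le_caratheodory_measurable => A; rewrite /mo /=.
apply: le_ereal_inf_tmp => _ [W [oW AW] <-].
apply: (@le_trans _ _ (mu (W `&` U) + mu (W `&` ~` U))).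
  by apply: leeD; apply: mu_mono; exact: setSI.
rewrite mu_open; last exact: openI.
rewrite -leeBrDr//; apply: ge_ereal_sup => _ [f [bf f01 f0] <-].
rewrite leeBrDr//; apply/lee_addgt0Pr => d d0.
pose W' := W `&` [set x | f x < d]%R.
have oW' : open W' by apply: openI => //; apply: open_lt_bcont => //; exact: bcont_cst.
have : mu (W `&` ~` U) <= lam W'.
  by apply: mu_le => // x [Wx Ux]; split=> //=; rewrite f0// => -[].
suff : lam W' <= lam W + d%:E - (l f)%:E.
  by move=> h1 /le_trans/(_ h1); rewrite leeBrDl.
apply: ge_ereal_sup => _ [h [bh h01 h0] <-].
rewrite leeBrDl//.
pose f' x := Num.max (f x - d)%R 0%R.
have bf' : bcont f'.
  by apply: bcont_max; [apply: bcontB => //|]; exact: bcont_cst.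
have lf' : (l f <= l f' + d)%R.
  rewrite -[X in (_ + X)%R](l_cst d) -l_add//; last exact: bcont_cst.
  apply: l_le => //; first by apply: bcontD => //; exact: bcont_cst.
  by move=> x; rewrite -lerBlDr le_max lexx.
apply: (@le_trans _ _ ((l f' + l h)%R%:E + d%:E)).
  by rewrite -EFinD lee_fin addrAC lerD2r.
rewrite leeD2r// -l_add//; apply: lam_ge; split; first exact: bcontD.
- move=> x; have /andP[fx0 fx1] := f01 x; have /andP[hx0 hx1] := h01 x.
  rewrite /f'; have [fd|fd] := ltP (f x) d.
    by rewrite (max_idPr _) ?add0r ?hx0// subr_le0 ltW.
  rewrite h0 ?addr0; last by move=> -[_ /=]; rewrite ltNge fd.
  by rewrite le_max lexx orbT/= ge_max ler01 andbT lerBlDr (le_trans fx1)// lerDl ltW.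
- move=> x Wx; rewrite h0; last by move=> -[].
  by rewrite /f' f0 ?addr0; [apply/max_idPr; rewrite sub0r oppr_le0 ltW|move=> -[]].
Qed.

Let borel_cara (A : set (borel V)) : measurable A -> mo.-caratheodory A.
Proof.
have : @measurable _ (borel V) `<=` @measurable _ (caratheodory_type mo).
  apply: smallest_sub; first exact: sigma_algebra_measurable.
  by move=> U oU; exact: open_cara.
by move=> h /h.
Qed.

Let nu (A : set (borel V)) : \bar R := mu A.

Let nu_sigma : semi_sigma_additive nu.
Proof.
move=> F mF tF mUF.
apply: (@caratheodory_measure_sigma_additive R V mo F) => //.
  by move=> i; exact: borel_cara.
exact: borel_cara.
Qed.

Let nu_setT : nu setT = 1.
Proof.
rewrite /nu mu_open; last exact: openT.
apply/eqP; rewrite eq_le lam_le1/= -l1; apply: lam_ge; split=> //.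
- exact: bcont_cst.
- by move=> x; rewrite ler01 lexx.
- by move=> x; case.
Qed.

(** A positive normalized functional that is tight is an integral. Each layer of
    [N * f] is subordinate to the open set where [f] exceeds its base, so that
    [l] of it is at most the measure of that set; summing the layers gives
    [l f <= \int f + 1 / N], and the same for [1 - f] gives equality. The second
    part of the conclusion gives access to the measure of open sets, through
    which tightness passes from [l] to the measure. *)
Theorem riesz_tight : exists nu : probability (borel V) R,
  (forall f, bcont f -> \int[nu]_x (f x)%:E = (l f)%:E) /\
  (forall (U : set V) (e : R), open U ->
    (forall f, bcont f -> (forall x, 0 <= f x <= 1)%R ->
      (forall x, ~ U x -> f x = 0%R) -> (l f <= e)%R) -> nu U <= e%:E).
Proof.
pose M : {measure set (borel V) -> \bar R} :=
  HB.pack_for {measure set (borel V) -> \bar R} nu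
    (isMeasure.Build _ _ _ nu mu0 mu_ge0 nu_sigma).
pose Q : probability (borel V) R :=
  HB.pack_for (probability (borel V) R) nu M
    (Measure_isProbability.Build _ _ _ M nu_setT).
have Qopen U : open U -> Q U = lam U by exact: mu_open.
exists Q; split; last first.
  move=> U e oU Ue; rewrite Qopen//; apply: ge_ereal_sup => _ [f [bf f01 f0] <-].
  by rewrite lee_fin Ue.
have le01 f : bcont f -> (forall x, 0 <= f x <= 1)%R -> (l f <= \int[Q]_x f x)%R.
  move=> bf f01; apply/ler_addgt0Pr => e e0.
  pose N := (Num.truncn (e^-1)).+1.
  have N0 : (0 < N%:R :> R)%R by rewrite ltr0n.
  have Ne : (N%:R^-1 <= e)%R.
    rewrite -[leRHS]invrK lef_pV2 ?posrE ?invr_gt0//.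
    by rewrite ltW// truncnS_gt.
  pose fj (j : 'I_N) x := clip01 (N%:R * f x - j%:R)%R.
  have bfj j : bcont (fj j).
    apply: bcont_max; first exact: bcont_cst.
    apply: bcont_min; first exact: bcont_cst.
    by apply: bcontB; [exact: bcontZ|exact: bcont_cst].
  have sumfj x : (f x = N%:R^-1 * \sum_(j < N) fj j x)%R.
    rewrite sum_clip01 ?mulKf ?gt_eqF//.
    have /andP[? ?] := f01 x; rewrite mulr_ge0 ?ler0n//=.
    by rewrite ler_piMr ?ler0n.
  have oj (j : 'I_N) : open [set x | j%:R < N%:R * f x]%R.
    by apply: open_lt_bcont; [exact: bcont_cst|exact: bcontZ].
  have lfj (j : 'I_N) : (l (fj j) <= fine (Q [set x | j%:R < N%:R * f x]%R))%R.
    rewrite -lee_fin fineK; last by rewrite fin_num_measure//; exact: open_measurable_borel.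
    rewrite Qopen//; apply: lam_ge; split=> //.
      by move=> x; exact: clip01_itv.
    move=> x /= /negP; rewrite -leNgt => h.
    apply/max_idPl; rewrite ge_min; apply/orP; right.
    by rewrite subr_le0.
  have -> : l f = (N%:R^-1 * \sum_(j < N) l (fj j))%R.
    rewrite -l_sum// -l_scale; last by apply: bcont_sum.
    by congr l; apply/funext => x; exact: sumfj.
  apply: (@le_trans _ _ (N%:R^-1 * \sum_(j < N) fine (Q [set x | j%:R < N%:R * f x]))%R).
    by rewrite ler_pM2l ?invr_gt0//; apply: ler_sum.
  have bind (j : 'I_N) : bmf (\1_[set x | j%:R < N%:R * f x]%R : borel V -> R).
    by apply: bmf_indic; exact: open_measurable_borel.
  rewrite -(eq_bigr _ (fun j _ => @bint_indic _ (borel V) R Q _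
    (open_measurable_borel (oj j)))).
  rewrite -bint_sum// -bintZ; last exact: bmf_sum.
  rewrite -[X in (_ + X)%R](bint_cst Q) -bintD; [|exact: bcont_bmf|exact: bmf_cst].
  apply: le_bint; first by apply: bmfZ; exact: bmf_sum.
    by apply: bmfD; [exact: bcont_bmf|exact: bmf_cst].
  move=> x; have /andP[fx0 fx1] := f01 x.
  have /sum_below/andP[_ +] : (0 <= N%:R * f x <= N%:R)%R.
    by rewrite mulr_ge0//= ler_piMr.
  move=> h; rewrite ler_pdivrMl//.
  under eq_bigr do rewrite indic_bool.
  apply: le_trans h _; rewrite mulrDr lerD2l -ler_pdivrMl// mulr1//.
have eq01 f : bcont f -> (forall x, 0 <= f x <= 1)%R -> (l f = \int[Q]_x f x)%R.
  move=> bf f01; apply/eqP; rewrite eq_le le01//=.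
  have b1f : bcont (fun x => 1 - f x)%R by apply: bcontB => //; exact: bcont_cst.
  have := le01 _ b1f; rewrite l_sub ?l1//; last exact: bcont_cst.
  rewrite bintB; [|exact: bmf_cst|exact: bcont_bmf].
  rewrite bint_cst lerD2l lerN2; apply => x; have := f01 x.
  by rewrite subr_ge0 gerBl andbC.
move=> f bf; rewrite -EFin_Rintegral; last exact: bcont_bmf.
congr EFin; have [_ [C fC]] := bf.
have C0 : (0 <= C)%R by exact: le_trans (normr_ge0 _) (fC 0%R).
pose c := (2 * (C + 1))%R.
have c0 : (0 < c)%R by rewrite mulr_gt0// ltr_wpDl.
pose g x := (c^-1 * (f x + (C + 1)))%R.
have bg : bcont g by apply: bcontZ; apply: bcontD => //; exact: bcont_cst.
have g01 x : (0 <= g x <= 1)%R.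
  have := fC x; rewrite ler_norml => /andP[? ?].
  apply/andP; split; last by rewrite ler_pdivrMl// mulr1 /c; lra.
  by apply: mulr_ge0; [rewrite invr_ge0 ltW|lra].
have fg : f = (fun x => c * g x - (C + 1))%R.
  by apply/funext => x; rewrite /g mulrA divff ?gt_eqF// mul1r addrK.
rewrite [in RHS]fg [in LHS]fg l_sub; [|exact: bcontZ|exact: bcont_cst].
rewrite l_scale// l_cst bintB; [|apply: bmfZ; exact: bcont_bmf|exact: bmf_cst].
by rewrite bint_cst bintZ ?eq01//; exact: bcont_bmf.
Qed.

End riesz.

(** * Trigonometric integrals determine weak limits of tight sequences *)

Lemma bounded_funP (R : realType) (T : Type) (f : T -> R) : bounded_fun f ->
  exists M : R, forall x, `|f x| <= M.
Proof.
by case=> M [_ Mf]; exists (M + 1) => x; apply: (Mf (M + 1)); rewrite // ltrDl.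
Qed.

Section trigonometric_determination.
Context (R : realType) (V : normedModType R).

Lemma compact_measurable_borel (K : set V) : compact K ->
  measurable (K : set (borel V)).
Proof.
move=> cK; apply: closed_measurable_borel; apply: compact_closed cK.
exact: norm_hausdorff.
Qed.

Lemma trigpoly_bcont (g : V -> R) : trigpoly g -> bcont g.
Proof. by move=> tg; split; [exact: trigpoly_continuous|exact: trigpoly_bounded]. Qed.

(** The approximating functions [g] depend on the compact set [K n], but their
    bound on the whole space does not; hence the mass [r] that may be missed by
    the compact set can be fixed before that set is chosen. *)
Lemma trigpoly_integral_approx (f : V -> R) (K : nat -> set V) (e : R) :
  bcont f -> (forall n, compact (K n)) -> 0 < e ->
  exists2 r : R, 0 < r & forall n, exists2 g : V -> R, trigpoly g &
    forall Q : probability (borel V) R, (Q (~` K n) <= r%:E)%E ->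
      `|\int[Q]_x f x - \int[Q]_x g x| <= e.
Proof.
move=> bf cK e0; have [cf [B fB]] := bf.
have B0 : 0 <= B by exact: le_trans (normr_ge0 _) (fB 0).
pose s := 2 * B + e / 2.
have s0 : 0 < s by rewrite ltr_wpDl ?divr_gt0// mulr_ge0.
have e20 : 0 < e / 2 by rewrite divr_gt0.
exists (e / 2 / s); first by rewrite divr_gt0.
move=> n; have [g [tg fg gB]] := trigpoly_dense (cK n) cf fB e20.
exists g => // Q QK.
have bg := trigpoly_bcont tg.
have mK : measurable (~` K n : set (borel V)).
  by apply: measurableC; exact: compact_measurable_borel.
rewrite -bintB; [|exact: bcont_bmf|exact: bcont_bmf].
have : `|\int[Q]_x (f x - g x)| <= e / 2 + s * fine (Q (~` K n)).
  apply: bint_norm_le_off => //.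
  - by apply: bcont_bmf; exact: bcontB.
  - exact: ltW.
  - exact: ltW.
  - by move=> x /contrapT; exact: fg.
  - move=> x; rewrite (le_trans (ler_normB _ _))// /s mulr2n mulrDl mul1r -addrA.
    by rewrite lerD.
move=> /le_trans; apply; rewrite [leRHS]splitr lerD2l.
rewrite -ler_pdivlMl// mulrC -lee_fin fineK//.
by rewrite fin_num_measure.
Qed.

Lemma trigpoly_measure_eq (P Q : probability (borel V) R) :
  (forall e : R, 0 < e -> exists2 K : set V, compact K &
    (P (~` K) <= e%:E)%E /\ (Q (~` K) <= e%:E)%E) ->
  (forall (L : {linear V -> R^o}) (c : R), continuous L ->
    \int[P]_x cos (L x + c) = \int[Q]_x cos (L x + c)) ->
  forall f : V -> R, bcont f -> \int[P]_x f x = \int[Q]_x f x.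
Proof.
move=> PQt PQ f bf; apply/eqP; rewrite -subr_eq0 -normr_le0.
apply/ler_addgt0Pr => e e0; rewrite add0r.
have e20 : 0 < e / 2 by rewrite divr_gt0.
have [K hK] : {K : nat -> set V & forall n, compact (K n) /\
    (P (~` K n) <= n.+1%:R^-1%:E)%E /\ (Q (~` K n) <= n.+1%:R^-1%:E)%E}.
  apply: (@choice _ _ (fun n K => compact K /\
    (P (~` K) <= n.+1%:R^-1%:E)%E /\ (Q (~` K) <= n.+1%:R^-1%:E)%E)) => n.
  by have [|K cK KPQ] := PQt n.+1%:R^-1; [rewrite invr_gt0|exists K].
have [r r0 rg] := trigpoly_integral_approx bf (fun n => (hK n).1) e20.
pose n := Num.truncn r^-1.
have nr : n.+1%:R^-1 <= r.
  by rewrite -[leRHS]invrK lef_pV2 ?posrE ?invr_gt0// ltW// truncnS_gt.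
have [g tg gPQ] := rg n.
have [_ [KP KQ]] := hK n.
have hQ : `|\int[Q]_x f x - \int[Q]_x g x| <= e / 2.
  by apply: gPQ; apply: le_trans KQ _; rewrite lee_fin.
have hP : `|\int[P]_x f x - \int[P]_x g x| <= e / 2.
  by apply: gPQ; apply: le_trans KP _; rewrite lee_fin.
have eg : \int[P]_x g x = \int[Q]_x g x.
  elim: tg => [L c cL|f1 f2 t1 ih1 t2 ih2|a h th ih].
  - exact: PQ.
  - by rewrite !bintD ?ih1 ?ih2//; exact/bcont_bmf/trigpoly_bcont.
  - by rewrite !bintZ ?ih//; exact/bcont_bmf/trigpoly_bcont.
rewrite eg in hP; rewrite distrC in hQ.
rewrite [X in `|X|](_ : _ = (\int[P]_x f x - \int[Q]_x g x) +
   (\int[Q]_x g x - \int[Q]_x f x)); last by rewrite subrKA.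
by rewrite (le_trans (ler_normD _ _))// [leRHS]splitr lerD.
Qed.

Section prokhorov.
Context (Q : nat -> probability (borel V) R).
Hypothesis Q_tight : forall e : R, 0 < e -> exists2 K : set V, compact K &
  forall n, (Q n (~` K) <= e%:E)%E.
Hypothesis Q_trig : forall (L : {linear V -> R^o}) (c : R), continuous L ->
  cvgn (fun n => \int[Q n]_x cos (L x + c)).

Let Q_bcont (f : V -> R) : bcont f -> cvgn (fun n => \int[Q n]_x f x).
Proof.
move=> bf; apply/cauchy_cvgP; apply: cauchy_exP => e e0.
have e40 : 0 < e / 4 by rewrite divr_gt0.
have [K hK] : {K : nat -> set V & forall n, compact (K n) /\
    forall k, (Q k (~` K n) <= n.+1%:R^-1%:E)%E}.
  apply: (@choice _ _ (fun n K => compact K /\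
    forall k, (Q k (~` K) <= n.+1%:R^-1%:E)%E)) => n.
  by have [|K cK KQ] := Q_tight (e := n.+1%:R^-1); [rewrite invr_gt0|exists K].
have [r r0 rg] := trigpoly_integral_approx bf (fun n => (hK n).1) e40.
pose n := Num.truncn r^-1.
have nr : n.+1%:R^-1 <= r.
  by rewrite -[leRHS]invrK lef_pV2 ?posrE ?invr_gt0// ltW// truncnS_gt.
have [g tg gQ] := rg n.
have {}gQ k : `|\int[Q k]_x f x - \int[Q k]_x g x| <= e / 4.
  by apply: gQ; have [_ KQ] := hK n; apply: le_trans (KQ k) _; rewrite lee_fin.
have : cvgn (fun n => \int[Q n]_x g x).
  elim: tg => [L c cL|f1 f2 t1 ih1 t2 ih2|a h th ih].
  - exact: Q_trig.
  - have b1 := bcont_bmf (trigpoly_bcont t1); have b2 := bcont_bmf (trigpoly_bcont t2).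
    under eq_fun do rewrite (bintD _ b1 b2).
    exact: is_cvgD.
  - under eq_fun do rewrite (bintZ _ _ (bcont_bmf (trigpoly_bcont th))).
    move: ih => /cvg_ex[y hy]; apply/cvg_ex; exists (a * y).
    by apply: cvgM => //; exact: cvg_cst.
move=> /cvg_ex[y /cvgrPdist_lt/(_ _ e40) gy]; exists y.
apply: filterS gy => k; rewrite -ball_normE/= => gy.
have := gQ k; move: gy; rewrite !ltr_norml !ler_norml => /andP[? ?] /andP[? ?].
by apply/andP; split; lra.
Qed.

(** Trigonometric approximation on compact sets of uniformly large mass makes the
    integrals of a bounded continuous function Cauchy, and the limit functional
    is positive and as tight as the sequence. *)
Theorem weak_cvg_of_trig : exists nu : probability (borel V) R,
  [/\ forall e : R, 0 < e -> exists2 K : set V, compact K & (nu (~` K) <= e%:E)%E,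
      weak_cvg Q nu &
      forall (f : V -> R), bcont f ->
        \int[Q n]_x f x @[n --> \oo] --> \int[nu]_x f x].
Proof.
pose l (f : V -> R) := limn (fun n => \int[Q n]_x f x).
have lP f : bcont f -> \int[Q n]_x f x @[n --> \oo] --> l f by exact: Q_bcont.
have lU f a : \int[Q n]_x f x @[n --> \oo] --> a -> l f = a.
  by move=> fa; apply: cvg_lim => //; exact: Rhausdorff.
have [| | | | |nu [nul nuU]] := @riesz_tight R V l.
- move=> f g bf bg; apply: lU; under eq_fun do rewrite (bintD _ (bcont_bmf bf) (bcont_bmf bg)).
  by apply: cvgD; exact: lP.
- move=> a f bf; apply: lU; under eq_fun do rewrite (bintZ _ _ (bcont_bmf bf)).
  by apply: cvgM; [exact: cvg_cst|exact: lP].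
- move=> f g bf bg fg; apply: ler_lim; [exact: Q_bcont|exact: Q_bcont|].
  by apply: nearW => n; apply: le_bint => //; exact: bcont_bmf.
- by apply: lU; under eq_fun do rewrite bint_cst; exact: cvg_cst.
- move=> e e0; have [K cK KQ] := Q_tight e0; exists K => // f a bf a0 f1 fK.
  have mK : measurable (~` K : set (borel V)).
    by apply: measurableC; exact: compact_measurable_borel.
  apply: limr_le; first exact: Q_bcont.
  apply: nearW => n.
  apply: (@le_trans _ _ (\int[Q n]_x (a + \1_(~` K) x))).
    apply: le_bint; first exact: bcont_bmf.
      by apply: bmfD; [exact: bmf_cst|exact: bmf_indic].
    move=> x; rewrite indicE; have [xK|xK] := boolP (x \in ~` K).
      by rewrite (le_trans (f1 x))// lerDr.
    rewrite addr0 fK//; apply: contrapT => Kx.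
    by move: xK; rewrite (mem_set (A := ~` K))//.
  rewrite bintD; [|exact: bmf_cst|exact: bmf_indic].
  rewrite bint_cst bint_indic// lerD2l -lee_fin fineK//.
  by rewrite fin_num_measure.
have nuR f : bcont f -> \int[nu]_x f x = l f.
  by move=> bf; rewrite /Rintegral nul.
exists nu; split.
- move=> e e0; have [K cK KQ] := Q_tight e0; exists K => //.
  have mK : measurable (~` K : set (borel V)).
    by apply: measurableC; exact: compact_measurable_borel.
  apply: nuU; first by apply: closed_openC; apply: compact_closed cK; exact: norm_hausdorff.
  move=> f bf f01 f0; apply: limr_le; first exact: Q_bcont.
  apply: nearW => n; apply: (@le_trans _ _ (\int[Q n]_x (\1_(~` K) x))).
    apply: le_bint; [exact: bcont_bmf|exact: bmf_indic|].
    move=> x; rewrite indicE; have [xK|xK] := boolP (x \in ~` K).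
      by have /andP[] := f01 x.
    by rewrite f0// => Kx; move: xK; rewrite (mem_set (A := ~` K)).
  rewrite bint_indic// -lee_fin fineK//.
  by rewrite fin_num_measure.
- move=> f cf /bounded_funP bf.
  have bcf : bcont f by split.
  rewrite nul//; under eq_fun do rewrite -(EFin_Rintegral _ (bcont_bmf bcf)).
  by apply: cvg_EFin; [exact: nearW|exact: lP].
- by move=> f bf; rewrite nuR//; exact: lP.
Qed.

End prokhorov.
End trigonometric_determination.

(** * The central limit theorem for trigonometric integrals *)

Section taylor_estimates.
Context (R : realType).
Implicit Types x u : R.

Lemma mvt_at0 (f f' : R -> R) : (forall x, is_derive x 1 f (f' x)) ->
  forall u, exists2 c, `|c| <= `|u| & f u - f 0 = f' c * u.
Proof.
move=> df u; have cf : continuous f.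
  move=> x; apply/differentiable_continuous/derivable1_diffP.
  by have [] := df x.
have cw (a b : R) : {within `[a, b], continuous f}.
  exact: continuous_subspaceT.
have [u0|u0] := leP 0 u.
  have [c /[!in_itv]/= /andP[c0 cu] ->] := MVT_segment u0 (fun x _ => df x) (cw _ _).
  by exists c; [rewrite !ger0_norm|rewrite subr0].
have [c /[!in_itv]/= /andP[cu c0] e] := MVT_segment (ltW u0) (fun x _ => df x) (cw _ _).
exists c; first by rewrite !ler0_norm ?lerN2 ?(ltW u0).
by apply: oppr_inj; rewrite opprB e sub0r mulrN.
Qed.

Lemma sin_le_norm u : `|sin u| <= `|u|.
Proof.
have [c _] := mvt_at0 (@is_derive_sin R) u; rewrite sin0 subr0 => ->.
by rewrite normrM ler_piMl// cos_max.
Qed.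

Lemma cos_taylor1 u : 0 <= 1 - cos u <= u ^+ 2 / 2.
Proof.
rewrite subr_ge0 cos_le1/=.
have {1}-> : u = (u / 2) *+ 2 by rewrite mulr2n -splitr.
rewrite cos_mulr2n cos2sin2.
have : sin (u / 2) ^+ 2 <= (u / 2) ^+ 2.
  by rewrite -real_normK ?num_real// -[leRHS]real_normK ?num_real// lerXn2r ?nnegrE// sin_le_norm.
have -> : (u / 2) ^+ 2 = u ^+ 2 / 4 by field.
by move: (sin (u / 2) ^+ 2) (u ^+ 2) => s v; rewrite -mulr_natr; lra.
Qed.

Lemma sin_taylor3 u : `|sin u - u| <= `|u| ^+ 3 / 2.
Proof.
have D x : is_derive x 1 (fun x => sin x - x) (cos x - 1) by apply: is_deriveB.
have [c cu] := mvt_at0 D u; rewrite sin0 subr0 subr0 => ->.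
rewrite normrM exprSr mulrAC ler_wpM2r// distrC.
have /andP[c0 c1] := cos_taylor1 c; rewrite ger0_norm//.
apply: le_trans c1 _; rewrite ler_wpM2r ?invr_ge0//.
by rewrite -real_normK ?num_real// lerXn2r ?nnegrE.
Qed.

Lemma sin_taylor2 u : `|sin u - u| <= 2 * u ^+ 2.
Proof.
have := sin_taylor3 u; have : `|sin u - u| <= 2 * `|u|.
  by rewrite (le_trans (ler_normB _ _))// mulr2n mulrDl mul1r lerD2r sin_le_norm.
rewrite -[u ^+ 2]real_normK ?num_real//; move: `|sin u - u| `|u| (normr_ge0 u) => s a a0 h1 h2.
have [a1|a1] := leP a 1.
  apply: le_trans h2 _; rewrite exprSr; have : 0 <= a ^+ 2 by rewrite exprn_ge0.
  by nra.
by apply: le_trans h1 _; rewrite ler_pM2l// expr2; nra.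
Qed.

Lemma cos_taylor4 u : `|cos u - 1 + u ^+ 2 / 2| <= `|u| ^+ 4 / 2.
Proof.
have D x : is_derive x 1 (fun x => cos x + x ^+ 2 / 2) (x - sin x).
  apply: is_derive_eq; rewrite addrC; congr (_ + _).
  by rewrite !scaler0 add0r /GRing.scale/= mulr1; field.
have [c cu] := mvt_at0 D u; rewrite cos0 expr0n/= mul0r addr0 => h.
rewrite addrAC h normrM [in leRHS]exprSr mulrAC ler_wpM2r// distrC.
apply: le_trans (sin_taylor3 c) _.
by rewrite ler_wpM2r ?invr_ge0// lerXn2r ?nnegrE.
Qed.

Lemma cos_taylor2 u : `|cos u - 1 + u ^+ 2 / 2| <= u ^+ 2.
Proof.
have /andP[c0 c1] := cos_taylor1 u.
have := sqr_ge0 u; rewrite ler_norml => u0; apply/andP; split; lra.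
Qed.

Lemma expRN_taylor x : 0 <= x -> `|expR (- x) - 1 + x| <= x ^+ 2.
Proof.
move=> x0; rewrite ger0_norm; last first.
  by have := expR_ge1Dx (- x); lra.
have h := expR_ge1Dx x; rewrite expRN.
have : (expR x)^-1 <= (1 + x)^-1 by rewrite lef_pV2 ?posrE ?expR_gt0//; lra.
suff : (1 + x)^-1 <= 1 - x + x ^+ 2 by lra.
rewrite -[leLHS]mulr1 ler_pdivrMl; last by lra.
rewrite [x ^+ 2]expr2; nra.
Qed.

End taylor_estimates.

Section bmf_functional.
Context d (S : measurableType d) (R : realType) (h : (S -> R) -> R) (C : R).
Hypothesis h_add : forall f g, bmf f -> bmf g -> h (fun x => f x + g x) = h f + h g.
Hypothesis h_scale : forall a f, bmf f -> h (fun x => a * f x) = a * h f.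
Hypothesis h_bnd : forall f (M : R), bmf f -> (forall x, `|f x| <= M) -> `|h f| <= C * M.
Hypothesis h_indic : forall A, measurable A -> h (\1_A) = 0.

(** Bounded measurable functions are uniform limits of combinations of
    indicators. Used to pass from identities between probabilities of events
    (independence, equality of laws, densities) to identities between
    integrals. *)
Lemma bmf_functional_eq0 f : bmf f -> h f = 0.
Proof.
have h0 : h (fun=> 0) = 0.
  rewrite (_ : (fun=> 0) = (fun x : S => 0 * (fun=> 0) x)).
    by rewrite h_scale ?mul0r//; exact: bmf_cst.
  by apply/funext => x; rewrite mul0r.
have h1 : h (fun=> 1) = 0.
  rewrite (_ : (fun=> 1) = \1_[set: S]); last by apply/funext => x; rewrite indicT.
  exact: h_indic.
have h_sum n (F : 'I_n -> S -> R) : (forall i, bmf (F i)) -> (forall i, h (F i) = 0) ->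
    h (fun x => \sum_(i < n) F i x) = 0.
  elim: n F => [|n ih] F bF F0.
    by under eq_fun do rewrite big_ord0; exact: h0.
  under eq_fun do rewrite big_ord_recr/=.
  by rewrite h_add ?F0 ?ih ?addr0//; apply: bmf_sum.
have h01 g : bmf g -> (forall x, 0 <= g x <= 1) -> h g = 0.
  move=> bg g01; apply/eqP; rewrite -normr_le0; apply/ler_addgt0Pr => e e0.
  rewrite add0r.
  have C1 : 0 < `|C| + 1 by rewrite ltr_wpDl.
  pose N := (Num.truncn ((`|C| + 1) / e)).+1.
  have N0 : 0 < N%:R :> R by rewrite ltr0n.
  have Ne : (`|C| + 1) / N%:R <= e.
    by rewrite ler_pdivrMr// -ler_pdivrMl// mulrC ltW// truncnS_gt.
  have mI (j : 'I_N) : measurable [set x | j%:R < N%:R * g x].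
    rewrite (_ : mkset _ = (fun x => N%:R * g x) @^-1` `]j%:R, +oo[); last first.
      by apply/seteqP; split=> x /=; rewrite in_itv/= andbT.
    have [+ _] := bmfZ N%:R bg => /(_ measurableT `]j%:R, +oo[%classic).
    by rewrite setTI; apply; exact: measurable_itv.
  pose s x := N%:R^-1 * \sum_(j < N) \1_[set x | j%:R < N%:R * g x] x : R.
  have bs : bmf s by apply: bmfZ; apply: bmf_sum => j; exact: bmf_indic.
  have hs : h s = 0.
    rewrite h_scale ?h_sum ?mulr0//.
    - by move=> j; exact: bmf_indic.
    - by move=> j; exact: h_indic.
    - by apply: bmf_sum => j; exact: bmf_indic.
  have bgs : bmf (fun x => g x - s x) by exact: bmfB.
  have gs x : `|g x - s x| <= N%:R^-1.
    have /andP[g0 g1] := g01 x.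
    have /sum_below/andP[l1 l2] : 0 <= N%:R * g x <= N%:R.
      by rewrite mulr_ge0//= ler_piMr.
    rewrite /s; under eq_bigr do rewrite indic_bool.
    rewrite distrC -[X in _ - X](mulKf (lt0r_neq0 N0)) -mulrBr normrM.
    rewrite [X in X * _]ger0_norm ?invr_ge0// ler_piMr ?invr_ge0//.
    by rewrite ger0_norm; lra.
  have -> : h g = h (fun x => g x - s x).
    have -> : (fun x => g x - s x) = (fun x => g x + -1 * s x).
      by apply/funext => x; rewrite mulN1r.
    by rewrite (h_add bg (bmfZ (-1) bs)) (h_scale (-1) bs) hs mulr0 addr0.
  apply: le_trans (h_bnd bgs gs) _; apply: le_trans Ne.
  rewrite ler_wpM2r ?invr_ge0//; have := ler_norm C; lra.
move=> bf; have [_ [M fM]] := bf.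
pose c := 2 * (`|M| + 1).
have c0 : 0 < c by rewrite mulr_gt0// ltr_wpDl.
pose g x := c^-1 * (f x + (`|M| + 1)).
have bg : bmf g by apply: bmfZ; apply: bmfD => //; exact: bmf_cst.
have g01 x : 0 <= g x <= 1.
  have := le_trans (fM x) (ler_norm M); rewrite ler_norml => /andP[? ?].
  apply/andP; split; last by rewrite ler_pdivrMl// mulr1 /c; lra.
  by apply: mulr_ge0; [rewrite invr_ge0 ltW|lra].
have fg : f = (fun x => c * g x + (- (`|M| + 1)) * 1).
  by apply/funext => x; rewrite /g mulrA divff ?gt_eqF// mul1r mulr1 addrK.
rewrite fg h_add; [|exact: bmfZ|exact: bmfZ (bmf_cst _ 1)].
by rewrite (h_scale _ bg) (h_scale _ (bmf_cst _ 1)) h01// h1 !mulr0 addr0.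
Qed.

End bmf_functional.

Section independence.
Context d (T : measurableType d) (R : realType) (P : probability T R).
Context d' (S : measurableType d').

Lemma bmf_comp (X : T -> S) (f : S -> R) : measurable_fun setT X -> bmf f ->
  bmf (fun w => f (X w)).
Proof.
move=> mX [mf [M fM]]; split; first exact: measurableT_comp.
by exists M => w; exact: fM.
Qed.

Lemma indic_comp (X : T -> S) (A : set S) w : \1_A (X w) = \1_(X @^-1` A) w :> R.
Proof. by rewrite !indicE; congr (_%:R); congr nat_of_bool; apply/idP/idP; rewrite !inE. Qed.

Lemma integral_indep (U : T -> R) (X : T -> S) (f : S -> R) :
  bmf U -> measurable_fun setT X ->
  (forall A, measurable A ->
    \int[P]_w (U w * \1_(X @^-1` A) w) = \int[P]_w U w * fine (P (X @^-1` A))) ->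
  bmf f ->
  \int[P]_w (U w * f (X w)) = \int[P]_w U w * \int[P]_w f (X w).
Proof.
move=> bU mX UX bf; apply/eqP; rewrite -subr_eq0; apply/eqP.
have [_ [B UB]] := bU.
pose h (f : S -> R) := \int[P]_w (U w * f (X w)) - \int[P]_w U w * \int[P]_w f (X w).
have mpre A : measurable A -> measurable (X @^-1` A).
  by move=> mA; rewrite -[X in measurable X]setTI; exact: mX.
apply: (@bmf_functional_eq0 _ S R h (B + B)) => //.
- move=> g1 g2 b1 b2; rewrite /h.
  have c1 := bmf_comp mX b1; have c2 := bmf_comp mX b2.
  under eq_Rintegral do rewrite mulrDr.
  by rewrite (bintD _ (bmfM bU c1) (bmfM bU c2)) (bintD _ c1 c2); ring.
- move=> a g bg; rewrite /h; have cg := bmf_comp mX bg.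
  under eq_Rintegral do rewrite mulrCA.
  by rewrite (bintZ _ _ (bmfM bU cg)) (bintZ _ _ cg); ring.
- move=> g M bg gM; rewrite /h; have cg := bmf_comp mX bg.
  rewrite (le_trans (ler_normB _ _))// mulrDl lerD//.
    apply: bint_norm_le; first exact: bmfM.
    by move=> w'; rewrite normrM ler_pM.
  rewrite normrM ler_pM//; first exact: bint_norm_le.
  exact: bint_norm_le.
- move=> A mA; rewrite /h; under eq_Rintegral do rewrite indic_comp.
  have -> : (fun w => \1_A (X w)) = \1_(X @^-1` A) :> (T -> R).
    by apply/funext => w; exact: indic_comp.
  by rewrite UX// bint_indic ?subrr//; exact: mpre.
Qed.

Lemma integral_same_law (X Y : T -> S) (f : S -> R) :
  measurable_fun setT X -> measurable_fun setT Y ->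
  (forall A, measurable A -> P (X @^-1` A) = P (Y @^-1` A)) -> bmf f ->
  \int[P]_w f (X w) = \int[P]_w f (Y w).
Proof.
move=> mX mY XY bf; apply/eqP; rewrite -subr_eq0; apply/eqP.
pose h (f : S -> R) := \int[P]_w f (X w) - \int[P]_w f (Y w).
have mpre (Z : T -> S) A : measurable_fun setT Z -> measurable A -> measurable (Z @^-1` A).
  by move=> mZ mA; rewrite -[X in measurable X]setTI; exact: mZ.
apply: (@bmf_functional_eq0 _ S R h (1 + 1)) => //.
- move=> g1 g2 b1 b2; rewrite /h.
  rewrite (bintD _ (bmf_comp mX b1) (bmf_comp mX b2)).
  by rewrite (bintD _ (bmf_comp mY b1) (bmf_comp mY b2)); ring.
- move=> a g bg; rewrite /h (bintZ _ _ (bmf_comp mX bg)) (bintZ _ _ (bmf_comp mY bg)).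
  by rewrite mulrBr.
- move=> g M bg gM; rewrite (le_trans (ler_normB _ _))// mulrDl mul1r lerD//.
    by apply: bint_norm_le => //; exact: bmf_comp.
  by apply: bint_norm_le => //; exact: bmf_comp.
- move=> A mA; rewrite /h.
  have e (Z : T -> S) : (fun w => \1_A (Z w)) = \1_(Z @^-1` A) :> (T -> R).
    by apply/funext => w; exact: indic_comp.
  by rewrite !e !bint_indic ?XY ?subrr//; exact: mpre.
Qed.

End independence.

Section characteristic_recursion.
Context d (T : measurableType d) (R : realType) (P : probability T R).
Context (Y : nat -> {RV P >-> R}) (a : R).
Hypothesis Yind : independent_seq Y.

(* Varying the phase [c], the functions [W k c] also comprise the sines of the
   partial sums, so that a single family is closed under adding a summand. *)
Let W k c w : R := cos (c + a * \sum_(i < k) Y i w).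

Let bW k c : bmf (W k c).
Proof.
split; last by exists 1 => w; exact: cos_max.
apply: (measurableT_comp (f := @cos R)).
  by apply: continuous_measurable_fun; exact: continuous_cos.
apply: measurable_funD => //; apply: measurable_funM => //.
by apply: measurable_sum.
Qed.

Let bcosY : bmf (fun y : R => cos (a * y)).
Proof.
split; last by exists 1 => w; exact: cos_max.
apply: (measurableT_comp (f := @cos R)).
  by apply: continuous_measurable_fun; exact: continuous_cos.
exact: measurable_funM.
Qed.

Let bsinY : bmf (fun y : R => sin (a * y)).
Proof.
split; last by exists 1 => w; exact: sin_max.
apply: (measurableT_comp (f := @sin R)).
  by apply: continuous_measurable_fun; exact: continuous_sin.
exact: measurable_funM.
Qed.

Let WS k c w : W k.+1 c w =
  W k c w * cos (a * Y k w) - W k (c - pi / 2) w * sin (a * Y k w).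
Proof.
rewrite /W big_ord_recr/= mulrDr addrA cosD; congr (_ - _ * _).
by rewrite addrAC cosBpihalf.
Qed.

Let I (J : {fset nat}) (A : nat -> set R) := \bigcap_(i in [set` J]) Y i @^-1` A i.

Let mI J A : (forall i, measurable (A i)) -> measurable (I J A).
Proof.
move=> mA; apply: fin_bigcap_measurable => // i _.
by rewrite -[X in measurable X]setTI; exact: measurable_funP.
Qed.

(* The hypothesis speaks of finitely many events, whereas the recursion needs
   [Y k] to be independent of a function of [Y 0], .., [Y k.-1]. The functions
   are introduced one variable at a time: [W k] is shown to be independent of all
   the events that involve the later variables. *)
Let W_indep k : forall c (J : {fset nat}) (A : nat -> set R),
  (forall i, measurable (A i)) -> (forall j, j \in J -> (k <= j)%N) ->
  \int[P]_w (W k c w * \1_(I J A) w) =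
  \int[P]_w W k c w * \prod_(j <- J) fine (P (Y j @^-1` A j)).
Proof.
elim: k => [|k ih] c J A mA Jk.
  rewrite /W; under eq_Rintegral do rewrite big_ord0 mulr0 addr0.
  under [in RHS]eq_Rintegral do rewrite big_ord0 mulr0 addr0.
  rewrite bintZ; last by apply: bmf_indic; exact: mI.
  rewrite bint_cst bint_indic; last exact: mI.
  rewrite Yind//; congr (_ * _); apply: EFin_inj; rewrite -prodEFin fineK.
    apply: eq_bigr => i _; rewrite fineK// fin_num_measure//.
    by rewrite -[X in measurable X]setTI; exact: measurable_funP.
  apply: prode_fin_num => i _; rewrite fin_num_measure//.
  by rewrite -[X in measurable X]setTI; exact: measurable_funP.
have bI : bmf (\1_(I J A) : T -> R) by apply: bmf_indic; exact: mI.
have Jk' j : j \in J -> (k <= j)%N by move=> /Jk /ltnW.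
have kJ : k \notin J by apply/negP => /Jk; rewrite ltnn.
have step c' (f : R -> R) : bmf f ->
    \int[P]_w (W k c' w * \1_(I J A) w * f (Y k w)) =
    \int[P]_w W k c' w * \prod_(j <- J) fine (P (Y j @^-1` A j)) * \int[P]_w f (Y k w).
  move=> bf; rewrite -(ih c' J A)//.
  apply: (integral_indep (U := fun w => W k c' w * \1_(I J A) w) (X := Y k)) => //.
    exact: bmfM.
  move=> B mB; rewrite ih//.
  pose A' i := if i == k then B else A i.
  have mA' i : measurable (A' i) by rewrite /A'; case: ifP.
  have := ih c' (k |` J)%fset A' mA'.
  rewrite big_fsetU1//= {2}/A' eqxx.
  rewrite (eq_big_seq (fun j => fine (P (Y j @^-1` A j)))); last first.
    by move=> j jJ /=; rewrite /A'; case: eqP jJ kJ => // -> ->.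
  have -> : \int[P]_w (W k c' w * \1_(I J A) w * \1_(Y k @^-1` B) w) =
      \int[P]_w (W k c' w * \1_(I (k |` J)%fset A') w); last first.
    move=> ->; first by ring.
    by move=> j; rewrite !inE => /orP[/eqP ->|/Jk'].
  apply: eq_Rintegral => w _; rewrite -mulrA; congr (_ * _).
  rewrite /I set_fsetU1 bigcap_setU1 indicI /= mulrC; congr (_ * _).
    by rewrite /A' eqxx.
  congr (\1_ _ _); apply: eq_bigcapr => j /= jJ; rewrite /A'.
  by case: eqP jJ kJ => // -> ->.
have WSint c' (g : T -> R) : bmf g ->
    \int[P]_w (W k.+1 c' w * g w) =
    \int[P]_w (W k c' w * g w * cos (a * Y k w)) -
    \int[P]_w (W k (c' - pi / 2) w * g w * sin (a * Y k w)).
  move=> bg; have bc := bmf_comp (measurable_funP (Y k)) bcosY.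
  have bs := bmf_comp (measurable_funP (Y k)) bsinY.
  rewrite -bintB; [|by apply: bmfM => //; apply: bmfM|by apply: bmfM => //; apply: bmfM].
  by apply: eq_Rintegral => w _; rewrite WS; ring.
rewrite WSint// (step c (fun y => cos (a * y)))// (step _ (fun y => sin (a * y)))//.
have -> : \int[P]_w W k.+1 c w = \int[P]_w (W k.+1 c w * (fun=> 1) w).
  by apply: eq_Rintegral => w _; rewrite mulr1.
rewrite WSint; last exact: bmf_cst.
have noI c' (f : R -> R) : bmf f -> \int[P]_w (W k c' w * (fun=> 1) w * f (Y k w)) =
    \int[P]_w W k c' w * \int[P]_w f (Y k w).
  move=> bf; under eq_Rintegral do rewrite mulr1.
  apply: integral_indep => // B mB.
  have := ih c' [fset k]%fset (fun=> B) (fun=> mB).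
  rewrite big_seq_fset1 /I set_fset1 bigcap_set1; apply => j.
  by rewrite inE => /eqP ->.
rewrite (noI c (fun y => cos (a * y)))// (noI _ (fun y => sin (a * y)))//; ring.
Qed.

(** The addition formula for [cos], where the sine of a partial sum is written as
    a cosine with phase shifted by [pi / 2], and independence of [Y k] from that
    partial sum. *)
Lemma cos_sum_recursion k c :
  \int[P]_w cos (c + a * \sum_(i < k.+1) Y i w) =
  \int[P]_w cos (c + a * \sum_(i < k) Y i w) * \int[P]_w cos (a * Y k w) -
  \int[P]_w cos (c - pi / 2 + a * \sum_(i < k) Y i w) * \int[P]_w sin (a * Y k w).
Proof.
have bc := bmf_comp (measurable_funP (Y k)) bcosY.
have bs := bmf_comp (measurable_funP (Y k)) bsinY.
have noI c' (f : R -> R) : bmf f -> \int[P]_w (W k c' w * f (Y k w)) =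
    \int[P]_w W k c' w * \int[P]_w f (Y k w).
  move=> bf; apply: integral_indep => // B mB.
  have := @W_indep k c' [fset k]%fset (fun=> B) (fun=> mB).
  rewrite big_seq_fset1 /I set_fset1 bigcap_set1; apply => j.
  by rewrite inE => /eqP ->.
rewrite -(noI c (fun y => cos (a * y)))// -(noI _ (fun y => sin (a * y)))//.
rewrite -bintB; [|exact: bmfM|exact: bmfM].
by apply: eq_Rintegral => w _; exact: WS.
Qed.

End characteristic_recursion.

Section clt.
Context d (T : measurableType d) (R : realType) (P : probability T R).

Let a n : R := (Num.sqrt n.+1%:R)^-1.

Let a_gt0 n : 0 < a n.
Proof. by rewrite invr_gt0 sqrtr_gt0. Qed.

Let aa n : n.+1%:R * a n ^+ 2 = 1.
Proof. by rewrite exprVn sqr_sqrtr// divff// pnatr_eq0. Qed.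

Let a_cvg0 : a n @[n --> \oo] --> 0.
Proof.
rewrite /a; apply/cvgr0Pnorm_le => e e0.
near=> n; rewrite ger0_norm ?invr_ge0 ?sqrtr_ge0//.
rewrite -[leRHS]invrK lef_pV2 ?posrE ?invr_gt0 ?sqrtr_gt0//.
rewrite -[leLHS]ger0_norm ?invr_ge0 ?(ltW e0)// -sqrtr_sqr ler_sqrt//.
apply: (@le_trans _ _ n%:R); last by rewrite ler_nat.
by near: n; exact: nbhs_infty_ger.
Unshelve. all: by end_near. Qed.

(** Dominated convergence: [n phi (Y / sqrt n)] is at most [K * Y ^+ 2] by the
    quadratic bound and tends to [0] pointwise by the cubic one. This yields the
    second order expansion of trigonometric moments from second moments alone. *)
Lemma small_perturbation (Y : {RV P >-> R}) (phi : R -> R) (K : R) :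
  measurable_fun setT phi ->
  (forall u, `|phi u| <= K * u ^+ 2) -> (forall u, `|phi u| <= K * `|u| ^+ 3) ->
  P.-integrable setT (fun w => (Y w ^+ 2)%:E) ->
  n.+1%:R * \int[P]_w phi (a n * Y w) @[n --> \oo] --> 0.
Proof.
move=> mphi phi2 phi3 iY.
have dom n w : `|n.+1%:R * phi (a n * Y w)| <= K * Y w ^+ 2.
  rewrite normrM ger0_norm// (le_trans (ler_wpM2l _ (phi2 _)))//.
  by rewrite exprMn mulrCA (mulrA n.+1%:R) aa mul1r.
have mf n : measurable_fun setT (fun w => phi (a n * Y w)).
  by apply: measurableT_comp => //; exact: measurable_funM.
have mnf n : measurable_fun setT (fun w => (n.+1%:R * phi (a n * Y w))%:E).
  by apply/measurable_EFinP; apply: measurable_funM.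
have iK : P.-integrable setT (fun w => (K * Y w ^+ 2)%:E).
  by under eq_fun do rewrite EFinM; exact: integrableZl.
have ptw : {ae P, forall w, setT w ->
    (n.+1%:R * phi (a n * Y w))%:E @[n --> \oo] --> (0:R)%:E}.
  apply: aeW => w _; apply: cvg_EFin; first exact: nearW.
  apply/cvgr0Pnorm_le => e e0.
  have c0 : 0 < `|K| * `|Y w| ^+ 3 + 1 by rewrite ltr_wpDl// mulr_ge0.
  have ec0 : 0 < e / (`|K| * `|Y w| ^+ 3 + 1) by rewrite divr_gt0.
  move/cvgr0Pnorm_le : a_cvg0 => /(_ _ ec0); apply: filterS => n an.
  rewrite (ger0_norm (ltW (a_gt0 n))) in an.
  have -> : `|n.+1%:R * phi (a n * Y w)| = n.+1%:R * `|phi (a n * Y w)|.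
    by rewrite normrM ger0_norm.
  apply: (@le_trans _ _ (n.+1%:R * (K * `|a n * Y w| ^+ 3))).
    by rewrite ler_pM2l.
  rewrite normrM (ger0_norm (ltW (a_gt0 n))) exprMn.
  have -> : n.+1%:R * (K * (a n ^+ 3 * `|Y w| ^+ 3)) =
      (n.+1%:R * a n ^+ 2) * (a n * (K * `|Y w| ^+ 3)) by ring.
  rewrite aa mul1r; rewrite ler_pdivlMr// in an; apply: le_trans an.
  rewrite ler_pM2l// -[leLHS]addr0 lerD//.
  by rewrite ler_wpM2r ?exprn_ge0// ler_norm.
have domae : {ae P, forall w n, setT w ->
    (`|(n.+1%:R * phi (a n * Y w))%:E| <= (K * Y w ^+ 2)%:E)%E}.
  by apply: aeW => w n _; rewrite lee_fin dom.
have [_ _] := @dominated_convergence _ T R P setT measurableT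
  (fun n w => (n.+1%:R * phi (a n * Y w))%:E) (fun=> 0%E) _ mnf
  (measurable_cst _) ptw iK domae.
rewrite integral0 => h.
have fin n : (\int[P]_x (n.+1%:R * phi (a n * Y x))%:E)%E =
   (n.+1%:R * \int[P]_w phi (a n * Y w))%:E.
  have iphi : P.-integrable setT (EFin \o (fun w => phi (a n * Y w))).
    apply: (@le_integrable _ _ _ P setT measurableT _ (fun w => (K * (a n * Y w) ^+ 2)%:E)) => //.
    - exact/measurable_EFinP.
    - by move=> w _; rewrite /= lee_fin (le_trans (phi2 _))// ler_norm.
    - rewrite (_ : (fun w => _) = fun w => ((K * a n ^+ 2)%:E * (Y w ^+ 2)%:E)%E).
        exact: integrableZl.
      by apply/funext => w; rewrite -EFinM exprMn mulrA.
  under eq_integral do rewrite EFinM.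
  rewrite integralZl//= EFinM /Rintegral fineK//.
  exact: integrable_fin_num.
by move: h; under eq_fun do rewrite fin; move=> /fine_cvgP[].
Qed.

(** With [al] and [be] the integrals of [cos (a n * Y)] and [sin (a n * Y)], and
    [r = expR (- s2 / 2n)], each step of the recursion adds at most
    [`|al - r| + `|be|] to the distance between the trigonometric integral of
    the [k]-th partial sum and [r ^+ k * cos c]. After [n] steps the distance is at
    most [n * (`|al - r| + `|be|)], which tends to [0] since [al] and [r] have the
    same expansion to first order in [1 / n] and [be = o(1 / n)]. *)
Theorem clt_trig (Y : nat -> {RV P >-> R}) (c : R) :
  iid Y -> P.-integrable setT (EFin \o Y 0%N) ->
  \int[P]_w Y 0%N w = 0 ->
  P.-integrable setT (fun w => (Y 0%N w ^+ 2)%:E) ->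
  \int[P]_w cos (c + a n * \sum_(i < n.+1) Y i w) @[n --> \oo] -->
    expR (- ((\int[P]_w (Y 0%N w ^+ 2)) / 2)) * cos c.
Proof.
move=> [Yind Yid] iY Y0 iY2; set s2 := \int[P]_w (Y 0%N w ^+ 2).
have s20 : 0 <= s2 by apply: Rintegral_ge0 => w _; exact: sqr_ge0.
have mcos : measurable_fun setT (@cos R)
  by apply: continuous_measurable_fun; exact: continuous_cos.
have msin : measurable_fun setT (@sin R)
  by apply: continuous_measurable_fun; exact: continuous_sin.
pose al n := \int[P]_w cos (a n * Y 0%N w).
pose be n := \int[P]_w sin (a n * Y 0%N w).
pose r n := expR (- (s2 / 2 / n.+1%:R)).
have law (f : R -> R) n : bmf f -> \int[P]_w f (Y n w) = \int[P]_w f (Y 0%N w).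
  move=> bf; apply: (integral_same_law (X := Y n) (Y := Y 0%N)) => // A mA.
  exact: Yid.
have bcos n : bmf (fun y : R => cos (a n * y)).
  split; last by exists 1 => y; exact: cos_max.
  by apply: measurableT_comp => //; exact: measurable_funM.
have bsin n : bmf (fun y : R => sin (a n * y)).
  split; last by exists 1 => y; exact: sin_max.
  by apply: measurableT_comp => //; exact: measurable_funM.
have rec n k c' : `|\int[P]_w cos (c' + a n * \sum_(i < k) Y i w) - r n ^+ k * cos c'|
    <= k%:R * (`|al n - r n| + `|be n|).
  elim: k c' => [|k ih] c'.
    under eq_Rintegral do rewrite big_ord0 mulr0 addr0.
    by rewrite bint_cst expr0 mul1r subrr normr0 mul0r.
  rewrite cos_sum_recursion//.
  rewrite (law (fun y => cos (a n * y)))// (law (fun y => sin (a n * y)))//.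
  rewrite -/(al n) -/(be n).
  set C := \int[P]_w _; set C' := \int[P]_w _.
  have bsum c'' : bmf (fun w => cos (c'' + a n * \sum_(i < k) Y i w)).
    split; last by exists 1 => w; exact: cos_max.
    apply: (measurableT_comp mcos); apply: measurable_funD => //.
    by apply: measurable_funM => //; exact: measurable_sum.
  have C1 : `|C| <= 1 by apply: bint_norm_le => // w; exact: cos_max.
  have C'1 : `|C'| <= 1 by apply: bint_norm_le => // w; exact: cos_max.
  have r0 : 0 <= r n by exact: expR_ge0.
  have r1 : r n <= 1 by rewrite -expR0 ler_expR oppr_le0 !divr_ge0.
  have -> : C * al n - C' * be n - r n ^+ k.+1 * cos c' =
    C * (al n - r n) + r n * (C - r n ^+ k * cos c') - C' * be n.
    by rewrite exprS; ring.
  have hA : `|C * (al n - r n)| <= `|al n - r n| by rewrite normrM ler_piMl.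
  have hB : `|r n * (C - r n ^+ k * cos c')| <= k%:R * (`|al n - r n| + `|be n|).
    by rewrite normrM (ger0_norm r0) (le_trans _ (ih c'))// ler_piMl.
  have hC : `|C' * be n| <= `|be n| by rewrite normrM ler_piMl.
  rewrite (le_trans (ler_normB _ _))// (le_trans (lerD (ler_normD _ _) (lexx _)))//.
  by rewrite -natr1 mulrDl mul1r; lra.
have al0 : n.+1%:R * (al n - 1 + s2 / 2 / n.+1%:R) @[n --> \oo] --> 0.
  have H := @small_perturbation (Y 0%N) (fun u => cos u - 1 + u ^+ 2 / 2) 1 _ _ _ iY2.
  have {H} : n.+1%:R * \int[P]_w (cos (a n * Y 0%N w) - 1 + (a n * Y 0%N w) ^+ 2 / 2)
      @[n --> \oo] --> 0.
    apply: H.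
    - apply: measurable_funD; first exact: measurable_funB.
      by apply: measurable_funM => //; exact: exprn_measurable.
    - by move=> u; rewrite mul1r; exact: cos_taylor2.
    - move=> u; rewrite mul1r; have := cos_taylor2 u; have := cos_taylor4 u.
      move: (`|cos u - _ + _|) => s; rewrite -(real_normK (num_real u)).
      move: `|u| (normr_ge0 u) => v v0 h4 h2; have [v1|v1] := leP v 1.
        apply: le_trans h4 _; rewrite exprSr -[leRHS]mulr1 -mulrA ler_wpM2l ?exprn_ge0//.
        by lra.
      apply: le_trans h2 _; by rewrite [leRHS]exprSr ler_peMr ?exprn_ge0// ltW.
  move=> h; suff -> : (fun n => n.+1%:R * (al n - 1 + s2 / 2 / n.+1%:R)) =
    (fun n => n.+1%:R * \int[P]_w (cos (a n * Y 0%N w) - 1 + (a n * Y 0%N w) ^+ 2 / 2)).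
    exact: h.
  apply/funext => n; congr (_ * _); apply/esym.
  have i2 : P.-integrable setT (EFin \o (fun w => (a n * Y 0%N w) ^+ 2 / 2)).
    rewrite (_ : _ \o _ = fun w => ((a n ^+ 2 / 2)%:E * (Y 0%N w ^+ 2)%:E)%E).
      exact: integrableZl.
    by apply/funext => w /=; rewrite -EFinM exprMn mulrAC.
  have bc : bmf (fun w => cos (a n * Y 0%N w) - 1).
    apply: bmfB; last exact: bmf_cst.
    exact: (bmf_comp (measurable_funP (Y 0%N)) (bcos n)).
  rewrite RintegralD//; last exact: bmf_integrable.
  rewrite bintB; [|exact: (bmf_comp (measurable_funP (Y 0%N)) (bcos n))|exact: bmf_cst].
  rewrite bint_cst; congr (_ + _).
  transitivity (\int[P]_w (a n ^+ 2 / 2 * Y 0%N w ^+ 2)).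
    by apply: eq_Rintegral => w _; rewrite exprMn mulrAC.
  rewrite RintegralZl// -/s2.
  rewrite -[a n ^+ 2](mulKf (lt0r_neq0 (ltr0Sn R n))) aa mulr1; ring.
have be0 : n.+1%:R * be n @[n --> \oo] --> 0.
  have H := @small_perturbation (Y 0%N) (fun u => sin u - u) 2 _ _ _ iY2.
  have {H} : n.+1%:R * \int[P]_w (sin (a n * Y 0%N w) - a n * Y 0%N w)
      @[n --> \oo] --> 0.
    apply: H.
    - exact: measurable_funB.
    - by move=> u; exact: sin_taylor2.
    - move=> u; apply: le_trans (sin_taylor3 u) _; rewrite mulrC ler_wpM2r ?exprn_ge0//.
      by lra.
  move=> h; suff -> : (fun n => n.+1%:R * be n) =
    (fun n => n.+1%:R * \int[P]_w (sin (a n * Y 0%N w) - a n * Y 0%N w)).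
    exact: h.
  apply/funext => n; congr (_ * _); apply/esym.
  have bs := bmf_comp (measurable_funP (Y 0%N)) (bsin n).
  have ia : P.-integrable setT (EFin \o (fun w => a n * Y 0%N w)).
    rewrite (_ : _ \o _ = fun w => ((a n)%:E * (EFin \o Y 0%N) w)%E).
      exact: integrableZl.
    by apply/funext => w /=; rewrite -EFinM.
  rewrite RintegralB//; last exact: bmf_integrable.
  by rewrite RintegralZl// Y0 mulr0 subr0.
have r0 : n.+1%:R * (r n - 1 + s2 / 2 / n.+1%:R) @[n --> \oo] --> 0.
  apply: (squeeze_cvgr (f := fun n => - ((s2 / 2) ^+ 2 * n.+1%:R^-1))
    (h := fun n => (s2 / 2) ^+ 2 * n.+1%:R^-1)).
  - apply: nearW => n; rewrite -ler_norml normrM ger0_norm//.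
    have x0 : 0 <= s2 / 2 / n.+1%:R by rewrite !divr_ge0.
    apply: le_trans (ler_wpM2l _ (expRN_taylor x0)) _ => //.
    rewrite exprMn mulrCA ler_wpM2l ?sqr_ge0//.
    by rewrite expr2 mulrA divff ?mul1r// pnatr_eq0.
  - rewrite -oppr0; apply: cvgN; rewrite -(mulr0 ((s2 / 2) ^+ 2)).
    by apply: cvgM; [exact: cvg_cst|exact: cvg_harmonic].
  - rewrite -(mulr0 ((s2 / 2) ^+ 2)).
    by apply: cvgM; [exact: cvg_cst|exact: cvg_harmonic].
(* [r] is chosen so that its relevant power is exactly the limit. *)
have rN n : r n ^+ n.+1 = expR (- (s2 / 2)).
  by rewrite -expRM_natl mulrN mulrCA divff ?mulr1// pnatr_eq0.
apply/cvgrPdist_le => e e0; have e30 : 0 < e / 3 by rewrite divr_gt0.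
move/cvgr0Pnorm_le : al0 => /(_ _ e30) al0.
move/cvgr0Pnorm_le : be0 => /(_ _ e30) be0.
move/cvgr0Pnorm_le : r0 => /(_ _ e30) r0.
near=> n; rewrite distrC -(rN n) (le_trans (rec n n.+1 c))//.
have h1 : `|n.+1%:R * (al n - 1 + s2 / 2 / n.+1%:R)| <= e / 3 by near: n.
have h2 : `|n.+1%:R * be n| <= e / 3 by near: n.
have h3 : `|n.+1%:R * (r n - 1 + s2 / 2 / n.+1%:R)| <= e / 3 by near: n.
have h4 : n.+1%:R * `|al n - r n| <= e / 3 + e / 3.
  rewrite -[X in X * _]ger0_norm// -normrM.
  rewrite (_ : _ * _ = n.+1%:R * (al n - 1 + s2 / 2 / n.+1%:R) -
    n.+1%:R * (r n - 1 + s2 / 2 / n.+1%:R)); last by ring.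
  by rewrite (le_trans (ler_normB _ _))// lerD.
move: h2; rewrite normrM [X in X * _]ger0_norm// => h2.
rewrite mulrDr; lra.
Unshelve. all: by end_near. Qed.

End clt.

(** * Trigonometric integrals of the normal law *)

Section integral_of_derivative.
Context (R : realType).
Local Notation leb := (@lebesgue_measure R).

Lemma integral_derivative_eq0 (F f : R -> R) :
  (forall x : R, is_derive x 1 F (f x)) -> continuous f ->
  leb.-integrable setT (EFin \o f) ->
  F n%:R @[n --> \oo] --> 0 -> F (- n%:R) @[n --> \oo] --> 0 ->
  \int[leb]_x f x = 0.
Proof.
move=> dF cf intf F1 F2.
have cF : continuous F.
  move=> x; apply/differentiable_continuous/derivable1_diffP.
  by have [] := dF x.
pose I n : set R := `[- n%:R, n%:R]%classic.
have mI n : measurable (I n) by exact: measurable_itv.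
have mf : measurable_fun setT f by exact: continuous_measurable_fun.
have FTC n : (\int[leb]_x ((f \_ (I n)) x)%:E)%E = (F n%:R - F (- n%:R))%:E.
  transitivity (\int[leb]_(x in I n) (f x)%:E)%E.
    rewrite [RHS]integral_mkcond; apply: eq_integral => x _.
    by rewrite !patchE; case: ifP.
  rewrite /I; have [->|n0] := eqVneq n 0%N.
    by rewrite oppr0 subrr set_itv1 integral_set1.
  have nn : - n%:R < n%:R :> R by rewrite gtrN// ltr0n lt0n.
  rewrite (continuous_FTC2 nn (F := F)) ?EFinB//.
  - exact: continuous_subspaceT.
  - split; first by move=> x _; have [] := dF x.
    + by apply: cvg_at_right_filter; exact: cF.
    + by apply: cvg_at_left_filter; exact: cF.
  - by move=> x _; rewrite derive1E; have [_ ->] := dF x.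
have ptw : {ae leb, forall x, setT x ->
    ((f \_ (I n)) x)%:E @[n --> \oo] --> (f x)%:E}.
  apply: aeW => x _; apply: cvg_near_cst.
  have [k xk] : exists k : nat, `|x| <= k%:R.
    by exists (Num.truncn `|x|).+1; rewrite ltW// truncnS_gt.
  exists k => // n /= kn; rewrite patchE mem_set// /I/= in_itv/= -ler_norml.
  by rewrite (le_trans xk)// ler_nat.
have dom : {ae leb, forall x n, setT x -> (`|((f \_ (I n)) x)%:E| <= `|f x|%:E)%E}.
  apply: aeW => x n _; rewrite lee_fin patchE; case: ifP => // _.
  by rewrite normr0.
have mfI n : measurable_fun setT (fun x => ((f \_ (I n)) x)%:E).
  apply/measurable_EFinP; apply/(measurable_restrictT _ (mI n)).
  exact: measurable_funS mf.
have mfE : measurable_fun setT (EFin \o f) by exact/measurable_EFinP.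
have [_ _] := @dominated_convergence _ _ R leb setT measurableT
  (fun n x => ((f \_ (I n)) x)%:E) (EFin \o f) (fun x => `|f x|%:E)
  mfI mfE ptw (integrable_norm intf) dom.
under eq_fun do rewrite FTC.
move=> h; rewrite /Rintegral -(cvg_lim _ h)//.
suff -> : limn (fun n => (F n%:R - F (- n%:R))%:E) = 0%E by [].
apply/cvg_lim => //; apply: cvg_EFin; first exact: nearW.
by rewrite -(subrr 0); apply: cvgB.
Qed.

End integral_of_derivative.

Section gaussian_characteristic_function.
Context (R : realType) (s : R).
Hypothesis s0 : s != 0.
Local Notation leb := (@lebesgue_measure R).
Local Notation g := (normal_pdf 0 s).

Let bounded_pdf_integrable (f : R -> R) : measurable_fun setT f ->
  (exists M : R, forall x, `|f x| <= M) ->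
  leb.-integrable setT (EFin \o (fun x => f x * g x)).
Proof.
move=> mf [M fM].
rewrite (_ : _ \o _ = ((EFin \o f) \* (EFin \o g))%E); last first.
  by apply/funext => x /=; rewrite EFinM.
apply: integrableMr => //.
- by exists M; split; rewrite ?num_real// => x Mx y _; apply: le_trans (fM y) (ltW Mx).
- exact: integrable_normal_pdf.
Qed.

(** The normal law is defined by the integral of its density over events;
    functions are reached through indicators. *)
Lemma integral_normal_prob (f : R -> R) : bmf f ->
  \int[normal_prob 0 s]_x f x = \int[leb]_x (f x * g x).
Proof.
move=> bf; apply/eqP; rewrite -subr_eq0; apply/eqP.
have ig (f' : R -> R) : bmf f' ->
    leb.-integrable setT (EFin \o (fun x => f' x * g x)).
  by move=> [mf' bf']; exact: bounded_pdf_integrable.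
have int1 : \int[leb]_x g x = 1 by rewrite /Rintegral integral_normal_pdf.
pose h (f : R -> R) := \int[normal_prob 0 s]_x f x - \int[leb]_x (f x * g x).
apply: (@bmf_functional_eq0 _ R R h (1 + 1)) => //.
- move=> f1 f2 b1 b2; rewrite /h bintD//.
  under [X in _ - X = _]eq_Rintegral do rewrite mulrDl.
  by rewrite RintegralD//; [ring|exact: ig|exact: ig].
- move=> a f1 b1; rewrite /h bintZ//.
  under [X in _ - X = _]eq_Rintegral do rewrite -mulrA.
  by rewrite RintegralZl//; [ring|exact: ig].
- move=> f1 M b1 fM; rewrite (le_trans (ler_normB _ _))// mulrDl mul1r lerD//.
    exact: bint_norm_le.
  rewrite (le_trans (le_normr_Rintegral _ (ig _ b1)))//.
  rewrite -[leRHS]mulr1 -int1 -RintegralZl//; last exact: integrable_normal_pdf.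
  apply: le_Rintegral => //.
  + have := integrable_norm (ig _ b1); congr (_.-integrable _ _).
  + have -> : EFin \o (fun x => M * g x) = (fun x => M%:E * (EFin \o g) x)%E.
      by apply/funext => x /=; rewrite EFinM.
    by apply: integrableZl => //; exact: integrable_normal_pdf.
  + move=> x _; rewrite normrM (ger0_norm (normal_pdf_ge0 _ _ _)).
    by rewrite ler_wpM2r// normal_pdf_ge0.
- move=> A mA; rewrite /h bint_indic// /normal_prob.
  rewrite -/(Rintegral leb A g) Rintegral_mkcond.
  apply/eqP; rewrite subr_eq0; apply/eqP; apply: eq_Rintegral => x _.
  by rewrite /patch [\1_A x]indicE; case: (x \in A); rewrite ?mul1r ?mul0r.
Qed.

Let gE x : g x = normal_peak s * expR (- (x ^+ 2) / (s ^+ 2 *+ 2)).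
Proof. by rewrite normal_pdfE// /normal_fun subr0. Qed.

Let s20 : 0 < s ^+ 2.
Proof. by rewrite exprn_even_gt0. Qed.

Let is_derive_g (x : R) : is_derive x 1 g (- (x / s ^+ 2) * g x).
Proof.
have -> : g = (fun x => normal_peak s * expR (- (x ^+ 2) / (s ^+ 2 *+ 2))).
  by apply/funext => y; exact: gE.
have d1 : is_derive x 1 (fun x : R => - (x ^+ 2) / (s ^+ 2 *+ 2)) (- (x / s ^+ 2)).
  apply: is_derive_eq.
  by rewrite scaler0 add0r /GRing.scale/= mulr1 -mulr_natr; field.
have d2 := @is_derive1_comp R expR (fun x : R => - (x ^+ 2) / (s ^+ 2 *+ 2)) x _ _
  (is_derive_expR _) d1.
have dX := is_deriveZ (normal_peak s) d2.
apply: (is_derive_eq dX).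
by rewrite /GRing.scale/=; ring.
Qed.

(** Half of the exponent absorbs the factor [`|x|]. The Gaussian of twice the
    variance is an integrable majorant, needed both to integrate by parts and to
    differentiate under the integral sign. *)
Lemma normal_pdf_moment1 : exists2 K : R, 0 < K &
  forall x, `|x| * g x <= K * normal_pdf 0 (Num.sqrt 2 * s) x.
Proof.
have s'0 : Num.sqrt 2 * s != 0 by rewrite mulf_neq0// sqrtr_eq0 -ltNge.
pose p := normal_peak s / normal_peak (Num.sqrt 2 * s).
have p0 : 0 < p by rewrite divr_gt0// normal_peak_gt0.
pose m := 1 + 4 * s ^+ 2.
have m0 : 0 < m by rewrite ltr_wpDr// mulr_ge0// ltW.
exists (p * m); first by rewrite mulr_gt0.
move=> x; rewrite gE normal_pdfE// /normal_fun subr0.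
rewrite exprMn sqr_sqrtr//.
have -> : p * m * (normal_peak (Num.sqrt 2 * s) * expR (- x ^+ 2 / (2 * s ^+ 2 *+ 2))) =
    normal_peak s * (m * expR (- x ^+ 2 / (2 * s ^+ 2 *+ 2))).
  rewrite /p; field; rewrite gt_eqF// normal_peak_gt0//.
rewrite mulrCA ler_wpM2l ?normal_peak_ge0//.
set y := x ^+ 2 / (4 * s ^+ 2).
have -> : - x ^+ 2 / (s ^+ 2 *+ 2) = - y - y.
  by rewrite /y -mulr_natr; field.
have -> : - x ^+ 2 / (2 * s ^+ 2 *+ 2) = - y.
  by rewrite /y -mulr_natr; field.
rewrite expRD mulrA ler_wpM2r ?expR_ge0// expRN ler_pdivrMr ?expR_gt0//.
have y0 : 0 <= y by rewrite /y divr_ge0 ?sqr_ge0// mulr_ge0// ltW.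
have x2 : x ^+ 2 = 4 * s ^+ 2 * y by rewrite /y; field.
apply: (@le_trans _ _ (m * (1 + y))); last by rewrite ler_wpM2l ?(ltW m0)// expR_ge1Dx.
apply: (@le_trans _ _ (1 + x ^+ 2)).
  rewrite -(real_normK (num_real x)); have := normr_ge0 x; nra.
rewrite x2 /m; have := mulr_ge0 (ltW s20) y0; nra.
Qed.

Let moment_integrable (f : R -> R) : measurable_fun setT f ->
  (exists M : R, forall x, `|f x| <= M) ->
  leb.-integrable setT (EFin \o (fun x => f x * (x * g x))).
Proof.
move=> mf [M fM]; have [K K0 Kg] := normal_pdf_moment1.
have mg : measurable_fun setT g by exact: measurable_normal_pdf.
apply: (@le_integrable _ _ _ leb setT measurableT _
  (fun x => ((`|M| * K)%:E * (normal_pdf 0 (Num.sqrt 2 * s) x)%:E)%E)).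
- apply/measurable_EFinP; apply: measurable_funM => //.
  by apply: measurable_funM.
- move=> x _; rewrite -EFinM lee_fin !normrM normr_id.
  rewrite (ger0_norm (normal_pdf_ge0 _ _ _)) -mulrA ler_pM//.
    by rewrite mulr_ge0// normal_pdf_ge0.
  + exact: le_trans (fM x) (ler_norm _).
  + rewrite (ger0_norm (ltW K0)) (ger0_norm (normal_pdf_ge0 _ _ _)).
    exact: Kg.
- by apply: integrableZl => //; exact: integrable_normal_pdf.
Qed.

Let F c t : R := \int[leb]_x (cos (t * x + c) * g x).

Let mcos t c : measurable_fun setT (fun x : R => cos (t * x + c)).
Proof.
apply: (measurableT_comp (f := @cos R)).
  by apply: continuous_measurable_fun; exact: continuous_cos.
by apply: measurable_funD => //; exact: measurable_funM.
Qed.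

Let msin t c : measurable_fun setT (fun x : R => sin (t * x + c)).
Proof.
apply: (measurableT_comp (f := @sin R)).
  by apply: continuous_measurable_fun; exact: continuous_sin.
by apply: measurable_funD => //; exact: measurable_funM.
Qed.

Let cosb t c : exists M : R, forall x : R, `|cos (t * x + c)| <= M.
Proof. by exists 1 => x; exact: cos_max. Qed.

Let sinb t c : exists M : R, forall x : R, `|sin (t * x + c)| <= M.
Proof. by exists 1 => x; exact: sin_max. Qed.

(* The derivative of [sin (t * x + c) * g x] has integral [0], and
   [g^`() x = - (x / s ^+ 2) * g x]. *)
Let parts c t : \int[leb]_x (sin (t * x + c) * (x * g x)) = s ^+ 2 * t * F c t.
Proof.
have iF : leb.-integrable setT (EFin \o (fun x => t * (cos (t * x + c) * g x))).
  have -> : EFin \o (fun x => t * (cos (t * x + c) * g x)) =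
      (fun x => t%:E * (EFin \o (fun x => cos (t * x + c) * g x)%R) x)%E.
    by apply/funext => x /=; rewrite EFinM.
  by apply: integrableZl => //; exact: bounded_pdf_integrable.
have iS : leb.-integrable setT (EFin \o (fun x => (s ^+ 2)^-1 * (sin (t * x + c) * (x * g x)))).
  have -> : EFin \o (fun x => (s ^+ 2)^-1 * (sin (t * x + c) * (x * g x))) =
      (fun x => ((s ^+ 2)^-1)%R%:E * (EFin \o (fun x => sin (t * x + c) * (x * g x))%R) x)%E.
    by apply/funext => x /=; rewrite EFinM.
  by apply: integrableZl => //; exact: moment_integrable.
pose h x := t * (cos (t * x + c) * g x) - (s ^+ 2)^-1 * (sin (t * x + c) * (x * g x)).
have cg : continuous g by exact: continuous_normal_pdf.
have dlin (x : R) : is_derive x 1 (fun x : R => t * x + c) t.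
  apply: is_derive_eq; rewrite /GRing.scale/= mulr1 addr0//.
have dcos (x : R) : is_derive x 1 (fun x => sin (t * x + c)) (t * cos (t * x + c)).
  have dX := @is_derive1_comp R sin (fun x : R => t * x + c) x _ _ (is_derive_sin _) (dlin x).
  by apply: (is_derive_eq dX); rewrite mulrC.
have clin : continuous (fun x : R => t * x + c).
  move=> x; apply: cvgD; last exact: cvg_cst.
  by apply: cvgM; [exact: cvg_cst|exact: cvg_id].
have ccos : continuous (fun x => cos (t * x + c)).
  move=> x; apply: (continuous_comp (f := fun x => t * x + c) (g := cos)).
    exact: clin.
  exact: continuous_cos.
have csin : continuous (fun x => sin (t * x + c)).
  move=> x; apply: (continuous_comp (f := fun x => t * x + c) (g := sin)).
    exact: clin.
  exact: continuous_sin.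
have dG (x : R) : is_derive x 1 (fun x => sin (t * x + c) * g x) (h x).
  have dX := is_deriveM (dcos x) (is_derive_g x).
  by apply: (is_derive_eq dX); rewrite /h /GRing.scale/=; ring.
have [K K0 Kg] := normal_pdf_moment1.
have gbound (x : R) : 0 < `|x| -> `|sin (t * x + c) * g x| <=
    K * normal_peak (Num.sqrt 2 * s) * `|x|^-1.
  move=> x0; rewrite normrM (ger0_norm (normal_pdf_ge0 _ _ _)).
  rewrite ler_pdivlMr// -mulrA (mulrC (g x)).
  have xg : `|x| * g x <= K * normal_peak (Num.sqrt 2 * s).
    apply: le_trans (Kg x) _; rewrite ler_pM2l//; apply: normal_pdf_ub.
    by rewrite mulf_neq0// sqrtr_eq0 -ltNge.
  apply: le_trans xg; rewrite ler_piMl// ?sin_max//.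
  by rewrite mulr_ge0// normal_pdf_ge0.
have lim0 (u : nat -> R) : (forall n, `|u n| = n%:R) ->
    sin (t * u n + c) * g (u n) @[n --> \oo] --> 0.
  move=> un; rewrite -cvg_shiftS /=.
  apply/norm_cvg0P; apply: (squeeze_cvgr (f := fun=> 0)
    (h := fun n => K * normal_peak (Num.sqrt 2 * s) * n.+1%:R^-1)).
  - apply: nearW => n; rewrite normr_ge0/=.
    by have := gbound (u n.+1); rewrite un; apply.
  - exact: cvg_cst.
  - rewrite -[X in _ --> X](mulr0 (K * normal_peak (Num.sqrt 2 * s))).
    by apply: cvgM; [exact: cvg_cst|exact: cvg_harmonic].
have : \int[leb]_x h x = 0.
  apply: (integral_derivative_eq0 dG).
  - move=> x; apply: cvgB; apply: cvgM.
    + exact: cvg_cst.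
    + by apply: cvgM; [exact: ccos|exact: cg].
    + exact: cvg_cst.
    + by apply: cvgM; [exact: csin|apply: cvgM; [exact: cvg_id|exact: cg]].
  - rewrite (_ : _ \o _ = (fun x => (EFin \o (fun x => t * (cos (t * x + c) * g x))%R) x - (EFin \o (fun x => (s ^+ 2)^-1 * (sin (t * x + c) * (x * g x)))%R) x)%E).
      exact: integrableB.
    by apply/funext => x /=; rewrite EFinB.
  - by apply: lim0 => n; rewrite ger0_norm.
  - by apply: lim0 => n; rewrite normrN ger0_norm.
rewrite RintegralB// !RintegralZl//; [|exact: moment_integrable|exact: bounded_pdf_integrable].
rewrite -/(F c t) => /eqP; rewrite subr_eq0 => /eqP e.
by rewrite -mulrA e mulrA divff ?mul1r// gt_eqF.
Qed.

Let is_derive_F c (t : R) : is_derive t 1 (F c) (- (s ^+ 2 * t) * F c t).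
Proof.
pose f (t : R) (x : R) := cos (t * x + c) * g x.
have df (t' x : R) : is_derive t' 1 (f ^~ x) (- sin (t' * x + c) * (x * g x)).
  have dlin : is_derive t' 1 (fun t : R => t * x + c) x.
    by apply: is_derive_eq; rewrite /GRing.scale/= ?mulr0 ?mulr1 ?add0r ?addr0.
  have d2 := @is_derive1_comp R cos (fun t : R => t * x + c) t' _ _ (is_derive_cos _) dlin.
  have := is_deriveZ (g x) d2.
  rewrite (_ : _ \*: _ = f ^~ x); last by apply/funext => y; rewrite /f /= /GRing.scale/= mulrC.
  by move=> dX; apply: (is_derive_eq dX); rewrite /GRing.scale/=; ring.
have pf t' x : partial1of2 f t' x = - sin (t' * x + c) * (x * g x).
  by rewrite partial1of2E; have [_ ->] := df t' x.
have tI : [set` `]t - 1, t + 1[] t by rewrite /= in_itv/= gtrBl ltrDl ltr01.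
have H1 t' : [set` `]t - 1, t + 1[] t' -> leb.-integrable setT (EFin \o f t').
  by move=> _; exact: bounded_pdf_integrable.
have H2 t' y : [set` `]t - 1, t + 1[] t' -> setT y -> derivable (f^~ y) t' 1.
  by move=> _ _; have [] := df t' y.
have H3 y : 0 <= `|y * g y| by [].
have H4 : leb.-integrable setT (EFin \o (fun y => `|y * g y|)).
  have b1 : exists M : R, R -> `|1 : R| <= M by exists 1; rewrite normr1.
  have := @moment_integrable (fun=> 1) (measurable_cst _) b1.
  by move=> /integrable_norm; congr (_.-integrable _ _); apply/funext => x /=; rewrite mul1r.
have H5 t' y : [set` `]t - 1, t + 1[] t' -> setT y -> `|partial1of2 f t' y| <= `|y * g y|.
  by move=> _ _; rewrite pf normrM normrN ler_piMl// sin_max.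
have dF := @derivable_under_integral R _ _ leb f setT measurableT t (t - 1) (t + 1) tI H1 H2 _ H3 H4 H5.
have eF := @differentiation_under_integral R _ _ leb f setT measurableT t (t - 1) (t + 1) tI H1 H2 _ H3 H4 H5.
apply: DeriveDef => //.
rewrite -derive1E eF.
transitivity (\int[leb]_x (-1 * (sin (t * x + c) * (x * g x)))).
  by apply: eq_Rintegral => x _; rewrite pf; ring.
rewrite RintegralZl//; last exact: moment_integrable.
by rewrite parts; ring.
Qed.

(** The integral [F] as a function of [t] solves [F^`() t = - s ^+ 2 * t * F t]
    with [F 0 = cos c]: differentiate under the integral sign, then integrate by
    parts. *)
Theorem gaussian_trig t c :
  \int[normal_prob 0 s]_x cos (t * x + c) = expR (- (s ^+ 2 * t ^+ 2 / 2)) * cos c.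
Proof.
rewrite integral_normal_prob; last by split; [exact: mcos|exact: cosb].
rewrite -/(F c t).
(* The integrating factor makes [D] constant. *)
pose D t := F c t * expR (s ^+ 2 / 2 * t ^+ 2).
have dD (x : R) : is_derive x 1 D 0.
  have d1 : is_derive x 1 (fun x : R => s ^+ 2 / 2 * x ^+ 2) (s ^+ 2 * x).
    by apply: is_derive_eq; rewrite /GRing.scale/= ?mulr0 ?mulr1 ?add0r ?addr0; field.
  have d2 := @is_derive1_comp R expR (fun x : R => s ^+ 2 / 2 * x ^+ 2) x _ _
    (is_derive_expR _) d1.
  have dX := is_deriveM (is_derive_F c x) d2.
  by apply: (is_derive_eq dX); rewrite /GRing.scale/=; ring.
have : D t = D 0 by exact: is_derive_0_is_cst.
rewrite /D expr0n/= mulr0 expR0 mulr1.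
have -> : F c 0 = cos c.
  rewrite /F; under eq_Rintegral do rewrite mul0r add0r.
  rewrite RintegralZl//; last exact: integrable_normal_pdf.
  by rewrite /Rintegral integral_normal_pdf mulr1.
move=> <-; rewrite mulrCA -expRD.
by rewrite (_ : _ + _ = 0) ?expR0 ?mulr1//; field.
Qed.

End gaussian_characteristic_function.

(** * Laws on the line *)

Section law_on_the_line.
Context (R : realType).

(* The usual measurable structure of the line and the Borel structure of the
   line as a normed space are generated differently; laws are transported along
   the identity. *)
Let id_borel : measurableTypeR R -> borel R^o := id.

Let measurable_id_borel : measurable_fun setT id_borel.
Proof.
apply: (@measurability _ _ (measurableTypeR R) (borel R^o) setT id_borel (@open R^o) erefl).
by move=> _ [B oB <-]; rewrite setTI; exact: open_measurable.
Qed.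

Let idm : {mfun measurableTypeR R >-> borel R^o} :=
  HB.pack_for {mfun measurableTypeR R >-> borel R^o} id_borel
    (isMeasurableFun.Build _ _ _ _ id_borel measurable_id_borel).

Implicit Types Q : probability (measurableTypeR R) R.

Let integral_idm Q (f : R -> R) : bcont f ->
  \int[distribution Q idm]_x f x = \int[Q]_x f x.
Proof.
move=> bf; have bmff := @bcont_bmf R R^o f bf.
rewrite /Rintegral integral_distribution//.
- by apply/measurable_EFinP; have [] := bmff.
- apply: (@bmf_integrable _ (measurableTypeR R) R Q f); case: bf => cf bf; split => //.
  exact: continuous_measurable_fun.
Qed.

Let seg (n : nat) : set R := `[- n%:R, n%:R]%classic.

Let tight_line Q (e : R) : 0 < e -> exists n : nat, (Q (~` seg n) <= e%:E)%E.
Proof.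
move=> e0; pose I := seg.
have mI n : measurable (I n) by exact: measurable_itv.
have IT : \bigcup_n I n = setT.
  apply/seteqP; split=> // x _; exists (Num.truncn `|x|).+1 => //.
  by rewrite /I /seg /= in_itv/= -ler_norml ltW// truncnS_gt.
have ndI : nondecreasing_seq I.
  move=> n m nm; apply/subsetPset => x; rewrite /I /seg /= !in_itv/= -!ler_norml.
  by move=> /le_trans; apply; rewrite ler_nat.
have := @nondecreasing_cvg_mu _ (measurableTypeR R) R Q I mI (bigcupT_measurable _ mI) ndI.
rewrite IT [X in _ --> X](probability_setT Q) => /fine_cvgP[_ /cvgrPdist_le/(_ _ e0)[N _ /(_ N (leqnn _))]].
rewrite /= => h; exists N; rewrite probability_setC; last exact: mI.
rewrite -[Q _]fineK; last by apply: fin_num_measure; exact: mI.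
by rewrite -EFinB lee_fin (le_trans _ h)// ler_norm.
Qed.

Let integral_bcont_eq Q1 Q2 :
  (forall t c : R, \int[Q1]_x cos (t * x + c) = \int[Q2]_x cos (t * x + c)) ->
  forall f : R -> R, bcont f -> \int[Q1]_x f x = \int[Q2]_x f x.
Proof.
move=> Q12 f bf; rewrite -!integral_idm//.
apply: (@trigpoly_measure_eq R R^o) => //.
- move=> e e0; have [n1 h1] := tight_line Q1 e0; have [n2 h2] := tight_line Q2 e0.
  exists (seg (maxn n1 n2)); first exact: segment_compact.
  have sub (n m : nat) : (n <= m)%N ->
      ~` seg m `<=` ~` seg n.
    move=> nm; apply: subsetC => x; rewrite /seg /= !in_itv/= -!ler_norml.
    by move=> /le_trans; apply; rewrite ler_nat.
  split; rewrite /distribution /pushforward /=.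
  + apply: le_trans h1; apply: (@le_measure _ _ _ Q1); rewrite ?inE; [| |exact/sub/leq_maxl].
      by apply: measurableC; exact: measurable_itv.
    by apply: measurableC; exact: measurable_itv.
  + apply: le_trans h2; apply: (@le_measure _ _ _ Q2); rewrite ?inE; [| |exact/sub/leq_maxr].
      by apply: measurableC; exact: measurable_itv.
    by apply: measurableC; exact: measurable_itv.
- move=> L c cL.
  have bL : bcont (fun x : R => cos (L x + c)).
    by apply: trigpoly_bcont; exact: trigpoly_cos.
  rewrite !integral_idm//.
  have LE (x : R) : L x = L 1 * x.
    by rewrite -[x in LHS]mulr1 (linearZ_LR L x 1) mulrC.
  by under eq_Rintegral do rewrite LE; under [in RHS]eq_Rintegral do rewrite LE.
Qed.

(** A single probability on the line is tight, so that equality of the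
    trigonometric integrals gives equality of the integrals of bounded
    continuous functions; continuous approximations of indicators of open rays
    then give equality on rays, which generate the Borel sets. *)
Theorem law_of_trig Q1 Q2 :
  (forall t c : R, \int[Q1]_x cos (t * x + c) = \int[Q2]_x cos (t * x + c)) ->
  forall A, measurable A -> Q1 A = Q2 A.
Proof.
move=> Q12; have Q12b := integral_bcont_eq Q12.
have ray_le (P1 P2 : probability (measurableTypeR R) R) (x : R) :
    (forall f : R -> R, bcont f -> \int[P1]_x f x = \int[P2]_x f x) ->
    (P1 `]x, +oo[%classic <= P2 `]x, +oo[%classic)%E.
  move=> P12.
  pose U n : set R := `]x + n.+1%:R^-1, +oo[%classic.
  have mU n : measurable (U n) by exact: measurable_itv.
  have UT : \bigcup_n U n = `]x, +oo[%classic.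
    apply/seteqP; split=> y /=.
      move=> [n _]; rewrite /U /= !in_itv/= !andbT; apply: lt_trans.
      by rewrite ltrDl invr_gt0.
    rewrite in_itv/= andbT => xy; exists (Num.truncn (y - x)^-1) => //.
    rewrite /U /= in_itv/= andbT -ltrBrDl -[ltRHS]invrK ltf_pV2 ?posrE ?invr_gt0 ?subr_gt0//.
    exact: truncnS_gt.
  have ndU : nondecreasing_seq U.
    move=> n m nm; apply/subsetPset => y; rewrite /U /= !in_itv/= !andbT.
    by apply: le_lt_trans; rewrite lerD2l lef_pV2 ?posrE// ler_nat.
  have := @nondecreasing_cvg_mu _ (measurableTypeR R) R P1 U mU (bigcupT_measurable _ mU) ndU.
  rewrite UT => h; rewrite -(cvg_lim _ h)//.
  apply: lime_le; first by apply/cvg_ex; exists (P1 `]x, +oo[%classic).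
  apply: nearW => n /=.
  pose f (y : R) := clip01 (n.+1%:R * (y - x)).
  have bf : bcont f.
    split; last first.
      exists 1 => y; have /andP[f0 f1] := clip01_itv (n.+1%:R * (y - x)).
      by rewrite ger0_norm.
    move=> y; apply: (@continuous_max R R (fun=> 0) (fun y => Num.min 1 (n.+1%:R * (y - x))) y).
      exact: cvg_cst.
    apply: (@continuous_min R R (fun=> 1) (fun y => (n.+1%:R * (y - x))) y).
      exact: cvg_cst.
    apply: cvgM; first exact: cvg_cst.
    by apply: cvgB; [exact: cvg_id|exact: cvg_cst].
  have bmff : bmf (f : measurableTypeR R -> R).
    by case: bf => cf bf; split => //; exact: continuous_measurable_fun.
  apply: (@le_trans _ _ (\int[P1]_y f y)%:E).
    rewrite -[P1 (U n)]fineK; last by apply: fin_num_measure; exact: mU.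
    rewrite lee_fin -bint_indic; last exact: mU.
    apply: le_bint => //; first by apply: bmf_indic; exact: mU.
    move=> y; rewrite indicE; have [|_] := boolP (y \in U n); last first.
      by have /andP[] := clip01_itv (n.+1%:R * (y - x)).
    rewrite inE /U /= in_itv/= andbT => xy.
    rewrite /f /clip01 le_max; apply/orP; right; rewrite le_min lexx/=.
    by rewrite -ler_pdivrMl// mulr1 lerBrDl ltW.
  rewrite P12// -[leRHS]fineK; last by apply: fin_num_measure; exact: measurable_itv.
  rewrite lee_fin -bint_indic; last exact: measurable_itv.
  apply: le_bint => //; first by apply: bmf_indic; exact: measurable_itv.
  move=> y; rewrite indicE; have [_|] := boolP (y \in _).
    by have /andP[] := clip01_itv (n.+1%:R * (y - x)).
  rewrite notin_setE/= in_itv/= andbT => /negP; rewrite -leNgt => yx.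
  by rewrite /f /clip01 ge_max lexx/= ge_min mulr_ge0_le0 ?orbT// subr_le0.
apply: (@measure_unique _ R (measurableTypeR R) (@RGenOInfty.G R)
  (fun n => `]- n%:R, +oo[%classic)).
- exact: RGenOInfty.measurableE.
- move=> _ _ [x ->] [y ->]; exists (Num.max x y).
  by apply/seteqP; split=> z /=; rewrite !in_itv/= !andbT gt_max => /andP.
- by move=> n; exists (- n%:R).
- apply/seteqP; split=> // x _; exists (Num.truncn `|x|).+1 => //=.
  rewrite in_itv/= andbT ltrNl; apply: le_lt_trans (truncnS_gt _).
  by rewrite -normrN ler_norm.
- move=> _ [x ->]; apply/eqP; rewrite eq_le; apply/andP.
  by split; apply: ray_le => f bf; rewrite Q12b.
- by move=> n; rewrite -ge0_fin_numE// fin_num_measure//; exact: measurable_itv.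
Qed.

End law_on_the_line.

(** * Finite nets in the parameter space *)

Section nets.
Context (R : realType) (Theta : metricType R).

Lemma ball_mdist (x y : Theta) (r : R) : ball x r y = (mdist x y < r) :> Prop.
Proof. by rewrite ballEmdist. Qed.

Lemma mdist_le_diameter (cTheta : compact [set: Theta]) (x y : Theta) :
  mdist x y <= diameter Theta.
Proof.
apply: ub_le_sup; last by exists (x, y).
have [| | | |k _ xk] := @compact_directed_cover Theta setT nat setT
  (fun k => (ball x k%:R)°) cTheta.
- by exists 0%N.
- by move=> k _; exact: open_interior.
- move=> i j _ _; exists (maxn i j) => // z [].
    by apply: interiorS; apply: le_ball; rewrite ler_nat leq_maxl.
  by apply: interiorS; apply: le_ball; rewrite ler_nat leq_maxr.
- move=> z _; exists (Num.truncn (mdist x z + 1)).+1 => //.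
  have h : mdist x z + 1 < (Num.truncn (mdist x z + 1)).+1%:R by exact: truncnS_gt.
  apply/nbhs_ballP; exists 1 => //= w; rewrite !ball_mdist => zw.
  apply: le_lt_trans (metric_triangle _ z _) _.
  by apply: lt_trans h; rewrite ltrD2l.
exists (k%:R + k%:R) => _ [[u v] _ <-] /=.
have := interior_subset (xk u Logic.I); have := interior_subset (xk v Logic.I).
rewrite !ball_mdist => xv xu.
by rewrite (le_trans (metric_triangle _ x _))// metric_sym lerD// ltW.
Qed.

(** A factor [2] in the radius pays for moving the centers into the dense set, a
    factor [2] in the size for choosing a cover that comes close to the infimum.
    When the diameter is [0] the hypothesis on covers is void, but one point is
    then a net of every radius. *)
Lemma dense_nets (cTheta : compact [set: Theta]) (C t b : R) (Theta' : set Theta) :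
  0 < C -> 0 < t -> 0 < b < 1 -> dense Theta' ->
  (forall eta : R, 0 < eta <= diameter Theta ->
     (covering_number Theta eta <= (C * eta `^ (- t))%:E)%E) ->
  exists (D A : R) (N : nat -> seq Theta), [/\ 0 < D, 0 < A &
    forall k, [/\ forall c, c \in N k -> Theta' c, is_net (D * b ^+ k) (N k) &
                  (size (N k))%:R <= A * (b `^ (- t)) ^+ k]].
Proof.
move=> C0 t0 /andP[b0 b1] dT cov.
have [D0|D0] := ltP 0 (diameter Theta); last first.
  have m0 (x y : Theta) : mdist x y <= 0 by exact: le_trans (mdist_le_diameter cTheta x y) D0.
  have [s [sT sn s1]] : exists s : seq Theta,
      [/\ forall c, c \in s -> Theta' c, forall e : R, 0 < e -> is_net e s & (size s <= 1)%N].
    have [[x _]|T0] := pselect ([set: Theta] !=set0).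
      have [|c [_ Tc]] := dT setT _ openT; first by exists x.
      exists [:: c]; split=> //; first by move=> y; rewrite inE => /eqP ->.
      move=> e e0 y; exists c; first by rewrite inE.
      exact: le_trans (m0 _ _) (ltW e0).
    by exists [::]; split=> // e e0 y; exfalso; apply: T0; exists y.
  exists 1, 1, (fun=> s); split=> // k; split=> //.
    by apply: sn; rewrite mul1r exprn_gt0.
  rewrite mul1r; apply: (@le_trans _ _ 1%:R); first by rewrite ler_nat.
  rewrite exprn_ege1// powRN invf_ge1 ?powR_gt0//.
  by have := ge0_ler_powR (ltW t0) _ _ (ltW b1); rewrite powR1; apply; rewrite nnegrE ?ltW.
set Delta := diameter Theta in D0 cov *.
exists (2 * Delta), (2 * (C * Delta `^ (- t))).
have CD : 0 < C * Delta `^ (- t) by rewrite mulr_gt0// powR_gt0.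
have exN k : exists s : seq Theta, [/\ forall c, c \in s -> Theta' c,
    is_net (2 * Delta * b ^+ k) s &
    (size s)%:R <= 2 * (C * Delta `^ (- t)) * (b `^ (- t)) ^+ k].
  pose eta := Delta * b ^+ k.
  have e0 : 0 < eta by rewrite mulr_gt0// exprn_gt0.
  have eD : eta <= Delta by rewrite /eta ler_piMr// ?exprn_ile1// ltW.
  have etat : C * eta `^ (- t) = C * Delta `^ (- t) * (b `^ (- t)) ^+ k.
    rewrite /eta powRM ?(ltW D0) ?exprn_ge0 ?(ltW b0)// mulrA; congr (_ * _).
    by rewrite -[b ^+ k]powR_mulrn ?(ltW b0)// -powRrM mulrC powRrM powR_mulrn// powR_ge0.
  have et0 : 0 < C * eta `^ (- t) by rewrite mulr_gt0// powR_gt0.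
  have /ereal_inf_lt[_ [s sn <-]] : (covering_number Theta eta < (2 * (C * eta `^ (- t)))%:E)%E.
    apply: (le_lt_trans (cov eta _)); first by rewrite e0.
    by rewrite lte_fin ltr_pMl// ltr1n.
  rewrite lte_fin => ss.
  have near c : exists c', Theta' c' /\ mdist c' c < eta.
    have [|c' [cc' Tc']] := dT (ball c eta)° _ (@open_interior _ _).
      by exists c; apply: nbhsx_ballx.
    exists c'; split=> //; have := interior_subset cc'.
    by rewrite ball_mdist metric_sym.
  have [p pP] := choice near.
  exists (map p s); split.
  - by move=> _ /mapP[c _ ->]; have [] := pP c.
  - move=> x; have [c cs cx] := sn x; exists (p c); first exact: map_f.
    rewrite (le_trans (metric_triangle _ c _))// -mulrA -/eta mulr2n mulrDl mul1r.
    by rewrite lerD// ltW//; have [] := pP c.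
  - by rewrite size_map ltW// (lt_le_trans ss)// etat mulrA.
have [N NP] := choice exN.
by exists N; split=> //; rewrite mulr_gt0.
Qed.

End nets.

(** * A compact set of functions controlled along links *)

Section chained_compact.
Context (R : realType) (Theta : metricType R) (cTheta : compact [set: Theta]).
Context (E : completeNormedModType R).
Local Notation C := (cspace E cTheta).
Context (N : nat -> seq Theta) (r : nat -> R) (par : nat -> Theta -> Theta).
Context (rho : R) (m : nat) (Kc : nat -> Theta -> set E).
Hypothesis N_net : forall k, is_net (r k) (N k).
Hypothesis r_cvg0 : r k @[k --> \oo] --> 0.
Hypothesis parN : forall k u, par k u \in N k.
Hypothesis rho01 : 0 <= rho < 1.
Hypothesis cK : forall k u, compact (Kc k u).

(** Here [par j u], a point of the net [N j], is the point to which [u] in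
    [N j.+1] is linked. *)
Definition chained : set C := [set f |
  (forall j, (m <= j)%N -> forall u, u \in N j.+1 -> `|f u - f (par j u)| <= rho ^+ j) /\
  (forall j, (m <= j)%N -> forall u, u \in N j -> Kc j u (f u))].

(* Along a chain of links from a fine net down to [N k], two functions of the
   set come apart by at most [2 * rho ^+ j] at level [j]. *)
Let chain_bound (f g : C) (k : nat) (a : R) : chained f -> chained g -> (m <= k)%N ->
  (forall u, u \in N k -> `|f u - g u| <= a) ->
  forall j, (k <= j)%N -> forall u, u \in N j ->
    `|f u - g u| <= a + 2 * (rho ^+ k - rho ^+ j) / (1 - rho).
Proof.
move=> [fl _] [gl _] mk fgk j.
have /andP[rho0 rho1] := rho01.
move=> kj; rewrite -(subnKC kj); elim: (j - k)%N => [|i ih] u.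
  by rewrite addn0 subrr mulr0 mul0r addr0; exact: fgk.
rewrite addnS => uN; set l := (k + i)%N.
have ml : (m <= l)%N by rewrite (leq_trans mk)// leq_addr.
have h1 := fl l ml u uN; have h2 := gl l ml u uN.
have h3 := ih (par l u) (parN l u).
rewrite -/l in h3.
have -> : f u - g u = (f u - f (par l u)) + (f (par l u) - g (par l u)) - (g u - g (par l u)).
  by rewrite addrA subrK opprB addrA subrK.
rewrite (le_trans (ler_normB _ _))// (le_trans (lerD (ler_normD _ _) (lexx _)))//.
have -> : a + 2 * (rho ^+ k - rho ^+ l.+1) / (1 - rho) =
    rho ^+ l + (a + 2 * (rho ^+ k - rho ^+ l) / (1 - rho)) + rho ^+ l.
  by rewrite exprS; field; rewrite subr_eq0 eq_sym lt_eqF.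
by rewrite lerD// lerD.
Qed.

Let dense_bound (f g : C) (k : nat) (b : R) :
  (forall j, (k <= j)%N -> forall u, u \in N j -> `|f u - g u| <= b) ->
  forall x, `|f x - g x| <= b.
Proof.
move=> fgb x; apply/ler_addgt0Pr => e e0.
have e20 : 0 < e / 2 by rewrite divr_gt0.
have /cvgrPdist_le/(_ _ e20) cf := @cspace_continuous _ _ _ _ f x.
have /cvgrPdist_le/(_ _ e20) cg := @cspace_continuous _ _ _ _ g x.
have : nbhs x [set y | `|f x - f y| <= e / 2 /\ `|g x - g y| <= e / 2].
  exact: filterI cf cg.
move=> /nbhs_ballP[d /= d0 dfg].
move/cvgrPdist_lt : r_cvg0 => /(_ _ d0)[n _ rn].
have [c cN cx] := N_net (maxn n k) x.
have [/=] : (`|f x - f c| <= e / 2) /\ (`|g x - g c| <= e / 2).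
  apply: dfg; rewrite ballEmdist/= metric_sym (le_lt_trans cx)//.
  have := rn (maxn n k) (leq_maxl _ _); rewrite /= sub0r normrN.
  exact: le_lt_trans (ler_norm _).
move=> fc gc; have := fgb _ (leq_maxr n k) c cN => fgc.
have -> : f x - g x = (f c - g c) + ((f x - f c) - (g x - g c)).
  by rewrite [in RHS]opprD opprK addrACA subrKC [- g c + _]addrC addrK.
rewrite (le_trans (ler_normD _ _))// lerD// (le_trans (ler_normB _ _))//.
by rewrite [leRHS]splitr lerD.
Qed.

Let closed_eval_norm (u v : Theta) (a : R) : closed [set f : C | `|f u - f v| <= a].
Proof.
rewrite (_ : mkset _ = (fun f : C => `|f u - f v|) @^-1` [set x | x <= a])//.
apply: closed_comp; last exact: closed_le.
have cev x : continuous (fun f : C => f x) := @cspace_eval_continuous _ _ _ _ x.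
by move=> f _; exact: cvg_norm (cvgB (cev u f) (cev v f)).
Qed.

Lemma closed_chained : closed chained.
Proof.
have -> : chained =
    \bigcap_(j in [set j | (m <= j)%N])
      (\bigcap_(u in [set u | u \in N j.+1]) [set f : C | `|f u - f (par j u)| <= rho ^+ j] `&`
       \bigcap_(u in [set u | u \in N j]) ((fun f : C => f u) @^-1` Kc j u)).
  apply/seteqP; split=> f.
    by move=> [f1 f2] j /= mj; split=> u /= uN; [exact: f1|exact: f2].
  by move=> h; split=> j mj u uN; have [h1 h2] := h j mj; [exact: h1|exact: h2].
apply: closed_bigI => j _; apply: closedI; apply: closed_bigI => u _.
  exact: closed_eval_norm.
apply: closed_comp; first by move=> f _; exact: cspace_eval_continuous.
by apply: compact_closed; [exact: norm_hausdorff|exact: cK].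
Qed.

(** An ultrafilter converges pointwise on the finite net [N k], by compactness of
    the sets of values there; by [chain_bound] and density of the union of the
    nets, closeness on [N k] is uniform closeness up to a multiple of [rho ^+ k].
    Hence an ultrafilter is Cauchy, and it converges by completeness. *)
Lemma compact_chained : compact chained.
Proof.
rewrite compact_ultra => F UF FK.
have PF : ProperFilter F by exact: ultra_proper.
have /andP[rho0 rho1] := rho01.
have ev_cvg (k : nat) (u : Theta) (e : R) : (m <= k)%N -> 0 < e -> u \in N k ->
    exists y : E, F [set f : C | `|f u - y| <= e].
  move=> mk e0 uN.
  have FKu : ((fun f : C => f u) @ F) (Kc k u).
    by apply: (@filterS _ F _ _ _ _ FK) => f [_ fK]; exact: fK.
  have [y [_ cy]] := @cK k u _ (fmap_proper_filter (fun f : C => f u) PF) FKu.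
  exists y; have [//|FC] := in_ultra_setVsetC [set f : C | `|f u - y| <= e] UF.
  have yB : nbhs y [set z | `|y - z| < e] by apply/nbhs_normP; exists e.
  have [z [/= ze yz]] := cy [set z | ~ (`|z - y| <= e)] _ FC yB.
  by exfalso; apply: ze; rewrite distrC ltW.
have osc (k : nat) (e : R) (s : seq Theta) : (m <= k)%N -> 0 < e ->
    {subset s <= N k} -> exists2 G : set C, F G &
      forall f g, G f -> G g -> forall u, u \in s -> `|f u - g u| <= e + e.
  move=> mk e0; elim: s => [_|u s ih us].
    by exists setT => //; exact: filterT.
  have [|G FG Gs] := ih; first by move=> v vs; apply: us; rewrite inE vs orbT.
  have [|y Fy] := ev_cvg k u e mk e0; first by apply: us; rewrite inE eqxx.
  exists (G `&` [set f : C | `|f u - y| <= e]); first exact: filterI.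
  move=> f g [Gf fy] [Gg gy] v; rewrite inE => /predU1P[->|]; last exact: Gs.
  have -> : f u - g u = (f u - y) - (g u - y) by rewrite opprB addrA subrK.
  by rewrite (le_trans (ler_normB _ _))// lerD.
have Fcauchy : cauchy F.
  apply: cauchy_exP => e e0; have e40 : 0 < e / 4 by rewrite divr_gt0.
  have rho_small : 0 < e / 4 * (1 - rho) / 2.
    by rewrite divr_gt0// mulr_gt0// subr_gt0.
  have [k mk rk] : exists2 k, (m <= k)%N & 2 * rho ^+ k / (1 - rho) <= e / 4.
    have nr : `|rho| < 1 by rewrite ger0_norm.
    have /cvgr0Pnorm_le/(_ _ rho_small)[n _ rn] := cvg_expr nr.
    exists (maxn m n); first exact: leq_maxl.
    have := rn (maxn m n) (leq_maxr _ _); rewrite /= ger0_norm ?exprn_ge0// => h.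
    by rewrite ler_pdivrMr ?subr_gt0// -ler_pdivlMl// mulrC.
  have [G FG Gk] := osc k (e / 4) (N k) mk e40 (fun u uN => uN).
  have FGK : F (G `&` chained) by exact: filterI.
  have [f [Gf Kf]] := filter_ex FGK.
  exists f; apply: filterS FGK => g [Gg Kg].
  rewrite -ball_normE /=; apply: (@le_lt_trans _ _ (e / 4 + e / 4 + e / 4)); last by lra.
  apply: cspace_norm_le; first by lra.
  apply: (dense_bound (k := k)) => j kj u uN.
  apply: le_trans (chain_bound Kf Kg mk (Gk f g Gf Gg) kj uN) _.
  rewrite lerD2l; apply: le_trans rk.
  rewrite ler_pM2r ?invr_gt0 ?subr_gt0// ler_pM2l// gerBl exprn_ge0//.
have Ff : F --> (lim F : C) := @cauchy_cvg C F PF Fcauchy.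
exists (lim F); split=> //; apply: closed_chained => B Bf.
have FKB : F (chained `&` B) by apply: filterI => //; exact: Ff.
by have [g [Kg Bg]] := filter_ex FKB; exists g.
Qed.

End chained_compact.

(** * Tightness by chaining *)

Section measure_estimates.
Context d (T : measurableType d) (R : realType) (P : probability T R).

Lemma probability_bigsetU_le (I : eqType) (s : seq I) (F : I -> set T) (c : R) :
  0 <= c -> (forall u, u \in s -> measurable (F u) /\ (P (F u) <= c%:E)%E) ->
  measurable (\big[setU/set0]_(u <- s) F u) /\
  (P (\big[setU/set0]_(u <- s) F u) <= ((size s)%:R * c)%:E)%E.
Proof.
move=> c0; elim: s => [_|u s ih Fs].
  by rewrite big_nil mul0r measure0; split.
have [|mS PS] := ih; first by move=> v vs; apply: Fs; rewrite inE vs orbT.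
have [|mF PF] := Fs u; first by rewrite inE eqxx.
rewrite big_cons; split; first exact: measurableU.
apply: (le_trans (measureU2 _ mF mS)).
rewrite /= -natr1 mulrDl mul1r addrC EFinD.
exact: leeD.
Qed.

Lemma markov_powR (Z : T -> R) (p r c : R) : measurable_fun setT Z ->
  (forall w, 0 <= Z w) -> 0 < p -> 0 < r ->
  ('E_P[fun w => (Z w `^ p)%R] <= c%:E)%E ->
  (P [set w | r < Z w]%R <= (c / r `^ p)%:E)%E.
Proof.
move=> mZ Z0 p0 r0; rewrite unlock => Zc.
have rp : 0 < r `^ p by exact: powR_gt0.
have mS : measurable [set w | r < Z w].
  rewrite (_ : mkset _ = Z @^-1` `]r, +oo[).
    by rewrite -[X in measurable X]setTI; apply: mZ => //; exact: measurable_itv.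
  by apply/seteqP; split=> w /=; rewrite in_itv/= andbT.
have h : (\int[P]_w (r `^ p * \1_[set w | r < Z w] w)%:E <= c%:E)%E.
  apply: le_trans Zc; apply: ge0_le_integral => //.
  - by move=> w _; rewrite lee_fin mulr_ge0// ltW.
  - by apply/measurable_EFinP; apply: measurable_funM => //; exact: measurable_indic.
  - by apply/measurable_EFinP; exact: (measurableT_comp (@measurable_powR R p) mZ).
  - move=> w _; rewrite lee_fin indic_bool; have [rZ|_] := ltP r (Z w).
      by rewrite mulr1 ge0_ler_powR ?nnegrE// ltW.
    by rewrite mulr0 powR_ge0.
have := h; under eq_integral do rewrite EFinM.
rewrite ge0_integralZl_EFin; [|by []|by move=> w _; rewrite lee_fin| |exact: ltW]; last first.
  by apply/measurable_EFinP; exact: measurable_indic.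
rewrite integral_indic// setIT.
have fP : P [set w | r < Z w]%R \is a fin_num by exact: fin_num_measure.
move=> h'; rewrite -(fineK fP) lee_fin ler_pdivlMr// mulrC -lee_fin EFinM fineK//.
Qed.

End measure_estimates.

Section chaining.
Context (R : realType) (Theta : metricType R) (cTheta : compact [set: Theta]).
Context (E : completeNormedModType R).
Context d (Omega : measurableType d) (P : probability Omega R).
Context (Sn : nat -> {RV P >-> borel (cspace E cTheta)}).
Local Notation C := (cspace E cTheta).

Let measurable_increment n (u v : Theta) :
  measurable_fun setT (fun w => `|(Sn n w : C) u - (Sn n w : C) v|).
Proof.
pose h (f : C) : R := `|f u - f v|.
have ch : continuous h.
  have cev x : continuous (fun f : C => f x) := @cspace_eval_continuous _ _ _ _ x.
  by move=> f; exact: cvg_norm (cvgB (cev u f) (cev v f)).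
by apply: (measurableT_comp (continuous_measurable_real ch)).
Qed.

(** The ratios [b] of the radii and [rho] of the allowed increments are chosen so
    that [b `^ (q - t) = 1 / 4] and [rho `^ p = 1 / 2]. Markov's inequality over the
    at most [A * b `^ (- t) ^+ j.+1] links of level [j], each of length at most
    [D * b ^+ j], then bounds the probability of an excessive increment at level
    [j] by [B * (2 * b `^ (q - t)) ^+ j = B / 2 ^+ j]. The levels from [m] on cost at
    most [e / 2], and the values at net points another [e / 2]. *)
Theorem uniformly_tight_chaining (c t p q M : R) (Theta' : set Theta) :
  0 < c -> 0 < t -> 0 < p -> t < q -> 0 < M ->
  (forall eta : R, 0 < eta <= diameter Theta ->
     (covering_number Theta eta <= (c * eta `^ (- t))%:E)%E) ->
  dense Theta' ->
  (forall theta, Theta' theta -> uniformly_tight (fun n => eval_rv (Sn n) theta)) ->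
  (forall theta vartheta : Theta,
     (ereal_sup (range (fun n =>
        'E_P[fun w => (`|(Sn n w : C) theta - (Sn n w : C) vartheta| `^ p)%R]))
      <= (M * mdist theta vartheta `^ q)%:E)%E) ->
  uniformly_tight Sn.
Proof.
move=> c0 t0 p0 tq M0 cover dT tightS moment e e0.
have qt0 : 0 < q - t by rewrite subr_gt0.
have q0 : 0 < q by exact: lt_trans tq.
pose b : R := 2 `^ (- (2 / (q - t))).
have b0 : 0 < b by exact: powR_gt0.
have pow2N (x : R) : 0 < x -> 2 `^ (- x) < 1 :> R.
  move=> x0; rewrite powRN invf_lt1 ?powR_gt0//.
  have h1 : (1 : R) `^ x = 1 by rewrite powR1.
  by rewrite -[ltLHS]h1; apply: gt0_ltr_powR; rewrite ?nnegrE// ltr1n.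
have b1 : b < 1 by apply: pow2N; rewrite divr_gt0.
have bqt : b `^ (q - t) = 4^-1.
  rewrite /b -powRrM mulNr divfK ?gt_eqF// powRN powR_mulrn//.
  by rewrite -natrX.
pose rho : R := 2 `^ (- p^-1).
have rho0 : 0 < rho by exact: powR_gt0.
have rho1 : rho < 1 by apply: pow2N; rewrite invr_gt0.
have rhop : rho `^ p = 2^-1.
  by rewrite /rho -powRrM mulNr mulVf ?gt_eqF// powR_inv1.
have [D [A [N [D0 A0 NP]]]] := dense_nets cTheta c0 t0 (introT andP (conj b0 b1)) dT cover.
have [par parP] : {par : nat * Theta -> Theta & forall ku,
    par ku \in N ku.1 /\ mdist (par ku) ku.2 <= D * b ^+ ku.1}.
  apply: (@choice _ _ (fun ku c => c \in N ku.1 /\ mdist c ku.2 <= D * b ^+ ku.1)).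
  move=> [k u]; have [_ /(_ u)[c' c'N c'u] _] := NP k.
  by exists c'.
pose B : R := A * b `^ (- t) * (M * D `^ q).
have B0 : 0 < B by rewrite !mulr_gt0// powR_gt0.
have [m mB] : exists m : nat, B / 2 ^+ m <= e / 4.
  exists (Num.truncn (B / (e / 4))).+1.
  have e40 : 0 < e / 4 by rewrite divr_gt0.
  rewrite ler_pdivrMr ?exprn_gt0// -ler_pdivrMl// mulrC.
  apply: le_trans (ltW (truncnS_gt _)) _.
  by rewrite -natrX ler_nat ltnW// ltn_expl.
(* The share of [e] that a single point of the net [N k] may lose. *)
pose ek k : R := e / (2 ^ k.+2)%:R / (size (N k)).+1%:R.
have ek0 k : 0 < ek k by rewrite !divr_gt0// ltr0n expn_gt0.
have [Kc KcP] : {Kc : nat * Theta -> set E & forall ku, compact (Kc ku) /\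
    (Theta' ku.2 -> forall n, (P (eval_rv (Sn n) ku.2 @^-1` (~` Kc ku)) <= (ek ku.1)%:E)%E)}.
  apply: (@choice _ _ (fun ku K => compact K /\
    (Theta' ku.2 -> forall n, (P (eval_rv (Sn n) ku.2 @^-1` (~` K)) <= (ek ku.1)%:E)%E))).
  move=> [k u] /=; have [Tu|Tu] := pselect (Theta' u); last first.
    by exists set0; split=> //; exact: compact0.
  have [K cK KP] := tightS u Tu _ (ek0 k).
  by exists K; split=> // _ n; apply: le_trans KP; apply: ereal_sup_ubound; exists n.
pose K := @chained R Theta cTheta E N (fun j u => par (j, u)) rho m (fun j u => Kc (j, u)).
exists K.
  apply: (compact_chained (r := fun k => D * b ^+ k)).
  - by move=> k; have [] := NP k.
  - rewrite -[X in _ --> X](mulr0 D); apply: cvgM; first exact: cvg_cst.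
    by apply: cvg_expr; rewrite ger0_norm// ltW.
  - by move=> k u; have [] := parP (k, u).
  - by rewrite rho1 ltW.
  - by move=> k u; have [] := KcP (k, u).
apply: ge_ereal_sup => _ [n _ <-].
pose Lk j u := [set w | rho ^+ j < `|(Sn n w : C) (par (j, u)) - (Sn n w : C) u|].
pose Tk j u := eval_rv (Sn n) u @^-1` (~` Kc (j, u)).
have mLk j u : measurable (Lk j u).
  rewrite (_ : Lk j u = (fun w => `|(Sn n w : C) (par (j, u)) - (Sn n w : C) u|) @^-1` `]rho ^+ j, +oo[).
    rewrite -[X in measurable X]setTI.
    by apply: (measurable_increment n _ _) => //; exact: measurable_itv.
  by apply/seteqP; split=> w /=; rewrite in_itv/= andbT.
have PLk j u : u \in N j.+1 -> (P (Lk j u) <= (M * D `^ q * (b `^ q * 2) ^+ j)%:E)%E.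
  move=> uN; have [_ /= pu] := parP (j, u).
  have mom : ('E_P[fun w => (`|(Sn n w : C) (par (j, u)) - (Sn n w : C) u| `^ p)%R] <=
      (M * D `^ q * (b `^ q) ^+ j)%:E)%E.
    apply: (@le_trans _ _ (M * mdist (par (j, u)) u `^ q)%:E).
      by apply: le_trans (moment _ _); apply: ereal_sup_ubound; exists n.
    rewrite lee_fin -mulrA ler_pM2l//.
    have -> : D `^ q * (b `^ q) ^+ j = (D * b ^+ j) `^ q.
      rewrite powRM ?(ltW D0) ?exprn_ge0 ?(ltW b0)//; congr (_ * _).
      by rewrite -[b ^+ j]powR_mulrn ?(ltW b0)// -powRrM mulrC powRrM powR_mulrn// powR_ge0.
    apply: ge0_ler_powR; rewrite ?nnegrE ?(ltW q0) ?mdist_ge0//.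
    by rewrite mulr_ge0 ?exprn_ge0// ltW.
  have := markov_powR (measurable_increment n (par (j, u)) u) (fun=> normr_ge0 _) p0
    (exprn_gt0 j rho0) mom.
  move=> /le_trans; apply; rewrite lee_fin.
  have -> : (rho ^+ j) `^ p = 2^-1 ^+ j.
    by rewrite -[rho ^+ j]powR_mulrn ?(ltW rho0)// powRAC rhop powR_mulrn// invr_ge0.
  by rewrite exprVn invrK exprMn mulrA.
have mTk j u : measurable (Tk j u).
  rewrite /Tk -[X in measurable X]setTI; apply: measurable_funP => //.
  apply: open_measurable_borel; apply: closed_openC.
  by apply: compact_closed; [exact: norm_hausdorff|have [] := KcP (j, u)].
(* The bad event of level [m + i]. *)
pose F i := \big[setU/set0]_(u <- N (m + i).+1) Lk (m + i)%N u `|`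
            \big[setU/set0]_(u <- N (m + i)%N) Tk (m + i)%N u.
have FP i : measurable (F i) /\ (P (F i) <= (e / (2 ^ i.+1)%:R)%:E)%E.
  have bq2 : 0 <= M * D `^ q * (b `^ q * 2) ^+ (m + i).
    by rewrite mulr_ge0 ?exprn_ge0 ?mulr_ge0 ?powR_ge0// ltW.
  have [|mL PL] := probability_bigsetU_le (P := P) (s := N (m + i).+1) (F := Lk (m + i)%N) bq2.
    by move=> u uN; split=> //; exact: PLk.
  have [|mT PT] := probability_bigsetU_le (P := P) (s := N (m + i)%N) (F := Tk (m + i)%N) (ltW (ek0 (m + i)%N)).
    move=> u uN; split=> //; have [_] := KcP ((m + i)%N, u); apply.
    by have [NT _ _] := NP (m + i)%N; exact: NT.
  split; first exact: measurableU.
  apply: le_trans (measureU2 _ mL mT) _.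
  apply: le_trans (leeD PL PT) _; rewrite -EFinD lee_fin.
  have -> : e / (2 ^ i.+1)%:R = e / (2 ^ i.+2)%:R + e / (2 ^ i.+2)%:R.
    by rewrite !natrX [2 ^+ i.+2]exprS; field; rewrite expf_neq0.
  apply: lerD.
    have [_ _ sN] := NP (m + i).+1.
    apply: (@le_trans _ _ (A * b `^ (- t) ^+ (m + i).+1 * (M * D `^ q * (b `^ q * 2) ^+ (m + i)))).
      by rewrite ler_wpM2r.
    have -> : A * b `^ (- t) ^+ (m + i).+1 * (M * D `^ q * (b `^ q * 2) ^+ (m + i)) =
       B * (b `^ (- t) * b `^ q * 2) ^+ (m + i).
      rewrite /B exprS !exprMn; ring.
    rewrite -powRD; last by rewrite (gt_eqF b0) implybT.
    rewrite addrC bqt (_ : 4^-1 * 2 = 2^-1); last by field.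
    rewrite exprVn exprD invfM mulrA.
    rewrite natrX 2!exprS !invfM !mulrA ler_wpM2r ?invr_ge0 ?exprn_ge0//.
    by apply: le_trans mB _; rewrite -mulrA -invfM -natrM.
  have s1 : 0 < (size (N (m + i)%N)).+1%:R :> R by rewrite ltr0n.
  apply: (@le_trans _ _ (e / (2 ^ (m + i).+2)%:R)).
    by rewrite /ek mulrCA mulrC ler_piMl ?divr_ge0 ?(ltW e0)// ler_pdivrMr// mul1r ler_nat.
  rewrite ler_wpM2l ?(ltW e0)// lef_pV2 ?posrE ?ltr0n ?expn_gt0//.
  by rewrite ler_nat leq_exp2l// !ltnS leq_addl.
have sub : Sn n @^-1` (~` K) `<=` \bigcup_i F i.
  move=> w; apply: contra_notP => /= nF.
  have {}nF i : ~ F i w by move=> Fi; apply: nF; exists i.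
  split=> j mj u uN.
    rewrite leNgt; apply/negP => h; apply: (nF (j - m)%N); left; rewrite subnKC//.
    by rewrite -bigcup_seq; exists u => //=; rewrite /Lk /= distrC.
  apply: contrapT => h; apply: (nF (j - m)%N); right; rewrite subnKC//.
  by rewrite -bigcup_seq; exists u.
have mK : measurable (Sn n @^-1` (~` K)).
  rewrite -[X in measurable X]setTI; apply: measurable_funP => //.
  apply: open_measurable_borel; apply: closed_openC.
  by apply: closed_chained => k u; have [] := KcP (k, u).
apply: (le_trans (measure_sigma_subadditive P (fun i => (FP i).1) mK sub)).
apply: le_trans (epsilon_trick0 xpredT (ltW e0)).
apply: lee_nneseries => [i _ _|i _]; first exact: measure_ge0.
exact: (FP i).2.
Qed.

End chaining.

(** * Bochner integrals and continuous functionals *)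

Section bochner.
Context d (T : measurableType d) (R : realType) (P : probability T R).
Context (E : completeNormedModType R).

Lemma simple_fun_expand (g : T -> E) (F : T -> E -> R) (w : T) : simple_fun g ->
  F w (g w) = \sum_(y <- fset_set (range g)) (\1_(g @^-1` [set y]) w * F w y).
Proof.
move=> [fg _]; have gw : g w \in fset_set (range g).
  by rewrite in_fset_set// inE; exists w.
rewrite (bigD1_seq (g w) gw (fset_uniq _))/= {1}indicE mem_set// mul1r big1 ?addr0// => y yg.
rewrite indicE memNset ?mul0r// => /= gy; move: yg; rewrite -gy eqxx//.
Qed.

(** The pointwise expansion over the finitely many values of [g] also applies to
    expressions like [`|f w - g w|], in which [g] is combined with another random
    element; measurability of the pair is not available without separability. *)
Lemma simple_fun_measurable (g : T -> E) (F : T -> E -> R) : simple_fun g ->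
  (forall y, measurable_fun setT (F^~ y)) -> measurable_fun setT (fun w => F w (g w)).
Proof.
move=> sg mF.
rewrite (_ : (fun w => _) = fun w =>
    \sum_(y <- fset_set (range g)) (\1_(g @^-1` [set y]) w * F w y)); last first.
  by apply/funext => w; exact: simple_fun_expand.
apply: measurable_sum => y; apply: measurable_funM => //.
by apply: measurable_indic; have [_] := sg; exact.
Qed.

Lemma simple_fun_norm_bounded (g : T -> E) : simple_fun g ->
  exists M : R, forall w, `|g w| <= M.
Proof.
move=> sg; exists (\sum_(y <- fset_set (range g)) `|y|) => w.
rewrite (simple_fun_expand (fun _ y => `|y|) w sg); apply: ler_sum => y _.
by rewrite indicE; case: (_ \in _); rewrite ?mul1r ?mul0r.
Qed.

Lemma simple_fun_bmf (g : T -> E) (L : E -> R) (K : R) : simple_fun g ->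
  (forall x, `|L x| <= K * `|x|) -> bmf (fun w => L (g w)).
Proof.
move=> sg LK; split; first exact: (simple_fun_measurable (F := fun _ y => L y) sg).
have [M gM] := simple_fun_norm_bounded sg.
exists (`|K| * M) => w; apply: le_trans (LK _) _.
by apply: (le_trans (ler_wpM2r _ (ler_norm K))) => //; rewrite ler_wpM2l.
Qed.

Lemma linear_simple_integral (g : T -> E) (L : {linear E -> R^o}) (K : R) :
  simple_fun g -> (forall x, `|L x| <= K * `|x|) ->
  \int[P]_w L (g w) = L (simple_integral P g).
Proof.
move=> sg LK; have [fg mg] := sg.
rewrite /simple_integral fsbig_finite// linear_sum.
transitivity (\int[P]_w (\sum_(y <- fset_set (range g)) (\1_(g @^-1` [set y]) w * L y))).
  by apply: eq_Rintegral => w _; rewrite (simple_fun_expand (fun _ y => L y) w sg).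
have bi (y : E) : bmf (fun w => \1_(g @^-1` [set y]) w * L y).
  by apply: bmfM; [exact: bmf_indic|exact: bmf_cst].
suff : forall s : seq E, bmf (fun w => \sum_(y <- s) (\1_(g @^-1` [set y]) w * L y)) /\
  \int[P]_w (\sum_(y <- s) (\1_(g @^-1` [set y]) w * L y)) =
  \sum_(y <- s) L (fine (P (g @^-1` [set y])) *: y) by move=> h; have [_] := h (fset_set (range g)).
elim=> [|y s [bs IHs]].
  split; first by under eq_fun do rewrite big_nil; exact: bmf_cst.
  by under eq_Rintegral do rewrite big_nil; rewrite bint_cst big_nil.
split; first by under eq_fun do rewrite big_cons; exact: bmfD.
under eq_Rintegral do rewrite big_cons.
rewrite bintD// IHs big_cons; congr (_ + _).
under eq_Rintegral do rewrite mulrC.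
rewrite bintZ ?bint_indic//; last exact: bmf_indic.
by rewrite linearZ /GRing.scale/= mulrC.
Qed.

Section random_element.
Context (f : {mfun T >-> borel E}).

Lemma measurable_continuous_rv (h : E -> R) : continuous h ->
  measurable_fun setT (fun w => h (f w)).
Proof.
by move=> ch; apply: (measurableT_comp (continuous_measurable_real ch)).
Qed.

Let continuous_dist (y : E) : continuous (fun x : E => `|x - y|).
Proof. by move=> x; apply: cvg_norm; apply: cvgB; [exact: cvg_id|exact: cvg_cst]. Qed.

Section approximation.
Context (s : nat -> T -> E) (fs : bochner_approx P (f : T -> E) s).

Let ss n : simple_fun (s n). Proof. by have [] := fs. Qed.

Let mdiff n : measurable_fun setT (fun w => `|(f w : E) - s n w|).
Proof.
apply: (simple_fun_measurable (F := fun w y => `|(f w : E) - y|)) => // y.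
by apply: (measurable_continuous_rv (h := fun x => `|x - y|)).
Qed.

Let mnorm : measurable_fun setT (fun w => `|f w : E|).
Proof.
by apply: (measurable_continuous_rv (h := fun x => `|x|)); exact: norm_continuous.
Qed.

Lemma bochner_approx_norm_integrable : P.-integrable setT (fun w => (`|f w : E|)%:E).
Proof.
have [_ _ s0] := fs.
have /fine_cvgP[[N _ Nfin] _] := s0.
have iN : P.-integrable setT (fun w => (`|(f w : E) - s N w|)%:E).
  apply/integrableP; split; first exact/measurable_EFinP.
  under eq_integral do rewrite gee0_abs ?lee_fin//.
  by rewrite -ge0_fin_numE ?integral_ge0//; exact: (Nfin N (leqnn N)).
have [M sM] := simple_fun_norm_bounded (ss N).
have iM : P.-integrable setT (fun w => (`|s N w|)%:E).
  apply: (@bmf_integrable _ _ _ P (fun w => `|s N w|)).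
  by apply: (simple_fun_bmf (L := fun x => `|x|) (K := 1)) => // x; rewrite mul1r normr_id.
apply: (le_integrable measurableT _ _ (integrableD measurableT iN iM)).
  exact/measurable_EFinP.
move=> w _; rewrite /= lee_fin normr_id ger0_norm ?addr_ge0//.
by rewrite -[f w : E](subrK (s N w)) (le_trans (ler_normD _ _))// subrK.
Qed.

Let a n : R := \int[P]_w `|(f w : E) - s n w|.

Let idiff n : P.-integrable setT (EFin \o (fun w => `|(f w : E) - s n w|)).
Proof.
have iM : P.-integrable setT (fun w => (`|s n w|)%:E).
  apply: (@bmf_integrable _ _ _ P (fun w => `|s n w|)).
  by apply: (simple_fun_bmf (L := fun x => `|x|) (K := 1)) => // x; rewrite mul1r normr_id.
apply: (le_integrable measurableT _ _ (integrableD measurableT bochner_approx_norm_integrable iM)).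
  exact/measurable_EFinP.
move=> w _; rewrite /= lee_fin normr_id ger0_norm ?addr_ge0//.
exact: ler_normB.
Qed.

Let a_cvg0 : a n @[n --> \oo] --> 0.
Proof. by have [_ _ s0] := fs; exact: (fine_cvg s0). Qed.

Lemma linear_rv_integrable (L : {linear E -> R^o}) (K : R) : continuous L ->
  (forall x, `|L x| <= K * `|x|) -> P.-integrable setT (EFin \o (fun w => L (f w))).
Proof.
move=> cL LK.
have iK : P.-integrable setT (fun w => (K%:E * (`|f w : E|)%:E)%E).
  by apply: integrableZl => //; exact: bochner_approx_norm_integrable.
apply: (le_integrable measurableT _ _ iK).
  by apply/measurable_EFinP; exact: (measurable_continuous_rv (h := L)).
by move=> w _; rewrite /= lee_fin (le_trans (LK _))// ler_norm.
Qed.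

Let approx_le (L : {linear E -> R^o}) (K : R) (n : nat) : continuous L ->
  (forall x, `|L x| <= K * `|x|) ->
  `|\int[P]_w L (f w) - L (simple_integral P (s n))| <= K * a n.
Proof.
move=> cL LK; rewrite -(linear_simple_integral (ss n) LK).
have iL := linear_rv_integrable cL LK.
have iLs := bmf_integrable P (simple_fun_bmf (ss n) LK).
rewrite -RintegralB//.
have iB : P.-integrable setT (EFin \o (fun w => L (f w) - L (s n w))).
  rewrite (_ : _ \o _ = (fun w => (EFin \o (fun w => L (f w))) w - (EFin \o (fun w => L (s n w))) w)%E).
    exact: integrableB.
  by apply/funext => w /=; rewrite EFinB.
apply: le_trans (le_normr_Rintegral measurableT iB) _.
rewrite -RintegralZl//; apply: le_Rintegral => //.
- by have := integrable_norm iB; congr (_.-integrable _ _).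
- rewrite (_ : _ \o _ = (fun w => (K%:E * (EFin \o (fun w => `|(f w : E) - s n w|%R)) w))%E).
    exact: integrableZl.
  by apply/funext => w /=; rewrite EFinM.
- by move=> w _; rewrite -linearB.
Qed.

Lemma linear_simple_integral_cvg (L : {linear E -> R^o}) (K : R) : continuous L ->
  (forall x, `|L x| <= K * `|x|) ->
  L (simple_integral P (s n)) @[n --> \oo] --> \int[P]_w L (f w).
Proof.
move=> cL LK; apply/cvgrPdist_le => e e0.
have e10 : 0 < e / (`|K| + 1) by rewrite divr_gt0// ltr_wpDl.
move/cvgr0Pnorm_le : a_cvg0 => /(_ _ e10); apply: filterS => n an.
apply: le_trans (approx_le n cL LK) _.
have K1 : 0 < `|K| + 1 by rewrite ltr_wpDl.
rewrite ler_pdivlMr// in an; apply: le_trans an; rewrite mulrC.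
have a0 : 0 <= a n by apply: Rintegral_ge0.
rewrite (ger0_norm a0) ler_wpM2l// (le_trans (ler_norm _))// lerDl//.
Qed.

(** The norm of the difference of two simple integrals is the value at it of a
    functional of norm one, to which the comparison with [\int L f] applies;
    this bounds it by [\int `|f - s n| + \int `|f - s N|]. *)
Lemma simple_integral_cvg : cvgn (fun n => simple_integral P (s n)).
Proof.
apply: cauchy_cvg; apply/cauchy_exP => e e0.
have e30 : 0 < e / 3 by rewrite divr_gt0.
have /cvgr0Pnorm_le/(_ _ e30)[N _ aN] := a_cvg0.
exists (simple_integral P (s N)); exists N => // n /= Nn.
have [L [cL LK Lv]] := norming_functional (simple_integral P (s N) - simple_integral P (s n)).
have LK1 x : `|L x| <= 1 * `|x| by rewrite mul1r.
rewrite -ball_normE/= -Lv linearB.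
have := approx_le n cL LK1; have := approx_le N cL LK1.
have := aN n Nn; have := aN N (leqnn N); rewrite /= !mul1r.
have a0 k : 0 <= a k by apply: Rintegral_ge0.
rewrite (ger0_norm (a0 n)) (ger0_norm (a0 N)) !ler_norml => a1 a2 /andP[? ?] /andP[? ?]; lra.
Qed.

End approximation.

(** Whichever approximating sequence defines the Bochner integral, the images
    under [L] of its simple integrals converge to [\int L f]. *)
Theorem linear_bochner_integral (L : {linear E -> R^o}) : continuous L ->
  bochner_integrable P (f : T -> E) ->
  P.-integrable setT (EFin \o (fun w => L (f w))) /\
  L (bochner_integral P (f : T -> E)) = \int[P]_w L (f w).
Proof.
move=> cL [s fs].
have [K LK] : exists K : R, forall x, `|L x| <= K * `|x|.
  have /linear_bounded_continuous/linear_boundedP[K [_ KP]] := cL.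
  by exists (K + 1) => x; apply: KP; rewrite ltrDl.
split; first exact: (linear_rv_integrable fs cL LK).
have : exists y : E, [set y | exists2 s, bochner_approx P (f : T -> E) s &
    simple_integral P (s n) @[n --> \oo] --> y] y.
  by exists (limn (fun n => simple_integral P (s n))), s => //; exact: (simple_integral_cvg fs).
move=> /getPex[s' fs' Is'].
have h1 := linear_simple_integral_cvg fs' cL LK.
have h2 : L (simple_integral P (s' n)) @[n --> \oo] --> L (bochner_integral P (f : T -> E)).
  by apply: (cvg_comp _ _ Is'); exact: cL.
exact: (cvg_unique _ h2 h1).
Qed.

End random_element.
End bochner.

(** * The central limit theorem in a Banach space *)

Lemma Rintegral_distribution d d' (T : measurableType d) (S : measurableType d')
    (R : realType) (P : probability T R) (X : {mfun T >-> S}) (f : S -> R) :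
  bmf f -> \int[distribution P X]_y f y = \int[P]_w f (X w).
Proof.
move=> bf; rewrite /Rintegral integral_distribution//.
  by apply/measurable_EFinP; have [] := bf.
exact: (bmf_integrable P (bmf_comp (measurable_funP X) bf)).
Qed.

Section clt_banach.
Context d (Omega : measurableType d) (R : realType) (P : probability Omega R).
Context (V : completeNormedModType R) (X : nat -> {RV P >-> borel V}).
Hypothesis iidX : iid X.
Hypothesis intX : forall i, bochner_integrable P (X i : Omega -> V).
Hypothesis X_L2 : P.-integrable [set: Omega] (fun w => (`|X 0%N w : V| ^+ 2)%:E).
Context (Sn : nat -> {RV P >-> borel V}).
Hypothesis SnE : forall n, {ae P, forall w, Sn n w =
  normalized_sum P (fun i => X i : Omega -> V) n.+1 w}.

Definition mean_rv (L : V -> R) : R := \int[P]_w L (X 0%N w).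

Definition variance_rv (L : V -> R) : R := \int[P]_w ((L (X 0%N w) - mean_rv L) ^+ 2).

Let mean_rvE (L : {linear V -> R^o}) i : continuous L ->
  \int[P]_w L (X i w) = mean_rv L.
Proof.
move=> cL; have mL := continuous_measurable_real cL.
have [iL _] := linear_bochner_integral (f := X i) cL (intX i).
have [iL0 _] := linear_bochner_integral (f := X 0%N) cL (intX 0%N).
have e j : P.-integrable setT (EFin \o (fun w => L (X j w))) ->
    (\int[P]_w (L (X j w))%:E = \int[distribution P (X j)]_x (L x)%:E)%E.
  by move=> iLj; rewrite integral_distribution//; exact/measurable_EFinP.
rewrite /mean_rv /Rintegral !e//; congr fine.
by apply: eq_measure_integral => A mA _; have [_ Xid] := iidX; exact: Xid.
Qed.

Lemma centered_square_integrable (L : {linear V -> R^o}) : continuous L ->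
  P.-integrable setT (fun w => ((L (X 0%N w) - mean_rv L) ^+ 2)%:E).
Proof.
move=> cL; set m := mean_rv L.
have [K K0 LK] : exists2 K : R, 0 <= K & forall x, `|L x| <= K * `|x|.
  have /linear_bounded_continuous/linear_boundedP[K [_ KP]] := cL.
  exists (`|K| + 1); first by rewrite addr_ge0.
  by move=> x; apply: KP; rewrite (le_lt_trans (ler_norm K))// ltrDl.
have iB : P.-integrable setT (fun w =>
    (2 * K ^+ 2 * `|X 0%N w : V| ^+ 2 + 2 * m ^+ 2)%:E).
  rewrite (_ : (fun w => _) = (fun w => (2 * K ^+ 2)%:E * (`|X 0%N w : V| ^+ 2)%:E +
      (EFin \o (fun=> (2 * m ^+ 2)%R)) w)%E).
    apply: integrableD => //; first exact: integrableZl.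
    exact: (bmf_integrable P (bmf_cst _ _)).
  by apply/funext => w /=; rewrite EFinD EFinM.
apply: (le_integrable measurableT _ _ iB).
  apply/measurable_EFinP; apply: measurable_funX; apply: measurable_funB => //.
  exact: (measurable_continuous_rv (X 0%N) cL).
move=> w _; rewrite lee_fin.
rewrite ger0_norm ?sqr_ge0// ger0_norm; last first.
  by apply: addr_ge0; apply: mulr_ge0; rewrite ?sqr_ge0// mulr_ge0// sqr_ge0.
have h : L (X 0%N w) ^+ 2 <= K ^+ 2 * `|X 0%N w : V| ^+ 2.
  rewrite -exprMn -(real_normK (num_real (L _))).
  by apply: lerXn2r (LK _); rewrite nnegrE ?mulr_ge0.
by have := sqr_ge0 (L (X 0%N w) + m); rewrite sqrrB sqrrD; lra.
Qed.

(** The real variables [L (X i) - mean_rv L] satisfy the hypotheses of the real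
    theorem, and their normalized sum is almost surely [L (Sn n)]. *)
Theorem clt_trig_banach (L : {linear V -> R^o}) (c : R) : continuous L ->
  \int[distribution P (Sn n)]_x cos (L x + c) @[n --> \oo] -->
    expR (- (variance_rv L / 2)) * cos c.
Proof.
move=> cL; have mL := continuous_measurable_real cL.
pose m := mean_rv L.
have mY i : measurable_fun setT (fun w => L (X i w) - m).
  by apply: measurable_funB => //; exact: (measurable_continuous_rv (X i) cL).
pose Y i : {RV P >-> R} := HB.pack_for {mfun Omega >-> R} (fun w => L (X i w) - m)
  (isMeasurableFun.Build _ _ _ _ (fun w => L (X i w) - m) (mY i)).
have mpre (A : set R) : measurable A -> measurable ([set x : V | A (L x - m)] : set (borel V)).
  move=> mA; have mLm : measurable_fun setT (fun x : borel V => L x - m).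
    exact: measurable_funB.
  by have := mLm measurableT A mA; rewrite setTI.
have iidY : iid Y.
  have [Xind Xid] := iidX; split.
    move=> J A mA; exact: (Xind J (fun i => [set x : V | A i (L x - m)]) (fun i => mpre _ (mA i))).
  by move=> i j A mA; exact: (Xid i j _ (mpre A mA)).
have [iL0 L0] := linear_bochner_integral (f := X 0%N) cL (intX 0%N).
have icst (k : R) : P.-integrable setT (EFin \o (fun=> k)).
  exact: (bmf_integrable P (bmf_cst _ k)).
have iY : P.-integrable setT (EFin \o Y 0%N).
  rewrite (_ : _ \o _ = (fun w => (EFin \o (fun w => L (X 0%N w))) w - (EFin \o (fun=> m)) w)%E).
    exact: integrableB.
  by apply/funext => w /=; rewrite EFinB.
have Y0 : \int[P]_w Y 0%N w = 0.
  rewrite /Y /= RintegralB// bint_cst.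
  by rewrite -/(mean_rv L) subrr.
have iY2 : P.-integrable setT (fun w => (Y 0%N w ^+ 2)%:E) := centered_square_integrable cL.
have := clt_trig (c := c) iidY iY Y0 iY2.
have -> : \int[P]_w (Y 0%N w ^+ 2) = variance_rv L by [].
suff e n : \int[distribution P (Sn n)]_x cos (L x + c) =
    \int[P]_w cos (c + (Num.sqrt n.+1%:R)^-1 * \sum_(i < n.+1) Y i w).
  by under [X in _ -> X @ _ --> _]eq_fun do rewrite e.
have bcos : bmf (fun x : borel V => cos (L x + c)).
  by apply/bcont_bmf/trigpoly_bcont; exact: trigpoly_cos.
rewrite Rintegral_distribution// /Rintegral; congr fine.
have mS : measurable_fun setT (fun w => cos (c + (Num.sqrt n.+1%:R)^-1 * \sum_(i < n.+1) Y i w)).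
  apply: (measurableT_comp (f := @cos R)).
    by apply: continuous_measurable_fun; exact: continuous_cos.
  by apply: measurable_funD => //; apply: measurable_funM => //; exact: measurable_sum.
apply: ae_eq_integral => //.
- by apply/measurable_EFinP; have [] := bmf_comp (measurable_funP (Sn n)) bcos.
- exact/measurable_EFinP.
apply: filterS (SnE n) => w Snw _; congr (cos _)%:E.
rewrite Snw addrC; congr (_ + _).
rewrite /normalized_sum linearZ linear_sum; congr (_ * _); apply: eq_bigr => i _.
rewrite linearB; congr (_ - _).
by have [_ ->] := linear_bochner_integral (f := X i) cL (intX i); exact: mean_rvE.
Qed.

(** The limit law exists by tightness and convergence of the trigonometric
    integrals; on it, the identity is the limiting random element. Applied to
    all multiples of a functional [L], the theorem above gives the trigonometric
    integrals of the law of [L], which are those of the normal law of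
    variance [variance_rv L], or of the Dirac mass when the variance is [0]. *)
Theorem clt_of_tight : uniformly_tight Sn ->
  exists (d' : measure_display) (Omega' : measurableType d')
    (P' : probability Omega' R) (G : {RV P' >-> borel V}),
    [/\ tight G, centered_gaussian G &
        weak_cvg (fun n => distribution P (Sn n)) (distribution P' G)].
Proof.
move=> tS.
have [| |nu [nut nuw nuc]] := @weak_cvg_of_trig R V (fun n => distribution P (Sn n)).
- move=> e e0; have [K cK KP] := tS e e0; exists K => // n.
  by apply: le_trans KP; apply: ereal_sup_ubound; exists n.
- move=> L c cL; apply/cvg_ex; exists (expR (- (variance_rv L / 2)) * cos c).
  exact: clt_trig_banach.
pose G : {RV nu >-> borel V} := HB.pack_for {mfun borel V >-> borel V} (@id (borel V))
  (isMeasurableFun.Build _ _ _ _ (@id (borel V)) (@measurable_id _ (borel V) setT)).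
exists _, (borel V), nu, G; split.
- move=> e e0; have [K cK KP] := nut e e0; exists K => //.
  by apply: ge_ereal_sup => _ [n _ <-].
- move=> L cL.
  exists (Num.sqrt (variance_rv L)); first exact: sqrtr_ge0.
  have v0 : 0 <= variance_rv L by apply: Rintegral_ge0 => w _; exact: sqr_ge0.
  have mL : measurable_fun setT (L : borel V -> measurableTypeR R).
    exact: continuous_measurable_real.
  pose Lm : {mfun borel V >-> measurableTypeR R} :=
    HB.pack_for {mfun borel V >-> measurableTypeR R} (L : borel V -> measurableTypeR R)
      (isMeasurableFun.Build _ _ _ _ (L : borel V -> measurableTypeR R) mL).
  have char t c : \int[distribution nu Lm]_x cos (t * x + c) =
      expR (- (t ^+ 2 * variance_rv L / 2)) * cos c.
    pose tL : {linear V -> R^o} := t \*: L.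
    have ctL : continuous tL by move=> x; apply: cvgZl_tmp; exact: cL.
    have vtL : variance_rv tL = t ^+ 2 * variance_rv L.
      have [iL0 _] := linear_bochner_integral (f := X 0%N) cL (intX 0%N).
      have mtL : mean_rv tL = t * mean_rv L by rewrite /mean_rv /= RintegralZl.
      rewrite /variance_rv mtL -RintegralZl//; last exact: centered_square_integrable.
      by apply: eq_Rintegral => w _; rewrite -exprMn mulrBr.
    rewrite Rintegral_distribution; last first.
      split; last by exists 1 => x; exact: cos_max.
      apply: (measurableT_comp (f := @cos R)).
        by apply: continuous_measurable_fun; exact: continuous_cos.
      by apply: measurable_funD => //; exact: measurable_funM.
    have := nuc _ (trigpoly_bcont (trigpoly_cos c ctL)).
    move=> /(cvg_unique (@norm_hausdorff _ R^o))/(_ (clt_trig_banach (c := c) ctL)) ->.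
    by rewrite vtL.
  pose sigma := Num.sqrt (variance_rv L); rewrite -/sigma => A mA.
  have identify (Q : probability (measurableTypeR R) R) :
      (forall t c, \int[Q]_x cos (t * x + c) = expR (- (t ^+ 2 * sigma ^+ 2 / 2)) * cos c) ->
      nu (Lm @^-1` A) = Q A.
    move=> Qchar; apply: (law_of_trig (Q1 := distribution nu Lm)) => // t c.
    by rewrite char Qchar sqr_sqrtr.
  case: eqVneq => [s0|s0].
    apply: (identify \d_(0 : measurableTypeR R)) => t c.
    rewrite s0 expr0n/= mulr0 mul0r oppr0 expR0 mul1r /Rintegral integral_dirac//.
      by rewrite diracT mul1e/= mulr0 add0r.
    apply/measurable_EFinP; apply: (measurableT_comp (f := @cos R)).
      by apply: continuous_measurable_fun; exact: continuous_cos.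
    by apply: measurable_funD => //; exact: measurable_funM.
  apply: (identify (normal_prob 0 sigma)) => t c.
  by rewrite gaussian_trig// [sigma ^+ 2 * _]mulrC.
- move=> f cf bf; have := nuw f cf bf.
  rewrite (_ : (\int[distribution nu G]_x (f x)%:E = \int[nu]_x (f x)%:E)%E)//.
Qed.

End clt_banach.

Theorem corollary5p1 (R : realType)
    (Theta : metricType R) (cTheta : compact [set: Theta])
    (E : completeNormedModType R)
    (d : measure_display) (Omega : measurableType d) (P : probability Omega R)
    (X : nat -> {RV P >-> borel (cspace E cTheta)})
    (iidX : iid X)
    (intX : forall i, bochner_integrable P (X i : Omega -> cspace E cTheta))
    (Sn : nat -> {RV P >-> borel (cspace E cTheta)})
    (SnE : forall n, {ae P, forall w, Sn n w =
       normalized_sum P (fun i => X i : Omega -> cspace E cTheta) n.+1 w})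
    (C t : R) (C_gt0 : 0 < C) (t_gt0 : 0 < t)
    (cover : forall eta : R, 0 < eta <= diameter Theta ->
       (covering_number Theta eta <= (C * eta `^ (- t))%:E)%E)
    (X_L2 : P.-integrable [set: Omega]
       (fun w => (`|X 0%N w : cspace E cTheta| ^+ 2)%:E))
    (Theta' : set Theta) (dTheta' : dense Theta')
    (tightS : forall theta, Theta' theta ->
       uniformly_tight (fun n => eval_rv (Sn n) theta))
    (M p q : R) (M_gt0 : 0 < M) (p_gt0 : 0 < p) (t_lt_q : t < q)
    (moment : forall theta vartheta : Theta,
       (ereal_sup (range (fun n =>
          'E_P[fun w => (`|(Sn n w : cspace E cTheta) theta
                           - (Sn n w : cspace E cTheta) vartheta| `^ p)%R]))
        <= (M * mdist theta vartheta `^ q)%:E)%E) :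
  exists (d' : measure_display) (Omega' : measurableType d')
    (P' : probability Omega' R) (G : {RV P' >-> borel (cspace E cTheta)}),
    [/\ tight G, centered_gaussian G &
        weak_cvg (fun n => distribution P (Sn n)) (distribution P' G)].
Proof.
apply: (clt_of_tight iidX intX X_L2 SnE).
exact: uniformly_tight_chaining C_gt0 t_gt0 p_gt0 t_lt_q M_gt0 cover dTheta' tightS moment.
Qed.
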